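(* Let $\psi:\mathbb{Z}^m\times\mathcal{S}^{n-1}\to[0,\infty)$ be Borel measurable with $\psi(b,t)\ge c_0|b|$ for all $b\in\mathbb{Z}^m$, $t\in\mathcal{S}^{n-1}$ (for some constant $c_0>0$) and $\psi(0,\cdot)=0$, and let $\bar\psi$ be its $\mathcal{H}^1$-elliptic envelope. Then the following hold, with a constant $c$ depending only on $\psi$: 1. For every polyhedral measure $\mu=\sum_{i=1}^N b_i\otimes t_i\,\mathcal{H}^1\llcorner\gamma_i\in\mathcal{M}_{\rm df}^{(m)}(B_{1/2})$ such that $\gamma_i\subset B_{1/2}$ are disjoint segments (up to the endpoints) and $\mathrm{supp}(\mu-b\otimes t\,\mathcal{H}^1\llcorner(t\mathbb{R}\cap B_{1/2}))\subset B_{1/2}$ (where $b\in\mathbb{Z}^m$, $t\in\mathcal{S}^{n-1}$), one has $$\bar\psi(b,t)\le\sum_{i=1}^N\mathcal{H}^1(\gamma_i)\bar\psi(b_i,t_i)=\bar E(\mu,B_{1/2}).$$ 2. For every $b\in\mathbb{Z}^m$, the function $$t\mapsto\bar\psi\Big(b,\frac{t}{|t|}\Big)|t|$$ is convex in $t\in\mathbb{R}^n$. In particular, $\bar\psi$ is continuous. 3. The function $\bar\psi$ is subadditive in its first argument, i.e., for all $b,b'\in\mathbb{Z}^m$, $t\in\mathcal{S}^{n-1}$, $$\bar\psi(b+b',t)\le\bar\psi(b,t)+\bar\psi(b',t).$$ 4. For all $b\in\mathbb{Z}^m$, $t\in\mathcal{S}^{n-1}$, $$\frac1c|b|\le\bar\psi(b,t)\le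 c|b|.$$ 5. The function $\bar\psi$ is Lipschitz continuous in the sense that, for all $b,b'\in\mathbb{Z}^m$ and $t,t'\in\mathcal{S}^{n-1}$, $$|\bar\psi(b,t)-\bar\psi(b',t')|\le c|b-b'|+c|b|\,|t-t'|.$$
   Context: $\mathcal{S}^{n-1}$ is the unit sphere of $\mathbb{R}^n$. For $\Omega\subset\mathbb{R}^n$ open, $\mathcal{M}(\Omega;\mathbb{R}^{m\times n})$ is the space of finite $\mathbb{R}^{m\times n}$-valued Radon measures on $\Omega$. A measure $\mu$ in it is divergence-free if $\sum_{j=1}^n\int_\Omega\partial_j\varphi\,d\mu_{ij}=0$ for all $\varphi\in C_c^\infty(\Omega)$ and $i=1,\dots,m$. $\mathcal{M}_{\rm df}^{(m)}(\Omega)$ is the set of divergence-free measures of the form $\mu=\theta\otimes\tau\,\mathcal{H}^1\llcorner\gamma$, where $\gamma\subset\Omega$ is $1$-rectifiable, $\tau:\gamma\to\mathcal{S}^{n-1}$ is its tangent vector, and $\theta:\gamma\to\mathbb{Z}^m$ is $\mathcal{H}^1$-integrable. The $\mathcal{H}^1$-elliptic envelope of $\psi$ is, for $b\in\mathbb{Z}^m$, $t\in\mathcal{S}^{n-1}$, $$\bar\psi(b,t)=\inf\Big\{\int_\gamma\psi(\theta,\tau)\,d\mathcal{H}^1:\ \mu=\theta\otimes\tau\,\mathcal{H}^1\llcorner\gamma\in\mathcal{M}_{\rm df}^{(m)}(B_{1/2}),\ \mathrm{supp}\big(\mu-b\otimes t\,\mathcal{H}^1\llcorner(\mathbb{R}t\cap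 B_{1/2})\big)\subset B_{1/2}\Big\},$$ where $B_{1/2}\subset\mathbb{R}^n$ is the ball of radius $1/2$ centered at $0$; a condition $\mathrm{supp}(\mu-b\otimes t\,\mathcal{H}^1\llcorner(\mathbb{R}t\cap B_{1/2}))\subset B_{1/2}$ means that there is a ball $B'\subset\subset B_{1/2}$ with $\mu=b\otimes t\,\mathcal{H}^1\llcorner\mathbb{R}t$ on $B_{1/2}\setminus B'$. For $\mu=\theta\otimes\tau\,\mathcal{H}^1\llcorner\gamma\in\mathcal{M}_{\rm df}^{(m)}(\Omega)$ and $\omega\subset\Omega$ open, $\bar E(\mu,\omega)=\int_{\gamma\cap\omega}\bar\psi(\theta,\tau)\,d\mathcal{H}^1$. In a polyhedral measure, $b_i\in\mathbb{Z}^m$ and $t_i\in\mathcal{S}^{n-1}$ is the tangent to the segment $\gamma_i$. The function in item 2 is the positively one-homogeneous extension of $\bar\psi(b,\cdot)$, equal to $0$ at $t=0$.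
   Formalization: The dimension is assumed to satisfy n ≥ 2; for n = 1 the claim is false: with m = 1 and ψ(b,t) = b² divergence-free measures on an interval are constant, so the envelope is b², and items 3, 4 and 5 fail. *)

(* Defs.v *)
From HB Require Import structures.
From mathcomp Require Import all_boot all_order all_algebra.
From mathcomp Require Import all_classical all_reals all_analysis.

Set Implicit Arguments.
Unset Strict Implicit.
Unset Printing Implicit Defensive.

Import Order.TTheory GRing.Theory Num.Theory.
Import numFieldNormedType.Exports.

Local Open Scope classical_set_scope.
Local Open Scope ring_scope.

(* R^n is 'rV[R]_n and Z^m is 'rV[int]_m. The library norm on 'rV[R]_n is the
   sup norm: it is used below only for topological notions (open, compact,
   Lipschitz, differentiable), which do not depend on the choice of the norm. *)

Section Euclidean.
Context {R : realType}.

Definition dot {n} (x y : 'rV[R]_n) : R := \sum_(i < n) x ord0 i * y ord0 i.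

Definition enorm {n} (x : 'rV[R]_n) : R := Num.sqrt (dot x x).

Definition zvec {m} (b : 'rV[int]_m) : 'rV[R]_m := map_mx intr b.

Definition sphere n : set 'rV[R]_n := [set t | enorm t = 1].

Definition eball {n} (x : 'rV[R]_n) (r : R) : set 'rV[R]_n :=
  [set y | enorm (y - x) < r].

Definition closed_eball {n} (x : 'rV[R]_n) (r : R) : set 'rV[R]_n :=
  [set y | enorm (y - x) <= r].

Definition Bhalf n : set 'rV[R]_n := eball 0 2^-1.

Definition line {n} (t : 'rV[R]_n) : set 'rV[R]_n := [set s *: t | s in setT].

Definition oseg {n} (p t : 'rV[R]_n) (l : R) : set 'rV[R]_n :=
  [set p + s *: t | s in `]0, l[].

End Euclidean.

Arguments sphere {R} n _.
Arguments Bhalf {R} n _.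

Definition borel (R : realType) (n : nat) :=
  g_sigma_algebraType [set U : set 'rV[R]_n | open U].

Section Hausdorff.
Context {R : realType} {n : nat}.
Implicit Types A C : set 'rV[R]_n.
Local Open Scope ereal_scope.

(* 0 is added so that the empty set has diameter 0 *)
Definition ediam C : \bar R :=
  ereal_sup [set z | z = 0 \/
                     exists x y, [/\ C x, C y & z = (enorm (x - y))%:E]].

Definition hausdorff1_cover (delta : R) A : set (set 'rV[R]_n)^nat :=
  [set F | (forall k, ediam (F k) <= delta%:E) /\ A `<=` \bigcup_k F k].

(* the constant omega_1 / 2 that normalizes H^1 is 1 *)
Definition hausdorff1_delta (delta : R) A : \bar R :=
  ereal_inf [set \sum_(k <oo) ediam (F k) | F in hausdorff1_cover delta A].

Definition hausdorff1 A : \bar R :=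
  ereal_sup [set hausdorff1_delta delta A | delta in [set d : R | (0 < d)%R]].

Lemma ediam_ge0 C : 0 <= ediam C.
Proof. by apply: ereal_sup_ubound; left. Qed.

#[local] Hint Resolve ediam_ge0 : core.

Lemma ediam0 : ediam set0 = 0.
Proof.
apply/eqP; rewrite eq_le ediam_ge0 andbT.
by apply: ge_ereal_sup => z /= [->|[x [y [[]]]]].
Qed.

Lemma hausdorff1_delta_ge0 d A : 0 <= hausdorff1_delta d A.
Proof.
apply: le_ereal_inf_tmp => _ [F _ <-].
by apply: nneseries_ge0 => k _ _; exact: ediam_ge0.
Qed.

Lemma hausdorff1_delta0 d : (0 < d)%R -> hausdorff1_delta d set0 = 0.
Proof.
move=> d0; apply/eqP; rewrite eq_le hausdorff1_delta_ge0 andbT.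
apply: ereal_inf_lbound; exists (fun=> set0).
  by split=> // k; rewrite ediam0 lee_fin ltW.
by rewrite eseries0// => k _ _; rewrite ediam0.
Qed.

Lemma le_hausdorff1_delta d : {homo hausdorff1_delta d : A B / A `<=` B >-> A <= B}.
Proof.
move=> A B AB; apply/ereal_inf_le_tmp => _ [F [Fd BF] <-].
by exists F => //; split => //; exact: subset_trans BF.
Qed.

Lemma hausdorff1_delta_sigma_subadditive d :
  sigma_subadditive (hausdorff1_delta d).
Proof.
move=> A; have [[i ioo]|] := pselect (exists i, hausdorff1_delta d (A i) = +oo).
  rewrite (eseries_pinfty _ _ ioo) ?leey// => k _.
  by rewrite -ltNye (lt_le_trans _ (hausdorff1_delta_ge0 _ _)).
rewrite -forallNE => Aoo.
suff add2e (e : {posnum R}) : hausdorff1_delta d (\bigcup_n A n) <=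
    \sum_(i <oo) hausdorff1_delta d (A i) + e%:num%:E.
  by apply/lee_addgt0Pr => _/posnumP[].
rewrite (le_trans _ (epsilon_trick _ _ _))//; last first.
  by move=> k; exact: hausdorff1_delta_ge0.
pose P k (B : (set 'rV[R]_n)^nat) := hausdorff1_cover d (A k) B /\
  \sum_(j <oo) ediam (B j) <=
  hausdorff1_delta d (A k) + (e%:num / (2 ^ k.+1)%:R)%:E.
have [G PG] : {G : ((set 'rV[R]_n)^nat)^nat & forall k, P k (G k)}.
  apply: (@choice _ _ P) => k; rewrite /P.
  have fk : hausdorff1_delta d (A k) \is a fin_num.
    by rewrite ge0_fin_numE ?hausdorff1_delta_ge0// ltey; exact/eqP/Aoo.
  have ek : (0 < e%:num / (2 ^ k.+1)%:R :> R)%R by [].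
  have [_ [B cB <-] Be] := lb_ereal_inf_adherent ek fk.
  by exists B; split => //; exact/ltW.
have muG_ge0 x : 0 <= (ediam \o uncurry G) x by exact: ediam_ge0.
apply: (@le_trans _ _ (\esum_(i in setT) (ediam \o uncurry G) i)).
  apply: ereal_inf_lbound => /=.
  have /card_esym/ppcard_eqP[f] := card_nat2.
  exists (uncurry G \o f).
    split => [i|].
      by rewrite /= /uncurry; case: (f i) => a b; exact: (PG a).1.1.
    apply: (@subset_trans _ (\bigcup_n \bigcup_k G n k)) => [t [i _]|].
      by move=> /((PG i).1.2) -[j _ ?]; exists i => //; exists j.
    move=> t [i _ [j _ Bijt]]; exists (f^-1%FUN (i, j)) => //=.
    by rewrite invK ?inE.
  rewrite -(esum_pred_image (ediam \o uncurry G) _ xpredT) ?[fun=> _]set_true//.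
  by rewrite image_eq.
rewrite (_ : esum _ _ = \sum_(i <oo) \sum_(j <oo) ediam (G i j)); last first.
  pose J : nat -> set (nat * nat) := fun i => [set (i, j) | j in setT].
  rewrite (_ : setT = \bigcup_k J k); last first.
    by rewrite predeqE => -[a b]; split => // _; exists a => //; exists b.
  rewrite esum_bigcupT /=; last 2 first.
    - apply/trivIsetP => i j _ _ ij.
      rewrite predeqE => -[k l] /=; split => //= -[] [_] _ [<-{k} _].
      by move=> [m' _] [] /esym/eqP; rewrite (negbTE ij).
    - by move=> /= [k l]; exact: ediam_ge0.
  rewrite -(image_id [set: nat]) -fun_true esum_pred_image//; last first.
    by move=> k _; apply: esum_ge0 => p _; exact: ediam_ge0.
  apply: eq_eseriesr => /= j _.
  rewrite -(esum_pred_image (ediam \o uncurry G) (pair j) predT)//=; last first.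
    by move=> ? ? _ _; exact: (@can_inj _ _ _ snd).
  by congr esum; rewrite predeqE => -[a b]; split; move=> [i _ <-]; exists i.
apply: lee_nneseries => [k _ _|k _]; last exact: (PG k).2.
by apply: nneseries_ge0 => j _ _; exact: ediam_ge0.
Qed.

Lemma hausdorff1_ge0 A : 0 <= hausdorff1 A.
Proof.
apply: (le_trans (hausdorff1_delta_ge0 1%R A)).
by apply: ereal_sup_ubound; exists 1%R => //=.
Qed.

Lemma hausdorff10 : hausdorff1 set0 = 0.
Proof.
apply/eqP; rewrite eq_le hausdorff1_ge0 andbT.
by apply: ge_ereal_sup => _ [d d0 <-]; rewrite hausdorff1_delta0.
Qed.

Lemma le_hausdorff1 : {homo hausdorff1 : A B / A `<=` B >-> A <= B}.
Proof.
move=> A B AB; apply: ge_ereal_sup => _ [d d0 <-].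
apply: (le_trans (le_hausdorff1_delta d AB)).
by apply: ereal_sup_ubound; exists d.
Qed.

Lemma hausdorff1_sigma_subadditive : sigma_subadditive hausdorff1.
Proof.
move=> A; apply: ge_ereal_sup => _ [d d0 <-].
apply: (le_trans (hausdorff1_delta_sigma_subadditive d A)).
apply: lee_nneseries => [k _ _|k _]; first exact: hausdorff1_delta_ge0.
by apply: ereal_sup_ubound; exists d.
Qed.

HB.instance Definition _ := isOuterMeasure.Build R 'rV[R]_n hausdorff1
  hausdorff10 hausdorff1_ge0 le_hausdorff1 hausdorff1_sigma_subadditive.

End Hausdorff.

Definition H1_outer (R : realType) (n : nat) :
  {outer_measure set 'rV[R]_n -> \bar R} := @hausdorff1 R n.

(* R^n with the sigma-algebra of H^1-measurable sets (in the sense of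
   Caratheodory), which contains the Borel sets *)
Notation H1space R n := (caratheodory_type (H1_outer R n)).

Definition H1 {R : realType} {n : nat} : {measure set (H1space R n) -> \bar R} :=
  (H1_outer R n : set (H1space R n) -> \bar R).

Section Rectifiable.
Context {R : realType} {n : nat}.
Implicit Types (gamma : set 'rV[R]_n) (x v : 'rV[R]_n).

Definition rectifiable1 gamma : Prop :=
  [/\ measurable (gamma : set (H1space R n)),
      (H1 gamma < +oo)%E
    & exists f : nat -> R -> 'rV[R]_n,
        (forall k, lipschitz (f k : R^o -> 'rV[R]_n)) /\
        H1 (gamma `\` \bigcup_k range (f k)) = 0%E].

(* the open cone with vertex x, axis R v and opening s, for v a unit vector:
   points whose distance to the line x + R v is less than s times the distance
   to x *)
Definition cone x v (s : R) : set 'rV[R]_n :=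
  [set y | enorm (y - x - dot (y - x) v *: v) < s * enorm (y - x)].

(* The line R v is the approximate tangent line of gamma at x: gamma has
   positive upper H^1-density at x, and the part of gamma outside any cone
   around x + R v has H^1-density 0 at x. *)
Definition approx_tangent gamma x v : Prop :=
  (0 < limf_esup (fun r : R => H1 (gamma `&` closed_eball x r) * ((2 * r)^-1)%:E)
         0^'+)%E /\
  forall s : R, 0 < s < 1 ->
    ((fun r : R => H1 ((gamma `&` closed_eball x r) `\` cone x v s) * (r^-1)%:E)
       @ 0^'+ --> 0)%E.

End Rectifiable.

Section Measures.
Context {R : realType} {m n : nat}.

(* M(Omega; R^{m x n}): matrix-valued measures are given as set functions, to
   be evaluated on Borel subsets of Omega *)
Definition vmeasure := set 'rV[R]_n -> 'M[R]_(m, n).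

Definition eq_vmeasure_on (omega : set 'rV[R]_n) (mu nu : vmeasure) : Prop :=
  forall A : set 'rV[R]_n,
    measurable (A : set (borel R n)) -> A `<=` omega -> mu A = nu A.

Definition tensor (b : 'rV[int]_m) (t : 'rV[R]_n) : 'M[R]_(m, n) :=
  (zvec b)^T *m t.

(* b (x) t H^1 restricted to gamma, for constant b and t *)
Definition const_vmeasure b t (gamma : set 'rV[R]_n) : vmeasure :=
  fun A => fine (H1 (gamma `&` A)) *: tensor b t.

Record current := Current {
  carrier : set 'rV[R]_n ;
  mult : 'rV[R]_n -> 'rV[int]_m ;   (* theta, relevant on carrier only *)
  tang : 'rV[R]_n -> 'rV[R]_n       (* tau, relevant on carrier only *)
}.

(* theta (x) tau H^1 restricted to gamma *)
Definition vmeasure_of (d : current) : vmeasure := fun A =>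
  \matrix_(i < m, j < n)
    \int[H1]_(x in (carrier d `&` A : set (H1space R n)))
       (tensor (mult d x) (tang d x) i j).

Definition partial (j : 'I_n) (phi : 'rV[R]_n -> R) : 'rV[R]_n -> R :=
  fun x => 'D_(delta_mx ord0 j) (phi : 'rV[R]_n -> R^o) x.

(* C^infinity: the iterated partial derivatives of all orders are
   differentiable (hence continuous) *)
Definition smooth (phi : 'rV[R]_n -> R) : Prop :=
  forall (s : seq 'I_n) (x : 'rV[R]_n),
    differentiable (foldr partial phi s : 'rV[R]_n -> R^o) x.

Definition test_function (Omega : set 'rV[R]_n) (phi : 'rV[R]_n -> R) : Prop :=
  smooth phi /\
  exists K : set 'rV[R]_n,
    [/\ compact K, K `<=` Omega & forall x, ~ K x -> phi x = 0].

(* The integral of partial j phi with respect to the component mu_ij of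
   mu = theta (x) tau H^1 |_ gamma is that of partial j phi * theta_i * tau_j
   over gamma with respect to H^1. *)
Definition divergence_free (Omega : set 'rV[R]_n) (d : current) : Prop :=
  forall (phi : 'rV[R]_n -> R) (i : 'I_m), test_function Omega phi ->
    \sum_(j < n)
      \int[H1]_(x in (carrier d `&` Omega : set (H1space R n)))
        (partial j phi x * tensor (mult d x) (tang d x) i j) = 0.

(* d represents an element of M_df^(m)(Omega). *)
Definition Mdf (Omega : set 'rV[R]_n) (d : current) : Prop :=
  [/\ rectifiable1 (carrier d) /\ carrier d `<=` Omega,
      [/\ forall x, carrier d x -> sphere n (tang d x),
          forall j, measurable_fun (carrier d : set (H1space R n))
                      (fun x => tang d x ord0 j)
        & {ae H1, forall x : H1space R n,
             carrier d x -> approx_tangent (carrier d) x (tang d x)}],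
      forall i, H1.-integrable (carrier d : set (H1space R n))
                  (fun x => (zvec (mult d x) ord0 i)%:E)
    & divergence_free Omega d].

(* supp (mu - b (x) t H^1 |_ (R t `&` B_{1/2})) is contained in B_{1/2} *)
Definition straight_near_boundary (mu : vmeasure) b t : Prop :=
  exists (y : 'rV[R]_n) (r : R),
    [/\ 0 < r, closed_eball y r `<=` Bhalf n
      & eq_vmeasure_on (Bhalf n `\` eball y r)
          mu (const_vmeasure b t (line t `&` Bhalf n))].

(* integral of f(theta, tau) over the part of gamma in omega *)
Definition energy (f : 'rV[int]_m -> 'rV[R]_n -> \bar R) (d : current)
    (omega : set 'rV[R]_n) : \bar R :=
  (\int[H1]_(x in (carrier d `&` omega : set (H1space R n)))
     f (mult d x) (tang d x))%E.

(* The H^1-elliptic envelope, as an element of [0, +oo]. *)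
Definition envelope (psi : 'rV[int]_m -> 'rV[R]_n -> R)
    (b : 'rV[int]_m) (t : 'rV[R]_n) : \bar R :=
  ereal_inf [set energy (fun b' t' => (psi b' t')%:E) d (Bhalf n) | d in
    [set d | Mdf (Bhalf n) d /\ straight_near_boundary (vmeasure_of d) b t]].

Definition Ebar psi (d : current) (omega : set 'rV[R]_n) : \bar R :=
  energy (envelope psi) d omega.

(* For t = 0 this is 0 whatever the value of the envelope at 0^-1 *: 0 = 0. *)
Definition envelope_ext psi (b : 'rV[int]_m) (t : 'rV[R]_n) : R :=
  fine (envelope psi b ((enorm t)^-1 *: t)) * enorm t.

(* sum of the b_i (x) t_i H^1 |_ gamma_i *)
Definition poly_vmeasure N (b_ : 'I_N -> 'rV[int]_m) (t_ : 'I_N -> 'rV[R]_n)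
    (gamma_ : 'I_N -> set 'rV[R]_n) : vmeasure :=
  fun A => \sum_(i < N) const_vmeasure (b_ i) (t_ i) (gamma_ i) A.

End Measures.

Arguments current : clear implicits.
Arguments vmeasure : clear implicits.

(* Main.v *)
Require Import Defs.
From HB Require Import structures.
From mathcomp Require Import all_boot all_order all_algebra.
From mathcomp Require Import all_classical all_reals all_analysis.
From mathcomp Require Import measurable_realfun.
From mathcomp Require Import ring lra zify.

Set Implicit Arguments.
Unset Strict Implicit.
Unset Printing Implicit Defensive.

Import Order.TTheory GRing.Theory Num.Theory.
Import numFieldNormedType.Exports.

Local Open Scope classical_set_scope.
Local Open Scope ring_scope.

(** Everything rests on item 1, which is a replacement argument. Let a polyhedral current be a
    competitor for (b, t). Away from its finitely many vertices it is locally a straight line with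
    constant multiplicity b_i and direction t_i ([polyhedral_straight_in]). In a small ball of
    radius r centred on such a piece, the diameter is exchanged for a copy, scaled by 2r, of an
    almost optimal competitor s for (b_i, t_i) ([glue], [admissible_glue]). The result is still
    divergence-free: a competitor and the straight segment have the same pairing with the gradient
    of every smooth function, compactly supported in the ball or not, because a cutoff splits this
    function into a test function and a function that vanishes where the two currents may differ
    ([pairing_eq]). The energy changes by 2r times the difference between the energy of s and
    psi(b_i, t_i) ([glue_energy]). By Vitali's theorem, finitely many disjoint balls exhaust the
    length of each segment up to an arbitrarily small error ([vitali_intervals]), and performing all
    the replacements gives the inequality ([replace_in_balls], [envelope_polyhedral]).

    Items 2 and 3 come from a single configuration of five segments. On the piece from 0 to k(t1 +
    t2) of a straight line that carries b + b', the share b' takes the detour along k t1 and then k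
    t2. If f is the one-homogeneous extension of the envelope, item 1 yields f(b + b', t1 + t2) <=
    f(b, t1 + t2) + f(b', t1) + f(b', t2) for independent t1, t2 ([envelope_ext_triangle]). With b =
    0 this is subadditivity in t, that is, convexity by homogeneity. With t1 and t2 equal to t/2 + d
    e and t/2 - d e, and d tending to 0, it is subadditivity in b; a direction e independent of t
    exists because n > 1.

    The upper bound of item 4 follows from subadditivity in both arguments and the finitely many
    values at signed basis vectors. For the lower bound the coordinate functions serve as a
    calibration: testing a competitor with x_k shows that theta_i tau_k has integral b_i t_k
    ([energy_lower_bound]). Item 5 combines both subadditivities with the upper bound.

    The equality in item 1 concerns an arbitrary representation of the polyhedral measure by theta,
    tau and gamma. The measure determines the matrix of theta and tau up to an H^1-null set
    ([density_ae]), a nonzero such matrix determines its factors up to a common sign ([tensor_eq]),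
    and the envelope is invariant under that change of sign ([envelopeN]).

    The groundwork develops H^1 from its definition: measurability of Borel sets, Borel regularity,
    scaling, and agreement with Lebesgue measure on lines. *)

Lemma continuous_big_sum (R : realType) (T : topologicalType) (I : Type)
    (s : seq I) (F : I -> T -> R^o) :
  (forall i, continuous (F i)) ->
  continuous (fun x => \sum_(i <- s) F i x : R^o).
Proof.
move=> cF; elim: s => [|i s IH] x.
  by under eq_fun do rewrite big_nil; exact: cvg_cst.
by under eq_fun do rewrite big_cons; apply: cvgD; [exact: cF|exact: IH].
Qed.

Lemma continuous_mul (R : realType) (T : topologicalType) (f g : T -> R^o) :
  continuous f -> continuous g -> continuous (fun x => f x * g x : R^o).
Proof. by move=> cf cg x; apply: cvgM; [exact: cf|exact: cg]. Qed.

Lemma subr_continuous (R : realType) (V : normedModType R) (y : V) :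
  continuous (fun x : V => x - y).
Proof. by move=> x; apply: cvgB; [exact: cvg_id|exact: cvg_cst]. Qed.

(** * The Euclidean norm on row vectors and its topology *)

Section EuclideanFacts.
Context {R : realType} {n : nat}.
Implicit Types (x y z v : 'rV[R]_n) (a r : R).

Lemma dotC x y : dot x y = dot y x.
Proof. by apply: eq_bigr => i _; rewrite mulrC. Qed.

Lemma dotDl x y z : dot (x + y) z = dot x z + dot y z.
Proof. by rewrite -big_split; apply: eq_bigr => i _; rewrite mxE mulrDl. Qed.

Lemma dotZl a x y : dot (a *: x) y = a * dot x y.
Proof. by rewrite mulr_sumr; apply: eq_bigr => i _; rewrite mxE mulrA. Qed.

Lemma dotNl x y : dot (- x) y = - dot x y.
Proof. by rewrite -scaleN1r dotZl mulN1r. Qed.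

Lemma dotBl x y z : dot (x - y) z = dot x z - dot y z.
Proof. by rewrite dotDl dotNl. Qed.

Lemma dotDr x y z : dot z (x + y) = dot z x + dot z y.
Proof. by rewrite !(dotC z) dotDl. Qed.

Lemma dotZr a x y : dot x (a *: y) = a * dot x y.
Proof. by rewrite !(dotC x) dotZl. Qed.

Lemma dotNr x y : dot x (- y) = - dot x y.
Proof. by rewrite !(dotC x) dotNl. Qed.

Lemma dotBr x y z : dot z (x - y) = dot z x - dot z y.
Proof. by rewrite dotDr dotNr. Qed.

Lemma dot0l x : dot 0 x = 0.
Proof. by rewrite -(scale0r x) dotZl mul0r. Qed.

Lemma dot_ge0 x : 0 <= dot x x.
Proof. by apply: sumr_ge0 => i _; rewrite -expr2 sqr_ge0. Qed.

Lemma dot_eq0 x : dot x x = 0 -> x = 0.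
Proof.
move=> /eqP; rewrite psumr_eq0 => [/allP x0|i _]; last by rewrite -expr2 sqr_ge0.
apply/rowP => i; rewrite mxE; apply/eqP.
by have := x0 i (mem_index_enum _); rewrite mulf_eq0 orbb.
Qed.

Lemma enorm_ge0 x : 0 <= enorm x.
Proof. exact: sqrtr_ge0. Qed.

Lemma enorm_sqr x : enorm x ^+ 2 = dot x x.
Proof. by rewrite sqr_sqrtr// dot_ge0. Qed.

Lemma enorm0 : enorm (0 : 'rV[R]_n) = 0.
Proof. by rewrite /enorm dot0l sqrtr0. Qed.

Lemma enorm_eq0 x : enorm x = 0 -> x = 0.
Proof. by move=> x0; apply: dot_eq0; rewrite -enorm_sqr x0 expr0n. Qed.

Lemma enorm_gt0 x : x != 0 -> 0 < enorm x.
Proof.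
move=> x0; rewrite lt_neqAle enorm_ge0 andbT eq_sym.
by apply: contra_neq x0; exact: enorm_eq0.
Qed.

Lemma enormZ a x : enorm (a *: x) = `|a| * enorm x.
Proof.
by rewrite /enorm dotZl dotZr mulrA -expr2 sqrtrM ?sqr_ge0// sqrtr_sqr.
Qed.

Lemma enormN x : enorm (- x) = enorm x.
Proof. by rewrite -scaleN1r enormZ normrN1 mul1r. Qed.

Lemma enormB x y : enorm (x - y) = enorm (y - x).
Proof. by rewrite -enormN opprB. Qed.

Lemma dot_le x y : dot x y <= enorm x * enorm y.
Proof.
have [->|y0] := eqVneq y 0; first by rewrite dotC dot0l enorm0 mulr0.
have [xy0|xy0] := leP (dot x y) 0.
  by apply: le_trans xy0 _; rewrite mulr_ge0// enorm_ge0.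
rewrite -(@ler_pXn2r _ 2)// ?nnegrE ?mulr_ge0 ?enorm_ge0 ?(ltW xy0)//.
rewrite exprMn !enorm_sqr.
have yy : 0 < dot y y by rewrite -enorm_sqr exprn_gt0// enorm_gt0.
have := dot_ge0 (x - (dot x y / dot y y) *: y).
set c := dot x y / dot y y.
have cy : c * dot y y = dot x y by rewrite divfK ?gt_eqF.
rewrite !(dotBl, dotBr, dotZl, dotZr) (dotC y x) cy subrr ?mulr0 subr0.
by rewrite subr_ge0 /c mulrAC ler_pdivrMr// -expr2.
Qed.

Lemma dot_norm_le x y : `|dot x y| <= enorm x * enorm y.
Proof. by rewrite ler_norml dot_le andbT lerNl -dotNl -(enormN x) dot_le. Qed.

Lemma enormD x y : enorm (x + y) <= enorm x + enorm y.
Proof.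
rewrite -(@ler_pXn2r _ 2)// ?nnegrE ?addr_ge0 ?enorm_ge0//.
rewrite enorm_sqr sqrrD !enorm_sqr !(dotDl, dotDr) (dotC y x).
have := dot_le x y; lra.
Qed.

Lemma enorm_triangle y x z : enorm (x - z) <= enorm (x - y) + enorm (y - z).
Proof. by have := enormD (x - y) (y - z); rewrite addrA subrK. Qed.

Lemma coord_enorm x i : `|x ord0 i| <= enorm x.
Proof.
rewrite -sqrtr_sqr ler_wsqrtr// /dot (bigD1 i)//= -expr2 lerDl.
by apply: sumr_ge0 => j _; rewrite -expr2 sqr_ge0.
Qed.

Lemma row_sum_coord x : x = \sum_(i < n) x ord0 i *: delta_mx ord0 i.
Proof. exact: row_sum_delta. Qed.

Lemma enorm_delta (i : 'I_n) : enorm (delta_mx ord0 i : 'rV[R]_n) = 1.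
Proof.
rewrite /enorm /dot (bigD1 i)//= big1 ?addr0 => [|j ji].
  by rewrite mxE !eqxx mulr1 sqrtr1.
by rewrite mxE (negPf ji) andbF mulr0.
Qed.

Lemma dot_delta x (i : 'I_n) : dot x (delta_mx ord0 i) = x ord0 i.
Proof.
rewrite /dot (bigD1 i)//= big1 ?addr0 => [|j ji].
  by rewrite mxE !eqxx mulr1.
by rewrite mxE (negPf ji) andbF mulr0.
Qed.

Lemma enorm_sum (I : Type) (s : seq I) (F : I -> 'rV[R]_n) :
  enorm (\sum_(i <- s) F i) <= \sum_(i <- s) enorm (F i).
Proof.
elim: s => [|i s IH]; first by rewrite !big_nil enorm0.
by rewrite !big_cons (le_trans (enormD _ _))// lerD2l.
Qed.

Lemma enorm_le_sum x : enorm x <= \sum_(i < n) `|x ord0 i|.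
Proof.
rewrite {1}(row_sum_coord x) (le_trans (enorm_sum _ _))// ler_sum// => i _.
by rewrite enormZ enorm_delta mulr1.
Qed.

Lemma norm_le_enorm x : `|x| <= enorm x.
Proof.
rewrite [leLHS]mx_normrE; apply/bigmax_leP; split; first exact: enorm_ge0.
by move=> [i j] _ /=; rewrite ord1; exact: coord_enorm.
Qed.

Lemma coord_norm x (i : 'I_n) : `|x ord0 i| <= `|x|.
Proof.
rewrite [leRHS]mx_normrE.
exact: (le_bigmax _ (fun ij : 'I_1 * 'I_n => `|x ij.1 ij.2|) (ord0, i)).
Qed.

Lemma enorm_le_norm x : enorm x <= n%:R * `|x|.
Proof.
rewrite (le_trans (enorm_le_sum x))//.
rewrite (le_trans (ler_sum _ (fun i _ => coord_norm x i)))//.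
by rewrite sumr_const card_ord mulr_natl.
Qed.

Lemma dot_continuous v : continuous (fun x : 'rV[R]_n => dot x v : R^o).
Proof.
apply: continuous_big_sum => i; apply: continuous_mul.
  exact: coord_continuous.
exact: cst_continuous.
Qed.

Lemma dot2_continuous : continuous (fun x : 'rV[R]_n => dot x x : R^o).
Proof.
by apply: continuous_big_sum => i; apply: continuous_mul; exact: coord_continuous.
Qed.

Lemma enorm_continuous : continuous (fun x : 'rV[R]_n => enorm x : R^o).
Proof.
move=> x; apply: (@continuous_comp _ _ _ (fun x : 'rV[R]_n => dot x x : R^o) (Num.sqrt : R^o -> R^o)).
  exact: dot2_continuous.
exact: sqrt_continuous.
Qed.

Lemma enormB_continuous y : continuous (fun x : 'rV[R]_n => enorm (x - y) : R^o).
Proof.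
move=> x; apply: (@continuous_comp _ _ _ (fun x : 'rV[R]_n => x - y)).
  exact: subr_continuous.
exact: enorm_continuous.
Qed.

Lemma open_eball x r : open (eball x r).
Proof.
rewrite (_ : eball x r = (fun y => enorm (y - x) : R^o) @^-1` [set s | s < r])//.
by apply: open_comp => [y _|]; [exact: enormB_continuous|exact: open_lt].
Qed.

Lemma closed_closed_eball x r : closed (closed_eball x r).
Proof.
rewrite (_ : closed_eball x r = (fun y => enorm (y - x) : R^o) @^-1` [set s | s <= r])//.
by apply: closed_comp => [y _|]; [exact: enormB_continuous|exact: closed_le].
Qed.

Lemma compact_closed_eball x r : compact (closed_eball x r).
Proof.
apply: bounded_closed_compact; last exact: closed_closed_eball.
exists (r + enorm x); split; first exact: num_real.
move=> M rM y /=; rewrite /closed_eball/= => yr.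
apply: le_trans (norm_le_enorm y) _; apply: le_trans (ltW rM).
by have := enormD (y - x) x; rewrite subrK; move: yr; lra.
Qed.

Lemma eball_ball x r : 0 < r -> exists2 e : R, 0 < e & ball x e `<=` eball x r.
Proof.
move=> r0; exists (r / n.+1%:R); first by rewrite divr_gt0.
move=> y; rewrite -ball_normE /= distrC => yx.
rewrite /eball/= (le_lt_trans (enorm_le_norm _))//.
rewrite (@le_lt_trans _ _ (n.+1%:R * `|y - x|))//.
  by rewrite ler_wpM2r// ler_nat.
by rewrite mulrC -ltr_pdivlMr.
Qed.

Lemma open_eballP (U : set 'rV[R]_n) x : open U -> U x ->
  exists2 r : R, 0 < r & eball x r `<=` U.
Proof.
move=> oU Ux; have /nbhs_ballP[e /= e0 eU] : nbhs x U by exact: open_nbhs_nbhs.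
exists e => // y; rewrite /eball/= => yx; apply: eU.
by rewrite -ball_normE /= distrC (le_lt_trans (norm_le_enorm _)).
Qed.

Lemma eball_nbhs x r : 0 < r -> nbhs x (eball x r).
Proof.
move=> r0; apply: open_nbhs_nbhs; split; first exact: open_eball.
by rewrite /eball/= subrr enorm0.
Qed.

End EuclideanFacts.

(** * Closure properties of smooth functions *)

Section SmoothFunctions.
Context {R : realType} {n : nat}.
Implicit Types (f g : 'rV[R]_n -> R) (x y : 'rV[R]_n) (j : 'I_n).

(** Smoothness of finite order, recursive in the order, so that sums, products, inverses and
    compositions can be treated by induction. *)
Fixpoint smoothN (k : nat) f : Prop :=
  (forall x, differentiable (f : 'rV[R]_n -> R^o) x) /\
  (if k is k'.+1 then forall j, smoothN k' (partial j f) else True).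

Lemma smoothN_diff k f x : smoothN k f -> differentiable (f : 'rV[R]_n -> R^o) x.
Proof. by case: k => [|k] []. Qed.

Lemma smooth_partial j f : smooth f -> smooth (partial j f).
Proof. by move=> sf s x; have := sf (rcons s j) x; rewrite -cats1 foldr_cat. Qed.

Lemma smooth_smoothN f : smooth f <-> forall k, smoothN k f.
Proof.
split=> [sf k|sf s x].
  elim: k f sf => [|k IH] f sf; split=> //; try by move=> x; exact: (sf [::]).
  by move=> j; exact/IH/smooth_partial.
(* [foldr] applies the last index of the list first, while [smoothN] peels off the innermost
   derivative; hence the induction from the right end. *)
elim/last_ind: s f sf => [|s j IH] f sf; first exact: smoothN_diff (sf 0%N).
by rewrite -cats1 foldr_cat; apply: IH => k; exact: (sf k.+1).2.
Qed.

Lemma smoothN_pred k f : smoothN k.+1 f -> smoothN k f.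
Proof.
elim: k f => [|k IH] f [df sf]; split => // j.
by apply: IH; exact: sf.
Qed.

Lemma partial_cst j (c : R) : partial j (cst c) = cst 0.
Proof. by apply/funext => x; rewrite /partial derive_cst. Qed.

Lemma smoothN_cst k (c : R) : smoothN k (cst c).
Proof.
elim: k c => [|k IH] c; split => //; try by move=> x; exact: differentiable_cst.
by move=> j; rewrite partial_cst.
Qed.

Lemma partial_coord j (i : 'I_n) :
  partial j (fun x => x ord0 i) = cst ((delta_mx ord0 j : 'rV[R]_n) ord0 i).
Proof.
apply/funext => x; rewrite /partial deriveE; last exact: differentiable_coord.
have @f : {linear 'rV[R]_n -> R^o}.
  by exists (fun y : 'rV[R]_n => y ord0 i); do 2![eexists]; do ?[constructor];
    rewrite ?mxE// => ? *; rewrite ?mxE//; move=> ?; rewrite !mxE.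
by rewrite (_ : (fun _ => _) = f)// diff_lin//; exact: coord_continuous.
Qed.

Lemma smoothN_coord k (i : 'I_n) : smoothN k (fun x => x ord0 i).
Proof.
case: k => [|k]; split => //; try by move=> x; exact: differentiable_coord.
by move=> j; rewrite partial_coord; exact: smoothN_cst.
Qed.

Lemma partialD j f g : (forall x, differentiable (f : 'rV[R]_n -> R^o) x) ->
  (forall x, differentiable (g : 'rV[R]_n -> R^o) x) ->
  partial j (fun x => f x + g x) = (fun x => partial j f x + partial j g x).
Proof.
by move=> df dg; apply/funext => x; rewrite /partial deriveD//; exact: diff_derivable.
Qed.

Lemma smoothND k f g : smoothN k f -> smoothN k g -> smoothN k (fun x => f x + g x).
Proof.
elim: k f g => [|k IH] f g [df sf] [dg sg]; split => //;
  try by move=> x; exact: differentiableD.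
by move=> j; rewrite partialD//; apply: IH; [exact: sf|exact: sg].
Qed.

Lemma partialM j f g : (forall x, differentiable (f : 'rV[R]_n -> R^o) x) ->
  (forall x, differentiable (g : 'rV[R]_n -> R^o) x) ->
  partial j (fun x => f x * g x) =
    (fun x => f x * partial j g x + g x * partial j f x).
Proof.
by move=> df dg; apply/funext => x; rewrite /partial deriveM//; exact: diff_derivable.
Qed.

Lemma smoothNM k f g : smoothN k f -> smoothN k g -> smoothN k (fun x => f x * g x).
Proof.
elim: k f g => [|k IH] f g sf sg; split => //;
  try by move=> x; apply: (differentiableM (smoothN_diff x sf) (smoothN_diff x sg)).
move=> j; rewrite partialM => [|x|x]; [|exact: smoothN_diff sf|exact: smoothN_diff sg].
apply: smoothND; apply: IH; try exact: smoothN_pred.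
- exact: sg.2.
- exact: sf.2.
Qed.

Lemma smoothNV k f : (forall x, f x != 0) -> smoothN k f -> smoothN k (fun x => (f x)^-1).
Proof.
move=> f0; elim: k f f0 => [|k IH] f f0 sf; split => //;
  try by move=> x; apply: differentiableV => //; exact: smoothN_diff sf.
move=> j; rewrite (_ : partial _ _ = fun x => -1 * (((f x)^-1 * (f x)^-1) * partial j f x)).
  have sV := IH f f0 (smoothN_pred sf).
  exact: (smoothNM (smoothN_cst k (-1)) (smoothNM (smoothNM sV sV) (sf.2 j))).
apply/funext => x; rewrite /partial deriveV//.
  by rewrite -exprVn expr2 mulN1r [LHS]mulNr.
exact/diff_derivable/(smoothN_diff _ sf).
Qed.

Lemma partial_comp (h h' : R -> R) j f x : is_derive (f x) (1 : R) (h : R -> R^o) (h' (f x)) ->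
  differentiable (f : 'rV[R]_n -> R^o) x ->
  differentiable (h \o f : 'rV[R]_n -> R^o) x /\
  partial j (h \o f) x = h' (f x) * partial j f x.
Proof.
move=> [dh hh'] df; have dh' := (derivable1_diffP (h : R -> R^o) (f x)).1 dh.
split; first exact: (@differentiable_comp _ _ R^o).
rewrite /partial deriveE; last exact: (@differentiable_comp _ _ R^o).
rewrite (@diff_comp _ _ R^o)//= deriv1E// derive1E hh' -deriveE//.
by rewrite mulrC.
Qed.

Definition affine (x0 : 'rV[R]_n) (l : R) y : 'rV[R]_n := x0 + l *: y.

Lemma is_diff_affine x0 l y : is_diff y (affine x0 l) ( *:%R l).
Proof.
rewrite (_ : affine x0 l = cst x0 + ( *:%R l)); last exact: funext.
have D := is_diffD (is_diff_cst x0 y) (is_diff_scaler l y).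
by rewrite add0r in D.
Qed.

Lemma partial_affine x0 l j f : (forall x, differentiable (f : 'rV[R]_n -> R^o) x) ->
  partial j (f \o affine x0 l) = (fun y => l * partial j f (affine x0 l y)).
Proof.
move=> df; apply/funext => y; have [dT dTE] := is_diff_affine x0 l y.
rewrite /partial deriveE; last exact: (@differentiable_comp _ _ _ R^o).
by rewrite (@diff_comp _ _ _ R^o)//= dTE linearZ -deriveE.
Qed.

Lemma smoothN_affine k x0 l f : smoothN k f -> smoothN k (f \o affine x0 l).
Proof.
elim: k f => [|k IH] f sf; split => //; try by move=> y;
  apply: (@differentiable_comp _ _ _ R^o);
    [have [] := is_diff_affine x0 l y|exact: smoothN_diff sf].
move=> j; rewrite partial_affine => [|x]; last exact: smoothN_diff sf.
apply: smoothNM; first exact: smoothN_cst.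
by apply: IH; exact: sf.2.
Qed.

Lemma smooth_cst (c : R) : smooth (cst c : 'rV[R]_n -> R).
Proof. by apply/smooth_smoothN => k; exact: smoothN_cst. Qed.

Lemma smooth_coord (i : 'I_n) : smooth (fun x : 'rV[R]_n => x ord0 i).
Proof. by apply/smooth_smoothN => k; exact: smoothN_coord. Qed.

Lemma smoothD f g : smooth f -> smooth g -> smooth (fun x => f x + g x).
Proof.
move=> /smooth_smoothN sf /smooth_smoothN sg.
by apply/smooth_smoothN => k; exact: smoothND.
Qed.

Lemma smoothM f g : smooth f -> smooth g -> smooth (fun x => f x * g x).
Proof.
move=> /smooth_smoothN sf /smooth_smoothN sg.
by apply/smooth_smoothN => k; exact: smoothNM.
Qed.

Lemma smooth_affine x0 l f : smooth f -> smooth (f \o affine x0 l).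
Proof.
by move=> /smooth_smoothN sf; apply/smooth_smoothN => k; exact: smoothN_affine.
Qed.

Lemma smooth_diff f x : smooth f -> differentiable (f : 'rV[R]_n -> R^o) x.
Proof. by move=> sf; exact: (sf [::]). Qed.

Lemma smooth_continuous f : smooth f -> continuous (f : 'rV[R]_n -> R^o).
Proof. by move=> sf x; apply: differentiable_continuous; exact: smooth_diff. Qed.

Lemma partial_near j f g x : (\forall y \near x, f y = g y) ->
  partial j f x = partial j g x.
Proof. exact: near_eq_derive. Qed.

End SmoothFunctions.

(** * Smooth cutoff functions *)

Section Cutoff.
Context {R : realType}.

(** The whole family is introduced because it is stable under differentiation up to linear
    combinations ([flat_deriv]), which makes smoothness of exp(-1/v) an induction on the order. *)
Definition flat (k : nat) (v : R) : R := if 0 < v then v ^- k * expR (- v^-1) else 0.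

Lemma flat_ge0 k v : 0 <= flat k v.
Proof.
by rewrite /flat; case: ifPn => // v0; rewrite mulr_ge0 ?expR_ge0 ?invr_ge0 ?exprn_ge0 ?ltW.
Qed.

Lemma flat0_gt0 v : 0 < v -> 0 < flat 0 v.
Proof. by move=> v0; rewrite /flat v0 expr0 invr1 mul1r expR_gt0. Qed.

Lemma flat_le0 k v : v <= 0 -> flat k v = 0.
Proof. by rewrite /flat ltNge => ->. Qed.

Lemma flat_le k v : `|flat k v| <= k.+1`!%:R * `|v|.
Proof.
rewrite ger0_norm ?flat_ge0// /flat; case: ifPn => [v0|_]; last first.
  by rewrite mulr_ge0.
rewrite (gtr0_norm v0) expRN ler_pdivrMr ?expR_gt0//.
have X0 : 0 < v^-1 by rewrite invr_gt0.
have f0 : 0 < k.+1`!%:R :> R by rewrite ltr0n fact_gt0.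
have /(le_trans _)XE : v^-1 ^+ k.+1 / k.+1`!%:R <= expR v^-1.
  by apply: le_trans (expR_ge1Dxn k (ltW X0)); rewrite lerDr.
rewrite -mulrA mulrCA -ler_pdivrMl// -(ler_pdivrMl _ _ f0).
apply: XE; rewrite -exprVn exprS.
by rewrite mulrC.
Qed.

Lemma flat_deriv k (v : R) : is_derive v (1 : R) (flat k : R -> R^o)
  (- k%:R * flat k.+1 v + flat k.+2 v).
Proof.
have [v0|v0|v0] := ltgtP v 0.
- rewrite !flat_le0 ?ltW// mulr0 addr0.
  apply: (@near_eq_is_derive R R R^o (cst 0)).
  near=> w; rewrite flat_le0//; near: w.
  by apply: (filterS _ (lt_nbhsl v0)) => w /ltW.
- have v1 : v != 0 by rewrite gt_eqF.
  pose g (X : R) := X ^+ k * expR (- X).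
  apply: (@near_eq_is_derive R R R^o (g \o (fun w => w^-1) : R -> R^o)).
    near=> w; rewrite /flat ifT ?exprVn//=.
      by rewrite /g exprVn.
    by near: w; exact: lt_nbhsr.
  have dV : is_derive v (1 : R) (fun w : R => w^-1 : R^o) (- v ^- 2).
    split; first apply: (@derivableV _ _ id) => //.
    rewrite (@deriveV _ _ id)//. 
    by rewrite derive_id [LHS]mulr1.
  have dg : is_derive v^-1 (1 : R) (g : R -> R^o)
    ((k%:R * v^-1 ^+ k.-1 - v^-1 ^+ k) * expR (- v^-1)).
    have dX := is_deriveX k (is_derive_id v^-1 (1 : R)).
    have dE := is_derive1_comp (is_derive_expR (- v^-1)) (is_deriveNid v^-1 (1 : R)).
    rewrite (_ : g = (@id R) ^+ k * (expR \o -%R)); last by apply/funext => X; rewrite /g !fctE.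
    apply: (is_derive_eq (is_deriveM dX dE)).
    rewrite !fctE /GRing.scale/= mulr1 mulrN1.
    ring.
  apply: (@is_derive_eq _ _ _ _ _ _ _ _ (is_derive1_comp dg dV)).
  rewrite /flat v0 -!exprVn mulrN.
  rewrite !exprS; case: (k) => [|i]; rewrite ?exprS/=; ring.
- rewrite v0 !flat_le0// mulr0 addr0.
  suff D : (fun h : R => h^-1 *: ((flat k \o shift 0) (h *: (1 : R)) - flat k 0) : R^o) @ 0^' --> (0 : R^o).
    by split; [apply/cvg_ex; exists 0|exact/cvg_lim].
  apply/cvgr0Pnorm_le => e e0; near=> h.
  have h0 : h != 0 by near: h; exact: nbhs_dnbhs_neq.
  rewrite /= addr0 [h *: 1]mulr1 (flat_le0 k (lexx 0)) subr0.
  (* At 0 the difference quotient is the next member of the family, which tends to 0 by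
     [flat_le]. *)
  have -> : h^-1 *: flat k h = flat k.+1 h.
    rewrite /flat; case: ifPn => _; last exact: scaler0.
    by rewrite [LHS]mulrA exprS invfM.
  apply: le_trans (flat_le _ _) _; rewrite -ler_pdivlMl ?ltr0n ?fact_gt0//.
  near: h; apply: dnbhs0_le; rewrite mulr_gt0// invr_gt0 ltr0n fact_gt0//.
Unshelve. all: by end_near. Qed.

Lemma smooth_flat n k (f : 'rV[R]_n -> R) : smooth f -> smooth (flat k \o f).
Proof.
move=> sf; apply/smooth_smoothN => N; elim: N k => [|N IH] k; split => //.
- by move=> x; apply: (@differentiable_comp _ _ R^o R^o); [exact: smooth_diff|];
    apply/derivable1_diffP; have [] := flat_deriv k (f x).
- by move=> x; apply: (@differentiable_comp _ _ R^o R^o); [exact: smooth_diff|];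
    apply/derivable1_diffP; have [] := flat_deriv k (f x).
move=> j; rewrite (_ : partial _ _ = fun x =>
  (- k%:R * (flat k.+1 \o f) x + (flat k.+2 \o f) x) * partial j f x).
  apply: smoothNM; last exact: ((smooth_smoothN _).1 (smooth_partial j sf) N).
  apply: smoothND; last exact: IH.
  exact: (smoothNM (smoothN_cst N (- k%:R)) (IH _)).
apply/funext => x.
by have [_ ->] := partial_comp j (h' := fun v => - k%:R * flat k.+1 v + flat k.+2 v)
  (flat_deriv k (f x)) (smooth_diff x sf).
Qed.

Lemma smooth_sum n (I : Type) (s : seq I) (F : I -> 'rV[R]_n -> R) :
  (forall i, smooth (F i)) -> smooth (fun x => \sum_(i <- s) F i x).
Proof.
move=> sF; elim: s => [|i s IH].
  by under eq_fun do rewrite big_nil; exact: smooth_cst.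
by under eq_fun do rewrite big_cons; exact: smoothD.
Qed.

Lemma smooth_dot n : smooth (fun x : 'rV[R]_n => dot x x).
Proof. by apply: smooth_sum => i; apply: smoothM; exact: smooth_coord. Qed.

Lemma smooth_cutoff n (r0 r1 : R) : 0 <= r0 < r1 ->
  exists eta : 'rV[R]_n -> R, [/\ smooth eta,
    forall x, enorm x <= r0 -> eta x = 1 & forall x, r1 <= enorm x -> eta x = 0].
Proof.
move=> /andP[r00 r01].
have sD (a b : R) : smooth (fun x : 'rV[R]_n => a + b * dot x x).
  by apply: smoothD; [exact: smooth_cst|apply: smoothM; [exact: smooth_cst|exact: smooth_dot]].
(* [p] vanishes outside radius r1 and [q] inside radius r0, and [p + q] never vanishes; the cutoff
   is [p / (p + q)]. *)
pose p := flat 0 \o (fun x : 'rV[R]_n => r1 ^+ 2 + -1 * dot x x).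
pose q := flat 0 \o (fun x : 'rV[R]_n => - r0 ^+ 2 + 1 * dot x x).
have r01' : r0 ^+ 2 < r1 ^+ 2 by rewrite ltr_pXn2r// nnegrE// ltW// (le_lt_trans r00).
have pq0 x : 0 < p x + q x.
  have [xr|xr] := ltP (dot x x) (r1 ^+ 2).
    by apply: ltr_pwDl; [apply: flat0_gt0; lra|exact: flat_ge0].
  by apply: ltr_wpDl; [exact: flat_ge0|apply: flat0_gt0; lra].
exists (fun x => p x * (p x + q x)^-1); split.
- apply: smoothM; first exact: smooth_flat.
  apply/smooth_smoothN => k; apply: smoothNV => [x|]; first by rewrite gt_eqF.
  by apply: (smooth_smoothN _).1; apply: smoothD; exact: smooth_flat.
- move=> x xr; have xr2 : dot x x <= r0 ^+ 2.
    by rewrite -enorm_sqr ler_pXn2r ?nnegrE ?enorm_ge0.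
  have q0 : q x = 0 by apply: flat_le0; lra.
  by have := pq0 x; rewrite q0 addr0 => px; rewrite mulfV ?gt_eqF.
- move=> x xr; have xr2 : r1 ^+ 2 <= dot x x.
    by rewrite -enorm_sqr ler_pXn2r ?nnegrE ?enorm_ge0// ltW// (le_lt_trans r00).
  by rewrite (_ : p x = 0) ?mul0r//; apply: flat_le0; lra.
Qed.

End Cutoff.

(** * Caratheodory's criterion for H^1 *)

Section HausdorffBorel.
Context {R : realType} {n : nat}.
Implicit Types (A B C X : set 'rV[R]_n) (d : R).
Local Open Scope ereal_scope.

Lemma ediam_ub C x y : C x -> C y -> (enorm (x - y))%:E <= ediam C.
Proof. by move=> Cx Cy; apply: ereal_sup_ubound; right; exists x, y. Qed.

Lemma ediam_le C (a : \bar R) : 0 <= a ->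
  (forall x y, C x -> C y -> (enorm (x - y))%:E <= a) -> ediam C <= a.
Proof.
move=> a0 Ca; apply: ge_ereal_sup => z /= [->//|[x [y [Cx Cy ->]]]].
exact: Ca.
Qed.

Lemma le_ediam C C' : C `<=` C' -> ediam C <= ediam C'.
Proof.
move=> CC'; apply: ediam_le; first exact: ediam_ge0.
by move=> x y /CC' Cx /CC' Cy; exact: ediam_ub.
Qed.

Lemma hausdorff1_ub d A : (0 < d)%R -> hausdorff1_delta d A <= hausdorff1 A.
Proof. by move=> d0; apply: ereal_sup_ubound; exists d. Qed.

Lemma hausdorff1_delta_anti A d d' : (d <= d')%R ->
  hausdorff1_delta d' A <= hausdorff1_delta d A.
Proof.
move=> dd'; apply: ereal_inf_le_tmp => _ [F [Fd AF] <-]; exists F => //.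
by split => // k; apply: le_trans (Fd k) _; rewrite lee_fin.
Qed.

(** A covering set of diameter at most d < e meets at most one of the two sets, so its diameter is
    charged only once. *)
Lemma hausdorff1_delta_sep A B (e d : R) : (0 < d < e)%R ->
  (forall x y, A x -> B y -> (e <= enorm (x - y))%R) ->
  hausdorff1_delta d A + hausdorff1_delta d B <= hausdorff1_delta d (A `|` B).
Proof.
move=> /andP[d0 de] sep; apply: le_ereal_inf_tmp => _ [F [Fd ABF] <-].
have dA k : ediam (F k `&` A) + ediam (F k `&` B) <= ediam (F k).
  have [FA|/set0P[x [Fx Ax]]] := eqVneq (F k `&` A) set0.
    by rewrite FA ediam0 add0e le_ediam.
  rewrite (_ : F k `&` B = set0) ?ediam0 ?adde0 ?le_ediam//.
  rewrite -subset0 => y [Fy By].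
  have := le_trans (ediam_ub Fx Fy) (Fd k).
  by rewrite lee_fin leNgt (lt_le_trans de)// sep.
apply: (@le_trans _ _ (\sum_(k <oo) (ediam (F k `&` A) + ediam (F k `&` B)))).
  rewrite nneseriesD; try by move=> *; exact: ediam_ge0.
  apply: leeD; apply: ereal_inf_lbound => /=.
    exists (fun k => F k `&` A) => //; split=> [k|x Ax].
      by apply: le_trans (Fd k); exact: le_ediam.
    by have [k _ Fx] := ABF x (or_introl Ax); exists k.
  exists (fun k => F k `&` B) => //; split=> [k|x Bx].
    by apply: le_trans (Fd k); exact: le_ediam.
  by have [k _ Fx] := ABF x (or_intror Bx); exists k.
by apply: lee_nneseries => k _ //; rewrite adde_ge0// ediam_ge0.
Qed.

Lemma hausdorff1_sep A B (e : R) : (0 < e)%R ->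
  (forall x y, A x -> B y -> (e <= enorm (x - y))%R) ->
  hausdorff1 A + hausdorff1 B <= hausdorff1 (A `|` B).
Proof.
move=> e0 sep; have [->|Hfin] := eqVneq (hausdorff1 (A `|` B)) +oo; first exact: leey.
have Hd d : (0 < d)%R -> hausdorff1_delta d A + hausdorff1_delta d B <= hausdorff1 (A `|` B).
  move=> d0; pose d1 := Num.min d (e / 2)%R.
  have d10 : (0 < d1)%R by rewrite lt_min d0 divr_gt0.
  apply: le_trans (hausdorff1_ub _ d10).
  apply: le_trans (hausdorff1_delta_sep _ sep); last first.
    by rewrite d10/= gt_min; apply/orP; right; lra.
  by apply: leeD; apply: hausdorff1_delta_anti; rewrite ge_min lexx.
(* The two suprema defining H^1 of A and of B run over independent parameters; both are lowered to a
   common one. *)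
have Hd2 d d' : (0 < d)%R -> (0 < d')%R ->
    hausdorff1_delta d A + hausdorff1_delta d' B <= hausdorff1 (A `|` B).
  move=> d0 d'0; have m0 : (0 < Num.min d d')%R by rewrite lt_min d0.
  apply: le_trans (Hd _ m0).
  by apply: leeD; apply: hausdorff1_delta_anti; rewrite ge_min lexx ?orbT.
have Hge0 := hausdorff1_ge0 (A `|` B).
have Hf : hausdorff1 (A `|` B) \is a fin_num.
  by rewrite ge0_fin_numE// ltey.
have BH : hausdorff1 B <= hausdorff1 (A `|` B) by apply: le_hausdorff1; right.
have Bf : hausdorff1 B \is a fin_num.
  by rewrite ge0_fin_numE ?hausdorff1_ge0//; apply: le_lt_trans BH _; rewrite ltey.
rewrite -leeBrDr//; apply: ge_ereal_sup => _ [d /= d0 <-].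
rewrite leeBrDr// addeC.
have Af : hausdorff1_delta d A \is a fin_num.
  rewrite ge0_fin_numE ?hausdorff1_delta_ge0//.
  apply: (@le_lt_trans _ _ (hausdorff1 (A `|` B))); last by rewrite ltey.
  by apply: le_trans (hausdorff1_ub _ d0) _; apply: le_hausdorff1; left.
rewrite -leeBrDr//; apply: ge_ereal_sup => _ [d' /= d'0 <-].
by rewrite leeBrDr// addeC Hd2.
Qed.

(** The classical argument for metric outer measures. The sets [E k] where u > [a k] lie at positive
    distance from the sublevel set, so additivity holds with [E k] in place of the complement [O].
    It remains to see that H^1 of [O] is at most the supremum [M] of H^1 of the [E k], which follows
    by splitting the difference into shells [Q k]. *)
Lemma caratheodory_lipschitz (u : 'rV[R]_n -> R) :
  (forall x y, (`|u x - u y| <= enorm (x - y))%R) ->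
  (H1_outer R n).-caratheodory [set x | (u x <= 0)%R].
Proof.
move=> lipu; apply: le_caratheodory_measurable => X.
change (hausdorff1 (X `&` [set x | (u x <= 0)%R]) +
  hausdorff1 (X `&` ~` [set x | (u x <= 0)%R]) <= hausdorff1 X).
have [->|Hfin] := eqVneq (hausdorff1 X) +oo; first exact: leey.
have fX A : A `<=` X -> hausdorff1 A \is a fin_num.
  move=> AX; rewrite ge0_fin_numE ?hausdorff1_ge0//.
  by apply: le_lt_trans (le_hausdorff1 AX) _; rewrite ltey.
pose a (k : nat) := ((k.+1%:R)^-1 : R)%R.
have a0 k : (0 < a k)%R by rewrite invr_gt0.
have aS k : (a k.+1 < a k)%R by rewrite ltf_pV2 ?posrE// ltr_nat.
pose E k := X `&` [set x | (a k < u x)%R].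
pose Q k := X `&` [set x | (a k.+1 < u x <= a k)%R].
set P := X `&` [set x | (u x <= 0)%R]; set O := X `&` _.
have EX k : E k `<=` X by move=> ? [].
have QX k : Q k `<=` X by move=> ? [].
pose g k := fine (hausdorff1 (E k)); pose q k := fine (hausdorff1 (Q k)).
have gE k : hausdorff1 (E k) = (g k)%:E by rewrite /g fineK// fX.
have qE k : hausdorff1 (Q k) = (q k)%:E by rewrite /q fineK// fX.
have PE k : hausdorff1 P + (g k)%:E <= hausdorff1 X.
  rewrite -gE; apply: le_trans (hausdorff1_sep (a0 k) _) _.
    move=> x y [_ /= ux] [_ /= uy]; have := lipu y x; rewrite enormB ler_norml.
    by move=> /andP[_]; lra.
  by apply: le_hausdorff1 => x [[]|[]].
(* [E k] and the shell [Q k.+1] are separated by the gap [a k - a k.+1], and both lie in [E k.+2].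
   Summing over shells therefore telescopes with step two. *)
have QE k : (q k.+1 <= g k.+2 - g k)%R.
  rewrite lerBrDr -lee_fin EFinD -gE -qE -gE.
  have s0 : (0 < a k - a k.+1)%R by rewrite subr_gt0.
  apply: le_trans (hausdorff1_sep s0 _) _.
    move=> x y [_ /= /andP[_ ux]] [_ /= uy].
    by have := lipu y x; rewrite enormB ler_norml => /andP[_]; lra.
  apply: le_hausdorff1 => x [[Xx /= /andP[ux _]]|[Xx /= ux]]; split => //=.
  by apply: lt_trans ux; apply: lt_trans (aS _) (aS _).
have Qsum k N : (\sum_(i < N) q (k + i)%N.+1 <= g (k + N)%N.+1 + g (k + N)%N - g k - g k.+1)%R.
  elim: N => [|N IH]; first by rewrite big_ord0 !addn0 addrK subrr.
  rewrite big_ord_recr/= addnS; have := QE (k + N)%N; lra.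
have OE k : O `<=` E k.+1 `|` \bigcup_i Q (k + i)%N.+1.
  move=> x [Xx /= /negP]; rewrite -ltNge => u0.
  have [i ui] : exists i, (a i < u x)%R.
    exists (Num.trunc (u x)^-1); rewrite /a -[ltRHS]invrK ltf_pV2 ?posrE ?invr_gt0//.
    exact: truncnS_gt.
  have [uk|uk] := ltP (a k.+1) (u x); first by left.
  right; have exi : exists i, (a i < u x)%R by exists i.
  pose i0 := ex_minn exi.
  have [ui0 min0] : (a i0 < u x)%R /\ forall j, (a j < u x)%R -> (i0 <= j)%N.
    by rewrite /i0; case: ex_minnP.
  have amono j j' : (j <= j')%N -> (a j' <= a j)%R.
    by move=> jj'; rewrite lef_pV2 ?posrE// ler_nat ltnS.
  have ki0 : (k.+1 < i0)%N.
    by rewrite ltnNge; apply/negP => /amono; rewrite leNgt => /negP; apply; apply: lt_le_trans ui0 uk.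
  exists (i0 - k.+2)%N => //; split => //=.
  have -> : (k + (i0 - k.+2))%N.+1 = i0.-1 by lia.
  rewrite prednK ?(leq_ltn_trans _ ki0)// ui0/= leNgt; apply/negP => /min0.
  lia.
have bX k : (g k <= fine (hausdorff1 X) - fine (hausdorff1 P))%R.
  by rewrite lerBrDr addrC -lee_fin EFinD !fineK -?gE ?gE ?PE ?fX// => ? [].
set L := (fine (hausdorff1 X) - fine (hausdorff1 P))%R in bX.
pose M := sup (range g).
have Mub k : (g k <= M)%R.
  by apply: ub_le_sup; [exists L => _ [i _ <-]; exact: bX|exists k].
have ML : (M <= L)%R by apply: ge_sup; [exists (g 0%N), 0%N|move=> _ [i _ <-]; exact: bX].
(* Covering [O] by [E k.+1] and the later shells costs at most [2 * M - g k]; taking the supremum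
   over [g k] then gives [M]. *)
have OM k : hausdorff1 O <= (2 * M - g k)%:E.
  have : hausdorff1 O <= (g k.+1)%:E + \sum_(i <oo) (q (k + i)%N.+1)%:E.
    apply: le_trans (le_hausdorff1 (OE k)) _; rewrite -gE.
    apply: le_trans (outer_measureU2 (H1_outer R n) _ _) _.
    apply: leeD => //; under eq_eseriesr do rewrite -qE.
    exact: (outer_measure_sigma_subadditive (H1_outer R n)).
  move=> /le_trans; apply.
  rewrite (_ : (2 * M - g k = g k.+1 + (2 * M - g k - g k.+1))%R); last by lra.
  rewrite EFinD leeD2l//; apply: lime_le.
    apply: is_cvg_nneseries => i _ _; rewrite -qE; exact: hausdorff1_ge0.
  apply: nearW => N; rewrite big_mkord sumEFin lee_fin.
  by apply: le_trans (Qsum k N) _; have := Mub (k + N)%N; have := Mub (k + N)%N.+1; lra.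
have OMM : hausdorff1 O <= M%:E.
  have fO : hausdorff1 O \is a fin_num by apply: fX => ? [].
  rewrite -(fineK fO) lee_fin; set h := fine _.
  have gh k : (g k <= 2 * M - h)%R by have := OM k; rewrite -(fineK fO) lee_fin -/h; lra.
  have : (M <= 2 * M - h)%R by apply: ge_sup; [exists (g 0%N), 0%N|move=> _ [i _ <-]].
  lra.
apply: le_trans (leeD2l _ OMM) _.
have fP : hausdorff1 P \is a fin_num by apply: fX => ? [].
rewrite -(fineK fP) -EFinD -(fineK (fX _ (@subset_refl _ X))) lee_fin.
by move: ML; rewrite /L; lra.
Qed.

End HausdorffBorel.

(** * Borel sets are H^1-measurable *)

Section BorelMeasurability.
Context {R : realType} {n : nat}.

Lemma countType_bigcup_measurable d (T : measurableType d) (I : countType)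
  (F : I -> set T) : (forall i, measurable (F i)) -> measurable (\bigcup_i F i).
Proof.
move=> mF; rewrite (_ : \bigcup_i F i =
    \bigcup_k (if unpickle k is Some i then F i else set0)).
  by apply: bigcupT_measurable => k; case: unpickle.
apply/seteqP; split=> [x [i _ Fx]|x [k _]].
  by exists (pickle i); rewrite ?pickleK.
by case: unpickle => // i Fx; exists i.
Qed.

Let box (qk : 'rV[rat]_n * nat) : set 'rV[R]_n :=
  [set x | forall j, `|x ord0 j - ratr (qk.1 ord0 j)| < qk.2.+1%:R^-1].

Lemma open_bigcup_box (U : set 'rV[R]_n) : open U ->
  U = \bigcup_(qk in [set qk | box qk `<=` U]) box qk.
Proof.
move=> oU; apply/seteqP; split=> [x Ux|x [qk /= qkU qkx]]; last exact: qkU.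
have /nbhs_ballP[e /= e0 eU] : nbhs x U by exact: open_nbhs_nbhs.
pose k := Num.trunc (2 / e).
have ke : 2 * k.+1%:R^-1 < e :> R.
  by rewrite ltr_pdivrMr// mulrC -ltr_pdivrMr// truncnS_gt.
have k0 : 0 < k.+1%:R^-1 :> R by [].
have [dl dlE] : {dl : R | dl = k.+1%:R^-1} by exists k.+1%:R^-1.
rewrite -dlE in ke k0.
have qP j : {q : rat | `|x ord0 j - ratr q| < dl}.
  have /rat_in_itvoo : x ord0 j - dl < x ord0 j + dl by lra.
  move=> qq; apply: cid; case: qq => q; rewrite in_itv/= => /andP[q1 q2]; exists q.
  by rewrite ltr_norml; apply/andP; split; lra.
pose q : 'rV[rat]_n := \row_j sval (qP j).
have qx : box (q, k) x by move=> j; rewrite /= mxE -dlE; case: (qP j).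
exists (q, k) => //= y qy; apply: eU; split => // i j; rewrite ord1.
rewrite -ball_normE /=; have := qy j; have := qx j; rewrite /= -dlE.
have -> : x ord0 j - y ord0 j = (x ord0 j - ratr (q ord0 j)) - (y ord0 j - ratr (q ord0 j)) by lra.
move=> h1 h2; apply: le_lt_trans (ler_normB _ _) _; lra.
Qed.

(** Open sets are countable unions of rational boxes, so measurability of the coordinates
    suffices. *)
Lemma measurable_preimage_open d (T : measurableType d) (D : set T)
    (f : T -> 'rV[R]_n) (U : set 'rV[R]_n) : measurable D ->
  (forall j, measurable_fun D (fun x => f x ord0 j)) -> open U ->
  measurable (D `&` f @^-1` U).
Proof.
move=> mD mf oU; rewrite [X in f @^-1` X](open_bigcup_box oU).
rewrite preimage_bigcup setI_bigcupr bigcup_mkcond.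
apply: countType_bigcup_measurable => -[q k]; case: ifPn => // _.
rewrite (_ : _ `&` _ = D `&` \bigcap_(j in [set: 'I_n])
    (D `&` (fun x => f x ord0 j) @^-1` `](ratr (q ord0 j) - k.+1%:R^-1), (ratr (q ord0 j) + k.+1%:R^-1)[)).
  by apply: measurableI => //; apply: fin_bigcap_measurable => // j _; exact: mf.
have itvE j x : (f x ord0 j \in `](ratr (q ord0 j) - k.+1%:R^-1), (ratr (q ord0 j) + k.+1%:R^-1)[) =
   (`|f x ord0 j - ratr (q ord0 j)| < k.+1%:R^-1 :> R).
  by rewrite in_itv/= ltr_distl.
apply/seteqP; split=> x [Dx /= qx]; split=> // j.
  by move=> _; split => //=; rewrite itvE.
by have [_ /=] := qx j I; rewrite itvE.
Qed.

Lemma measurable_fun_borel d (T : measurableType d) (D : set T)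
    (f : T -> 'rV[R]_n) : measurable D ->
  (forall j, measurable_fun D (fun x => f x ord0 j)) ->
  measurable_fun D (f : T -> borel R n).
Proof.
move=> mD mf; apply: (@measurability _ _ _ (borel R n) _ _ [set U : set 'rV[R]_n | open U]) => //.
by move=> _ [U oU <-]; exact: measurable_preimage_open.
Qed.

Lemma measurable_coord (j : 'I_n) :
  measurable_fun [set: H1space R n] (fun x : H1space R n => x ord0 j : R).
Proof.
move=> _; apply: (measurability _ (measurable_realfun.RGenOInfty.measurableE R)) => //.
move=> _ [_ [a ->] <-]; rewrite setTI.
rewrite (_ : _ @^-1` _ = ~` [set x : H1space R n | x ord0 j - a <= 0]).
  apply: measurableC; apply: caratheodory_lipschitz => x y.
  have := coord_enorm (x - y) j; rewrite !mxE.
  by rewrite (_ : x ord0 j - a - (y ord0 j - a) = x ord0 j - y ord0 j); last by lra.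
apply/seteqP; split=> x /=; rewrite in_itv/= andbT => ax.
  by apply/negP; rewrite -ltNge subr_gt0.
by move/negP: ax; rewrite -ltNge subr_gt0.
Qed.

(** The coordinates are H^1-measurable by the criterion for sublevel sets of 1-Lipschitz functions,
    so the identity is measurable from the Caratheodory sets to the Borel sets. *)
Lemma borel_H1measurable (A : set 'rV[R]_n) :
  measurable (A : set (borel R n)) -> measurable (A : set (H1space R n)).
Proof.
move=> mA.
have mid : measurable_fun [set: H1space R n] (fun x : H1space R n => (x : borel R n)).
  apply: measurable_fun_borel; first exact: measurableT.
  by move=> j; exact: measurable_coord.
have := mid measurableT A mA; rewrite setTI; exact.
Qed.

End BorelMeasurability.

(** * Homotheties and their inverses *)

Section Affine.
Context {R : realType} {n : nat}.
Implicit Types (A : set 'rV[R]_n) (x y : 'rV[R]_n) (l : R).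

Definition affineV (x0 : 'rV[R]_n) (l : R) (y : 'rV[R]_n) := l^-1 *: (y - x0).

Lemma affineK x0 l : l != 0 -> cancel (affine x0 l) (affineV x0 l).
Proof. by move=> l0 y; rewrite /affine/affineV addrAC subrr add0r scalerA mulVf// scale1r. Qed.

Lemma affineVK x0 l : l != 0 -> cancel (affineV x0 l) (affine x0 l).
Proof. by move=> l0 y; rewrite /affine/affineV scalerA mulfV// scale1r addrC subrK. Qed.

Lemma affineVE x0 (l : R) : affineV x0 l = affine (- l^-1 *: x0) l^-1.
Proof. by apply/funext => y; rewrite /affine/affineV scalerBr scaleNr addrC. Qed.

Lemma affineB x0 l x y : affine x0 l x - affine x0 l y = l *: (x - y).
Proof. by rewrite /affine opprD addrACA subrr add0r scalerBr. Qed.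

Lemma affine_image x0 l A : l != 0 -> affine x0 l @` A = affineV x0 l @^-1` A.
Proof.
move=> l0; apply/seteqP; split=> [_ [y Ay <-]|y Ay] /=; first by rewrite affineK.
by exists (affineV x0 l y) => //; rewrite affineVK.
Qed.

End Affine.

(** * Borel regularity and scaling of H^1 *)

Section HausdorffRegularity.
Context {R : realType} {n : nat}.
Implicit Types (A B C : set 'rV[R]_n).
Local Open Scope ereal_scope.

Lemma ediam_closure C : ediam (closure C) = ediam C.
Proof.
apply/eqP; rewrite eq_le (le_ediam (@subset_closure _ C)) andbT.
apply: ediam_le => [|x y Cx Cy]; first exact: ediam_ge0.
apply/lee_addgt0Pr => e e0; have e20 : (0 < e / 2)%R by rewrite divr_gt0.
have [x' [Cx' xx']] := Cx _ (eball_nbhs x e20).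
have [y' [Cy' yy']] := Cy _ (eball_nbhs y e20).
apply: le_trans (leeD2r _ (ediam_ub Cx' Cy')); rewrite -EFinD lee_fin.
move: xx' yy'; rewrite /eball/= (enormB x' x) => h1 h2.
by have := enorm_triangle x' x y; have := enorm_triangle y' x' y; lra.
Qed.

(** Passing to closures does not change diameters, so almost optimal covers at scale 1/(k+1) may be
    taken closed. The intersection over k of their unions is Borel and admits the same covers. *)
Lemma hausdorff1_borel A : exists B, [/\ measurable (B : set (borel R n)),
  A `<=` B & hausdorff1 B = hausdorff1 A].
Proof.
have [HA|Hfin] := eqVneq (hausdorff1 A) +oo.
  exists setT; split => //; apply/eqP; rewrite HA -leye_eq -HA.
  exact: le_hausdorff1.
have fA : hausdorff1 A \is a fin_num by rewrite ge0_fin_numE ?hausdorff1_ge0// ltey.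
pose a (k : nat) := ((k.+1%:R)^-1 : R)%R.
have a0 k : (0 < a k)%R by rewrite invr_gt0.
have /choice[F FP] k : exists F : (set 'rV[R]_n)^nat, hausdorff1_cover (a k) A F /\
    \sum_(j <oo) ediam (F j) <= hausdorff1 A + (a k)%:E.
  have fk : hausdorff1_delta (a k) A \is a fin_num.
    rewrite ge0_fin_numE ?hausdorff1_delta_ge0//.
    by apply: le_lt_trans (hausdorff1_ub _ _) _; rewrite // ltey.
  have [_ [F cF <-] Fe] := lb_ereal_inf_adherent (a0 k) fk.
  exists F; split => //; apply: le_trans (ltW Fe) _.
  by rewrite leeD2r// hausdorff1_ub.
have AB : A `<=` \bigcap_k \bigcup_j closure (F k j).
  move=> x Ax k _; have [_] := (FP k).1; move=> /(_ x Ax)[j _ Fx]; exists j => //.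
  exact: subset_closure.
exists (\bigcap_k \bigcup_j closure (F k j)); split => //.
  apply: bigcapT_measurable => k; apply: bigcupT_measurable => j.
  rewrite -[X in measurable X]setCK; apply: measurableC; apply: sub_sigma_algebra => /=.
  exact/closed_openC/closed_closure.
apply/eqP; rewrite eq_le (le_hausdorff1 AB) andbT.
apply: ge_ereal_sup => _ [d /= d0 <-]; apply/lee_addgt0Pr => e e0.
pose m := Num.min d e.
have m0 : (0 < m)%R by rewrite lt_min d0.
pose k := Num.trunc m^-1.
have km : (a k < m)%R.
  by rewrite /a -[ltRHS]invrK ltf_pV2 ?posrE ?invr_gt0// truncnS_gt.
apply: (@le_trans _ _ (\sum_(j <oo) ediam (F k j))).
  apply: ereal_inf_lbound; exists (fun j => closure (F k j)).
    split => [j|x Bx]; last exact: (Bx k I).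
    rewrite ediam_closure; apply: le_trans ((FP k).1.1 j) _.
    by rewrite lee_fin (le_trans (ltW km))// ge_min lexx.
  by apply: eq_eseriesr => j _; rewrite ediam_closure.
apply: le_trans (FP k).2 _; rewrite leeD2l// lee_fin (le_trans (ltW km))//.
by rewrite ge_min lexx orbT.
Qed.

Lemma hausdorff1_lipschitz (f : 'rV[R]_n -> 'rV[R]_n) (l : R) A : (0 < l)%R ->
  (forall x y, (enorm (f x - f y) <= l * enorm (x - y))%R) ->
  hausdorff1 (f @` A) <= l%:E * hausdorff1 A.
Proof.
move=> l0 lipf; apply: ge_ereal_sup => _ [d /= d0 <-].
have dl0 : (0 < d / l)%R by rewrite divr_gt0.
apply: (@le_trans _ _ (l%:E * hausdorff1_delta (d / l) A)); last first.
  by rewrite lee_pmul2l// hausdorff1_ub.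
rewrite -lee_pdivrMl//; apply: le_ereal_inf_tmp => _ [F [Fd AF] <-].
rewrite lee_pdivrMl// -nneseriesZl => [|k _]; last exact: ediam_ge0.
have fF k : ediam (f @` F k) <= l%:E * ediam (F k).
  apply: ediam_le; first by rewrite mule_ge0 ?ediam_ge0// lee_fin ltW.
  move=> _ _ [x Fx <-] [y Fy <-]; apply: (@le_trans _ _ (l * enorm (x - y))%:E).
    by rewrite lee_fin.
  by rewrite EFinM lee_pmul2l// ediam_ub.
apply: (@le_trans _ _ (\sum_(k <oo) ediam (f @` F k))).
  apply: ereal_inf_lbound; exists (fun k => f @` F k) => //; split => [k|].
    apply: le_trans (fF k) _; rewrite -lee_pdivlMl//.
    by apply: le_trans (Fd k) _; rewrite -EFinM lee_fin mulrC.
  by move=> _ [x /AF[k _ Fx] <-]; exists k => //; exists x.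
by apply: lee_nneseries => [k _ _|k _ //]; exact: ediam_ge0.
Qed.

Lemma hausdorff1_affine x0 l A : (0 < l)%R ->
  hausdorff1 (affine x0 l @` A) = l%:E * hausdorff1 A.
Proof.
move=> l0; apply/eqP; rewrite eq_le; apply/andP; split.
  by apply: hausdorff1_lipschitz => // x y; rewrite affineB enormZ gtr0_norm.
rewrite -lee_pdivlMl//.
have -> : hausdorff1 A = hausdorff1 (affineV x0 l @` (affine x0 l @` A)).
  by rewrite -image_comp_eq || rewrite image_comp; congr hausdorff1;
     rewrite -[LHS]image_id; apply: eq_imagel => x _ /=; rewrite affineK ?gt_eqF.
rewrite affineVE; apply: hausdorff1_lipschitz; first by rewrite invr_gt0.
by move=> x y; rewrite affineB enormZ gtr0_norm ?invr_gt0.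
Qed.

Lemma hausdorff1_set1 (x : 'rV[R]_n) : hausdorff1 [set x] = 0.
Proof.
apply/eqP; rewrite eq_le hausdorff1_ge0 andbT.
apply: ge_ereal_sup => _ [d /= d0 <-].
have e0 : ediam [set x] = 0.
  apply/eqP; rewrite eq_le ediam_ge0 andbT; apply: ediam_le => // _ _ -> ->.
  by rewrite subrr enorm0.
apply: ereal_inf_lbound; exists (fun=> [set x]).
  by split=> [k|y ->]; [rewrite e0 lee_fin ltW|exists 0%N].
by rewrite eseries0// => k _ _; rewrite e0.
Qed.

End HausdorffRegularity.

(** * H^1 of a segment is its length *)

Section Line.
Context {R : realType} {n : nat}.
Variables (p t : 'rV[R]_n).
Hypothesis t1 : sphere n t.
Local Open Scope ereal_scope.

Definition pline (s : R) : 'rV[R]_n := (p + s *: t)%R.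
Definition cline (x : 'rV[R]_n) : R := dot (x - p)%R t.

Lemma sphere_dot : dot t t = 1%R.
Proof. by rewrite -enorm_sqr t1 expr1n. Qed.

Lemma plineK : cancel pline cline.
Proof. by move=> s; rewrite /cline/pline addrAC subrr add0r dotZl sphere_dot mulr1. Qed.

Lemma enorm_pline s s' : enorm (pline s - pline s')%R = `|s - s'|%R.
Proof.
rewrite /pline (_ : _ - _ = (s - s') *: t)%R ?enormZ ?t1 ?mulr1//.
by rewrite scalerBl opprD addrACA subrr add0r.
Qed.

Lemma hausdorff1_pline_itv_le (a b : R) : (a <= b)%R ->
  hausdorff1 (pline @` `[a, b]) <= (b - a)%:E.
Proof.
move=> ab; apply: ge_ereal_sup => _ [d /= d0 <-].
pose N := (Num.trunc ((b - a) / d)).+1.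
pose h := ((b - a) / N%:R)%R.
have h0 : (0 <= h)%R by rewrite divr_ge0// subr_ge0.
have hN : (h * N%:R = b - a)%R by rewrite /h divfK// pnatr_eq0.
have hd : (h <= d)%R.
  by rewrite /h ler_pdivrMr// mulrC -ler_pdivrMr// ltW// truncnS_gt.
pose F (k : nat) := if (k < N)%N then pline @` `[(a + k%:R * h)%R, (a + k.+1%:R * h)%R] else set0.
have Fh k : ediam (F k) <= if (k < N)%N then h%:E else 0.
  rewrite /F; case: ifPn => _; last by rewrite ediam0.
  apply: ediam_le => // _ _ [s /= + <-] [s' /= + <-].
  rewrite !in_itv/= enorm_pline lee_fin ler_norml -natr1 mulrDl mul1r.
  by move=> /andP[? ?] /andP[? ?]; apply/andP; split; lra.
apply: (@le_trans _ _ (\sum_(k <oo) ediam (F k))).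
  apply: ereal_inf_lbound; exists F => //; split => [k|_ [s /= + <-]].
    by apply: le_trans (Fh k) _; case: ifPn => _; rewrite lee_fin// ltW.
  rewrite in_itv/= => /andP[sa sb].
  have [h00|hn0] := eqVneq h 0%R.
    exists 0%N => //; rewrite /F/=; exists s => //=; rewrite in_itv/= h00 !mulr0.
    by move: hN; rewrite h00 mul0r => ?; apply/andP; split; lra.
  have hp : (0 < h)%R by rewrite lt_neqAle eq_sym hn0.
  (* The truncated quotient would give index N at the right endpoint, which lies in the last piece N
     - 1. *)
  have [sb'|sb'] := eqVneq s b.
    exists N.-1 => //; rewrite /F prednK// leqnn; exists s => //=.
    rewrite in_itv/= (mulrC N%:R%R) hN (_ : N.-1%:R = N%:R - 1)%R; last first.
      by rewrite -[in RHS](@prednK N)// -natr1 addrK.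
    by rewrite mulrBl (mulrC N%:R%R) hN; apply/andP; split; lra.
  pose k := Num.trunc ((s - a) / h).
  have sah : (0 <= (s - a) / h)%R by rewrite divr_ge0// subr_ge0.
  have /andP[k1 k2] := truncn_itv sah.
  have k1' : (k%:R * h <= s - a)%R by rewrite -ler_pdivlMr.
  have k2' : (s - a < k.+1%:R * h)%R by rewrite -ltr_pdivrMr.
  exists k => //; rewrite /F ifT.
    by exists s => //=; rewrite in_itv/=; apply/andP; split; lra.
  rewrite -(ltr_nat R) -(ltr_pM2r hp) (le_lt_trans k1')// (mulrC N%:R%R) hN.
  have : (s < b)%R by rewrite lt_neqAle sb'.
  lra.
apply: (@le_trans _ _ (\sum_(k <oo) if (k < N)%N then h%:E else 0)).
  by apply: lee_nneseries => [k _ _|k _ //]; exact: ediam_ge0.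
rewrite (nneseries_split 0 N); last by move=> k _; case: ifPn.
rewrite [X in _ + X]eseries0 ?adde0; last by move=> k /=; rewrite add0n leqNgt => /negPf ->.
rewrite add0n big_mkord (eq_bigr (fun=> h%:E)); last by move=> i _; rewrite ltn_ord.
by rewrite sumEFin lee_fin sumr_const card_ord -mulr_natr hN.
Qed.

(** Each covering set is replaced by the interval [J k] spanned by its trace on the line, whose
    length is at most the diameter. These intervals cover [a, b], so countable subadditivity of
    Lebesgue measure applies. *)
Lemma hausdorff1_pline_itv_ge (a b : R) : (a <= b)%R ->
  (b - a)%:E <= hausdorff1 (pline @` `[a, b]).
Proof.
move=> ab; apply: le_trans (hausdorff1_ub _ (ltr01 : (0 < 1 :> R)%R)).
apply: le_ereal_inf_tmp => _ [F [Fd AF] <-].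
pose P k := [set s | (a <= s <= b)%R /\ F k (pline s)].
pose J k := if P k == set0 then set0 else `[inf (P k), sup (P k)]%classic.
have PJ k s : P k s -> J k s.
  move=> Ps; rewrite /J ifF; last by apply/negP => /eqP P0; rewrite P0 in Ps.
  rewrite /= in_itv/=; apply/andP; split.
    by apply: ge_inf => //; exists a => z [/andP[]].
  by apply: ub_le_sup => //; exists b => z [/andP[]].
have mJ k : measurable (J k : set R) by rewrite /J; case: ifPn.
have Jd k : lebesgue_measure (J k) <= ediam (F k).
  rewrite /J; case: ifPn => [_|/set0P[s0 Ps0]]; first by rewrite measure0 ediam_ge0.
  have [->|Foo] := eqVneq (ediam (F k)) +oo; first exact: leey.
  have fF : ediam (F k) \is a fin_num by rewrite ge0_fin_numE ?ediam_ge0// ltey.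
  have Pd s s' : P k s -> P k s' -> (s - s' <= fine (ediam (F k)))%R.
    move=> [_ Fs] [_ Fs']; rewrite (le_trans (ler_norm _))// -enorm_pline -lee_fin fineK//.
    exact: ediam_ub.
  have Psup : (sup (P k) - inf (P k) <= fine (ediam (F k)))%R.
    rewrite lerBlDr; apply: ge_sup; first by exists s0.
    move=> s Ps; rewrite -lerBlDl; apply: lb_le_inf; first by exists s0.
    by move=> s' Ps'; have := Pd _ _ Ps Ps'; lra.
  rewrite lebesgue_measure_itv/= lte_fin; case: ifPn => _; last exact: ediam_ge0.
  by rewrite -EFinD -[leRHS]fineK// lee_fin.
have abJ : `[a, b]%classic `<=` \bigcup_k J k.
  move=> s /= sab; have [|k _ Fk] := AF (pline s); first by exists s.
  by exists k => //; apply: PJ; split => //; move: sab; rewrite in_itv.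
have : lebesgue_measure (`[a, b]%classic : set R) <= \sum_(k <oo) lebesgue_measure (J k).
  exact: (measure_sigma_subadditive (@lebesgue_measure R) mJ (measurable_itv _) abJ).
rewrite lebesgue_measure_itv/= lte_fin; case: ifPn => [_|]; last first.
  rewrite -leNgt => ba _; rewrite (_ : (b - a = 0)%R); last by lra.
  by apply: nneseries_ge0 => k _ _; exact: ediam_ge0.
move=> /le_trans; apply; apply: lee_nneseries => [k _ _|k _ //].
exact: measure_ge0.
Qed.

(** Half-open intervals are the ones on which Lebesgue measure is characterized; dropping an
    endpoint changes nothing since points are H^1-null. *)
Lemma hausdorff1_pline_oc (a b : R) : (a <= b)%R ->
  hausdorff1 (pline @` `]a, b]) = (b - a)%:E.
Proof.
move=> ab; apply/eqP; rewrite eq_le; apply/andP; split.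
  apply: le_trans (hausdorff1_pline_itv_le ab); apply: le_hausdorff1.
  by apply: image_subset => s /=; rewrite !in_itv/= => /andP[/ltW -> ->].
apply: le_trans (hausdorff1_pline_itv_ge ab) _.
rewrite -[leRHS]adde0 -(hausdorff1_set1 (pline a)).
apply: le_trans (outer_measureU2 (H1_outer R n) _ _); apply: le_hausdorff1.
move=> _ [s /= + <-]; rewrite in_itv/= le_eqVlt => /andP[/predU1P[<-|sa] sb]; first by right.
by left; exists s => //=; rewrite in_itv/= sa.
Qed.

End Line.

(** * From nonnegative to signed integrands *)

Section GeneralIntegrals.
Local Open Scope ereal_scope.

(** A change of variables is applied to positive and negative parts separately. Multiplication by a
    positive finite constant distributes over their difference even when a part has infinite
    integral. *)
Lemma ge0_integral_signed d (T : measurableType d) (R : realType)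
    (mu : {measure set T -> \bar R}) (D : set T) d' (T' : measurableType d')
    (mu' : {measure set T' -> \bar R}) (D' : set T')
    (f : T -> \bar R) (phi : T' -> T) (c : R) : (0 < c)%R ->
  (forall g : T -> \bar R, measurable_fun D g -> (forall x, 0 <= g x) ->
    \int[mu]_(x in D) g x = c%:E * \int[mu']_(x in D') g (phi x)) ->
  measurable_fun D f ->
  \int[mu]_(x in D) f x = c%:E * \int[mu']_(x in D') f (phi x).
Proof.
move=> c0 H mf; rewrite integralE.
rewrite (H _ (measurable_funepos mf) (funepos_ge0 f)).
rewrite (H _ (measurable_funeneg mf) (funeneg_ge0 f)).
have -> : \int[mu']_(x in D') f (phi x) =
  \int[mu']_(x in D') f^\+ (phi x) - \int[mu']_(x in D') f^\- (phi x).
  by rewrite [LHS]integralE; congr (_ - _); apply: eq_integral => x _;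
    rewrite (funeposE, funenegE) (funeposE, funenegE).
set a : \bar R := \int[mu']_(x in D') _; set b : \bar R := \int[mu']_(x in D') _.
have a0 : 0 <= a by apply: integral_ge0 => x _; exact: funepos_ge0.
have b0 : 0 <= b by apply: integral_ge0 => x _; exact: funeneg_ge0.
have c0' : 0 < c%:E by rewrite lte_fin.
case: a a0 => [a| |] // _; case: b b0 => [b| |] // _.
- by rewrite [RHS]muleBr.
- by rewrite gt0_muley//= gt0_muleNy.
- by rewrite gt0_muley//= gt0_muley.
- by rewrite gt0_muley//= gt0_muleNy.
Qed.

End GeneralIntegrals.

(** * Change of variables under a homothety *)

Section AffineMeasure.
Context {R : realType} {n : nat}.
Variables (x0 : 'rV[R]_n) (l : R).
Hypothesis l0 : 0 < l.
Let T : H1space R n -> H1space R n := affine x0 l.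

Lemma measurable_affine_image (A : set 'rV[R]_n) (y : 'rV[R]_n) (k : R) : 0 < k ->
  measurable (A : set (H1space R n)) ->
  measurable (affine y k @` A : set (H1space R n)).
Proof.
move=> k0 mA.
change ((H1_outer R n).-caratheodory (affine y k @` A)) => X.
have {}mA : (H1_outer R n).-caratheodory A by exact: mA.
have k1 : k != 0 by rewrite gt_eqF.
have E (B : set 'rV[R]_n) : X `&` (affine y k @` B) = affine y k @` ((affineV y k @` X) `&` B).
  apply/seteqP; split=> [x [Xx [z Bz zx]]|_ [_ [[w Xw <-] Bz] <-]].
    by rewrite -zx in Xx *; exists z => //; split => //; exists (affine y k z) => //; rewrite affineK.
  by rewrite affineVK//; split => //; exists (affineV y k w); rewrite // affineVK.
have C : ~` (affine y k @` A) = affine y k @` (~` A).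
  by rewrite !affine_image.
rewrite C !E.
change (hausdorff1 X = (hausdorff1 (affine y k @` (affineV y k @` X `&` A)) +
  hausdorff1 (affine y k @` (affineV y k @` X `&` ~` A)))%E).
rewrite !hausdorff1_affine// -muleDr//; last by rewrite ge0_adde_def// inE hausdorff1_ge0.
rewrite -(mA (affineV y k @` X)) -(hausdorff1_affine y)//.
congr hausdorff1; rewrite image_comp -[LHS]image_id.
by apply: eq_imagel => x _ /=; rewrite affineVK.
Qed.

Lemma affine_preimage (A : set 'rV[R]_n) :
  affine x0 l @^-1` A = affine (- l^-1 *: x0) l^-1 @` A.
Proof.
have l1 : l != 0 by rewrite gt_eqF.
rewrite -affineVE; apply/seteqP; split => [z Az|_ [z Az <-]] /=.
  by exists (affine x0 l z); rewrite ?affineK.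
by rewrite affineVK.
Qed.

Lemma measurable_affine : measurable_fun [set: H1space R n] T.
Proof.
move=> _ B mB; rewrite setTI affine_preimage.
by apply: measurable_affine_image; rewrite ?invr_gt0.
Qed.

Local Open Scope ereal_scope.

Lemma H1_affine_image (A : set 'rV[R]_n) : H1 (T @` A) = l%:E * H1 A.
Proof. exact: hausdorff1_affine. Qed.

Lemma H1_affine_preimage (A : set 'rV[R]_n) : H1 (T @^-1` A) = (l^-1)%:E * H1 A.
Proof.
rewrite /T affine_preimage; change (hausdorff1 (affine (- l^-1 *: x0)%R l^-1%R @` A) = l^-1%:E * hausdorff1 A).
by rewrite hausdorff1_affine// invr_gt0.
Qed.

Lemma integral_affine (A : set (H1space R n)) (f : 'rV[R]_n -> \bar R) :
  measurable A -> measurable_fun (T @` A : set (H1space R n)) f ->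
  \int[H1]_(x in (T @` A : set (H1space R n))) f x =
    l%:E * \int[H1]_(y in A) f (affine x0 l y).
Proof.
move=> mA mf.
have mTA : measurable (T @` A : set (H1space R n)) by exact: measurable_affine_image.
have l1 : l != 0%R by rewrite gt_eqF.
apply: ge0_integral_signed mf => // g mg g0.
have TT : T @^-1` (T @` A) = A.
  apply/seteqP; split=> [z [w Aw /= Twz]|z Az]; last by exists z.
  by rewrite -(affineK x0 l1 z) -[affine x0 l z]/(T z) -Twz /T affineK.
rewrite -[in RHS]TT -(ge0_integral_pushforward measurable_affine H1 mTA mg)//.
have li0 : (0 <= l^-1)%R by rewrite invr_ge0 ltW.
have mT := measurable_affine.
(* The image of H^1 under the homothety of ratio l is H^1 divided by l. *)
rewrite [in RHS](eq_measure_integral (mscale (NngNum li0) H1) (m1 := pushforward H1 T)) => [|B mB _]; last first.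
  exact: H1_affine_preimage.
rewrite ge0_integral_mscale//= muleA -EFinM mulfV// mul1e//.
Qed.

End AffineMeasure.

(** * Measurability of continuous functions and of null sets *)

Section H1Measurability.
Context {R : realType} {n : nat}.

Lemma open_H1measurable (U : set 'rV[R]_n) : open U -> measurable (U : set (H1space R n)).
Proof. by move=> oU; apply: borel_H1measurable; exact: sub_sigma_algebra. Qed.

Lemma closed_H1measurable (C : set 'rV[R]_n) : closed C -> measurable (C : set (H1space R n)).
Proof.
by move=> cC; rewrite -[C]setCK; apply: measurableC; apply: open_H1measurable; exact: closed_openC.
Qed.

Lemma eball_H1measurable (x : 'rV[R]_n) r : measurable (eball x r : set (H1space R n)).
Proof. exact/open_H1measurable/open_eball. Qed.

Lemma continuous_H1measurable (f : 'rV[R]_n -> R) :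
  continuous (f : 'rV[R]_n -> R^o) -> measurable_fun [set: H1space R n] (f : H1space R n -> R).
Proof.
move=> cf _; apply: (measurability _ (RGenOpens.measurableE R)) => //.
move=> _ [_ [a [b ->] <-]]; rewrite setTI; apply: open_H1measurable.
by apply: (open_comp (f := (f : 'rV[R]_n -> R^o))) => [x _|]; [exact: cf|exact: interval_open].
Qed.

Lemma negligible_H1measurable (N : set (H1space R n)) : H1.-negligible N -> measurable N.
Proof. by move=> nN; exact: (measure_is_complete_caratheodory (mu := H1_outer R n)). Qed.

End H1Measurability.

(** * Integration along a line as Lebesgue integration *)

Section LineMeasure.
Context {R : realType} {n : nat}.
Variables (p t : 'rV[R]_n).
Hypothesis t1 : sphere n t.
Local Notation L := (pline p t).
Local Notation cl := (cline p t).

Lemma cline_continuous : continuous (cl : 'rV[R]_n -> R^o).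
Proof.
move=> x.
exact: (continuous_comp (@subr_continuous _ _ p x) (@dot_continuous _ _ t (x - p))).
Qed.

Lemma measurable_cline : measurable_fun [set: H1space R n] (cl : H1space R n -> R).
Proof. exact/continuous_H1measurable/cline_continuous. Qed.

Lemma measurable_pline_range : measurable (range L : set (H1space R n)).
Proof.
rewrite (_ : range L = \bigcap_(j in [set: 'I_n])
    (fun x : H1space R n => x ord0 j - (p ord0 j + cl x * t ord0 j)) @^-1` [set 0]).
  apply: fin_bigcap_measurable => // j _; rewrite -[X in measurable X]setTI.
  have : measurable_fun [set: H1space R n]
      (fun x : H1space R n => x ord0 j - (p ord0 j + cl x * t ord0 j)).
    apply: measurable_funB; first exact: measurable_coord.
    apply: measurable_funD; first exact: measurable_cst.
    by apply: measurable_funM; [exact: measurable_cline|exact: measurable_cst].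
  by apply.
apply/seteqP; split=> [_ [s _ <-] j _ /=|x xL].
  by rewrite plineK// /pline !mxE subrr.
exists (cl x) => //; apply/rowP => j.
by have /= /eqP := xL j I; rewrite subr_eq0 => /eqP ->; rewrite /pline !mxE.
Qed.

Lemma pline_imageE (D : set R) : L @` D = range L `&` cl @^-1` D.
Proof.
apply/seteqP; split=> [_ [s Ds <-]|_ [[s _ <-]]]; rewrite /= plineK//.
  by split => //; exists s.
by move=> Ds; exists s.
Qed.

Lemma measurable_pline_image (D : set R) : measurable D ->
  measurable (L @` D : set (H1space R n)).
Proof.
move=> mD; rewrite pline_imageE; apply: measurableI; first exact: measurable_pline_range.
by rewrite -[X in measurable X]setTI; exact: measurable_cline.
Qed.

Let nu := mrestr (H1 : {measure set (H1space R n) -> \bar R}) measurable_pline_range.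

Let clT : H1space R n -> measurableTypeR R := cl.

Let measurable_clT : measurable_fun [set: H1space R n] clT.
Proof. exact: measurable_cline. Qed.

Let nuE (D : set R) : pushforward nu clT D = H1 (L @` D).
Proof. by rewrite pline_imageE setIC. Qed.

(** Uniqueness of Lebesgue measure: the image under [cline] of H^1 restricted to the line has the
    right value on half-open intervals. *)
Let lebesgue_nu (D : set R) : measurable D -> lebesgue_measure D = pushforward nu clT D.
Proof.
have mcl := measurable_clT.
move=> mD; apply: lebesgue_measure_unique => //= X [[a b] /= ab <-].
rewrite lebesgue_measure_itv/= lte_fin [RHS]nuE.
case: ifPn => ab'; last first.
  by rewrite set_itv_ge ?image_set0 ?measure0// bnd_simp.
by rewrite -EFinB; apply/esym; exact: (hausdorff1_pline_oc p t1 (ltW ab')).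
Qed.

Lemma H1_pline (D : set R) : measurable D -> H1 (L @` D) = lebesgue_measure D.
Proof. by move=> mD; rewrite lebesgue_nu// nuE. Qed.

Local Open Scope ereal_scope.

Lemma integral_pline (D : set R) (f : R -> \bar R) : measurable D -> measurable_fun D f ->
  \int[H1]_(x in (L @` D : set (H1space R n))) f (cl x) = \int[lebesgue_measure]_(s in D) f s.
Proof.
move=> mD mf; rewrite -[LHS]mul1e.
have mLD := measurable_pline_image mD; have mcl := measurable_clT.
apply/esym; apply: (@ge0_integral_signed _ _ R (@lebesgue_measure R) D _ (H1space R n)
  H1 (L @` D) f clT 1) => // g mg g0; rewrite mul1e.
rewrite (eq_measure_integral (pushforward nu clT)); last first.
  by move=> B mB _; exact: lebesgue_nu.
rewrite (ge0_integral_pushforward measurable_clT nu mD mg (fun x _ => g0 x)).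
have mD' : measurable (cl @^-1` D : set (H1space R n)).
  by rewrite -[X in measurable X]setTI; exact: mcl.
have mgcl : measurable_fun (cl @^-1` D : set (H1space R n)) (g \o clT).
  apply: (measurable_comp mD) => //; first by move=> _ [x Dx <-].
  exact: measurable_funS mcl.
have nuC : nu (~` range L) = 0 by rewrite /nu /= /mrestr setICl; exact: hausdorff10.
rewrite (@ge0_negligible_integral _ _ _ nu _ _ _ (measurableC measurable_pline_range) mD' mgcl
  (fun x _ => g0 (clT x)) nuC).
rewrite setDE setCK setIC -pline_imageE.
apply: eq_measure_integral => B mB BL.
have BLr : B `&` range L = B.
  by apply/setIidPl; apply: subset_trans BL _; exact: image_subset.
by rewrite -[in RHS]BLr.
Qed.

End LineMeasure.

(** * The fundamental theorem of calculus along a segment *)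

Section FTC.
Context {R : realType} {n : nat}.
Implicit Types (p t x : 'rV[R]_n) (phi : 'rV[R]_n -> R) (l : R).

Lemma H1_oseg p t l : sphere n t -> 0 <= l -> H1 (oseg p t l) = l%:E.
Proof.
move=> t1 l0; transitivity (H1 (pline p t @` `]0, l[)); first by [].
rewrite H1_pline// lebesgue_measure_itv/= lte_fin.
by case: ltP => l0'; [rewrite sube0|congr (_%:E); lra].
Qed.

Lemma measurable_oseg p t l : sphere n t -> measurable (oseg p t l : set (H1space R n)).
Proof. by move=> t1; exact: (measurable_pline_image p t1 (measurable_itv _)). Qed.

Lemma derive_partial phi t x : smooth phi ->
  'D_t (phi : 'rV[R]_n -> R^o) x = \sum_(j < n) partial j phi x * t ord0 j.
Proof.
move=> sphi; rewrite deriveE; last exact: smooth_diff.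
rewrite {1}(row_sum_coord t) linear_sum; apply: eq_bigr => j _.
by rewrite linearZ /partial deriveE; [exact: mulrC|exact: smooth_diff].
Qed.

Lemma pline_is_diff p t (s : R) : is_diff s (pline p t : R -> 'rV[R]_n) ( *:%R^~ t).
Proof.
rewrite (_ : pline p t = cst p + ( *:%R^~ t)); last exact: funext.
have D := is_diffD (is_diff_cst p s) (is_diff_scalel s t).
by rewrite add0r in D.
Qed.

Lemma is_derive_pline phi p t (s : R) : smooth phi ->
  is_derive s (1 : R) (phi \o pline p t : R -> R^o)
    (\sum_(j < n) partial j phi (pline p t s) * t ord0 j).
Proof.
move=> sphi; have [dL dLE] := pline_is_diff p t s.
have dp := smooth_diff (pline p t s) sphi.
have dc : differentiable (phi \o pline p t : R -> R^o) s by exact: (@differentiable_comp _ R _ R^o).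
apply: DeriveDef; first exact: diff_derivable.
rewrite deriveE// (@diff_comp _ R _ R^o)//= dLE scale1r -deriveE//.
exact: derive_partial.
Qed.

Lemma smooth_partial_continuous phi j : smooth phi ->
  continuous (partial j phi : 'rV[R]_n -> R^o).
Proof. by move=> sphi; exact/smooth_continuous/smooth_partial. Qed.

Lemma pline_continuous p t : continuous (pline p t : R -> 'rV[R]_n).
Proof.
move=> s; have [dL _] := pline_is_diff p t s; exact: (differentiable_continuous dL).
Qed.

(** This computes the divergence of a segment: only its endpoints contribute. *)
Lemma FTC_oseg phi p t l : smooth phi -> sphere n t -> 0 < l ->
  \int[H1]_(x in (oseg p t l : set (H1space R n)))
     (\sum_(j < n) partial j phi x * t ord0 j) = phi (p + l *: t) - phi p.
Proof.
move=> sphi t1 l0; pose f s := \sum_(j < n) partial j phi (pline p t s) * t ord0 j.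
have cf : continuous (f : R -> R^o).
  apply: continuous_big_sum => j; apply: continuous_mul; last exact: cst_continuous.
  move=> s; apply: (@continuous_comp _ _ _ (pline p t : R -> _) (partial j phi : _ -> R^o)).
    exact: pline_continuous.
  exact: smooth_partial_continuous.
have mf : measurable_fun [set: R] f by exact: continuous_measurable_fun.
rewrite /Rintegral.
transitivity (fine (\int[H1]_(x in (pline p t @` `]0%R, l[ : set (H1space R n))) (f (cline p t x))%:E)%E).
  congr fine; apply: eq_integral => x; rewrite inE => -[s _ <-].
  by rewrite /f plineK.
rewrite (integral_pline p t1 (f := EFin \o f))//; last first.
  by apply/measurable_EFinP; exact: measurable_funS mf.
rewrite integral_itv_obnd_cbnd; last by apply: measurable_funTS; apply/measurable_EFinP.
rewrite integral_itv_bndo_bndc; last by apply: measurable_funTS; apply/measurable_EFinP.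
rewrite (@continuous_FTC2 _ f (phi \o pline p t))//=.
- by rewrite /pline scale0r addr0.
- by apply: continuous_subspaceT.
- split.
  + by move=> s _; have [] := is_derive_pline p t s sphi.
  + apply: cvg_at_right_filter; apply: (differentiable_continuous).
    by apply/derivable1_diffP; have [] := is_derive_pline p t 0 sphi.
  + apply: cvg_at_left_filter; apply: (differentiable_continuous).
    by apply/derivable1_diffP; have [] := is_derive_pline p t l sphi.
- by move=> s _; rewrite derive1E; have [_ ->] := is_derive_pline p t s sphi.
Qed.

Lemma line_oseg t : sphere n t -> line t `&` Bhalf n = oseg (- (2^-1 *: t)) t 1.
Proof.
move=> t1; apply/seteqP; split=> [_ [[s _ <-]]|_ [s /= + <-]].
  rewrite /Bhalf /eball/= subr0 enormZ t1 mulr1 ltr_norml => /andP[s1 s2].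
  exists (s + 2^-1); last by rewrite scalerDl addrC addrK.
  by rewrite /= in_itv/=; apply/andP; split; lra.
rewrite in_itv/= => /andP[s0 s1].
have -> : - (2^-1 *: t) + s *: t = (s - 2^-1) *: t by rewrite scalerBl addrC.
split; first by exists (s - 2^-1).
by rewrite /Bhalf/eball/= subr0 enormZ t1 mulr1 ltr_norml; apply/andP; split; lra.
Qed.

End FTC.

(** * The density of a current and the measure it represents *)

Section Density.
Context {R : realType} {m n : nat}.
Implicit Types (d : current R m n) (phi : 'rV[R]_n -> R) (A D Omega : set 'rV[R]_n).

Lemma tensorE (b : 'rV[int]_m) (t : 'rV[R]_n) i j :
  tensor b t i j = zvec b ord0 i * t ord0 j.
Proof. by rewrite /tensor mxE big_ord1 mxE. Qed.

(** What integrating the density requires, isolated from [Mdf] so that it can be established for a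
    modified current before its divergence is known. *)
Definition current_regular d := [/\ measurable (carrier d : set (H1space R n)),
  (H1 (carrier d) < +oo)%E,
  forall x, carrier d x -> sphere n (tang d x),
  forall j, measurable_fun (carrier d : set (H1space R n)) (fun x => tang d x ord0 j)
  & forall i, H1.-integrable (carrier d : set (H1space R n))
                  (fun x => (zvec (mult d x) ord0 i)%:E)].

Lemma Mdf_regular Omega d : Mdf Omega d -> current_regular d.
Proof. by move=> [[[mc cf _] _] [st mt _] it _]; split. Qed.

Definition density d i j : 'rV[R]_n -> R :=
  (fun x => tensor (mult d x) (tang d x) i j) \_ (carrier d).

Lemma density_out d i j x : ~ carrier d x -> density d i j x = 0.
Proof. by move=> cx; rewrite /density patchE memNset. Qed.

Lemma density_in d i j x : carrier d x ->
  density d i j x = zvec (mult d x) ord0 i * tang d x ord0 j.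
Proof. by move=> cx; rewrite /density patchE mem_set// tensorE. Qed.

Lemma measurable_density d i j : current_regular d ->
  measurable_fun [set: H1space R n] (density d i j : H1space R n -> R).
Proof.
move=> [mc _ _ mt it]; apply/(measurable_restrictT _ mc).
under eq_fun do rewrite tensorE; apply: measurable_funM; last exact: mt.
by apply/measurable_EFinP; exact: measurable_int (it i).
Qed.

Lemma integrable_density d i j : current_regular d ->
  H1.-integrable [set: H1space R n] (EFin \o (density d i j : H1space R n -> R)).
Proof.
move=> dok; have [mc _ st mt it] := dok.
have /(integrable_mkcond _ mc) it' := it i.
apply: (le_integrable measurableT _ _ it').
  by apply/measurable_EFinP; exact: measurable_density.
move=> x _ /=; rewrite patchE; case: ifPn => [/set_mem cx|/negP cx].
  rewrite density_in// lee_fin normrM ler_piMr//.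
  by rewrite -(st _ cx) coord_enorm.
by rewrite density_out ?normr0 ?abse_ge0// => cx'; apply: cx; exact: mem_set.
Qed.

Lemma Rintegral_density d i j (g : 'rV[R]_n -> R) A :
  \int[H1]_(x in (carrier d `&` A : set (H1space R n)))
     (g x * tensor (mult d x) (tang d x) i j) =
  \int[H1]_(x in (A : set (H1space R n))) (g x * density d i j x).
Proof.
rewrite Rintegral_mkcondl; apply: eq_Rintegral => x _.
by rewrite /density !patchE; case: ifPn => _ //; rewrite mulr0.
Qed.

Lemma vmeasure_density d i j A :
  vmeasure_of d A i j = \int[H1]_(x in (A : set (H1space R n))) density d i j x.
Proof. by rewrite mxE Rintegral_mkcondl. Qed.

(** The i-th row of the measure applied to the gradient of phi. It is considered for all smooth phi,
    not only for test functions: coordinate functions and rescaled test functions will be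
    inserted. *)
Definition pairing d Omega phi i : R := \sum_(j < n)
  \int[H1]_(x in (Omega : set (H1space R n))) (partial j phi x * density d i j x).

Lemma divergence_free_pairing Omega d : divergence_free Omega d <->
  forall phi i, test_function Omega phi -> pairing d Omega phi i = 0.
Proof.
by split=> H phi i tphi; rewrite -[RHS](H phi i tphi) /pairing; apply: eq_bigr => j _;
  rewrite Rintegral_density.
Qed.

Lemma Rintegral_setD_null (f : H1space R n -> R) (A E : set (H1space R n)) :
  measurable A -> measurable E -> E `<=` A -> H1 (A `\` E) = 0%E ->
  H1.-integrable [set: H1space R n] (EFin \o f) ->
  (\int[H1]_(x in A) (f x)%:E = \int[H1]_(x in E) (f x)%:E)%E.
Proof.
move=> mA mE EA AE0 fi.
have mAE : measurable (A `\` E) by exact: measurableD.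
rewrite (negligible_integral mAE mA _ AE0).
  by rewrite setDD setIidr.
exact: integrableS fi.
Qed.

(** Equality of the measures is known on Borel sets only, whereas almost everywhere equality is
    tested on all H^1-measurable subsets of the two carriers. Borel regularity bridges the gap,
    because the carriers have finite H^1 measure. *)
Lemma density_ae d d' Omega : current_regular d -> current_regular d' ->
  measurable (Omega : set (borel R n)) ->
  eq_vmeasure_on Omega (vmeasure_of d) (vmeasure_of d') ->
  forall i j, {ae H1, forall x : H1space R n, Omega x -> density d i j x = density d' i j x}.
Proof.
move=> dok dok' mO dd' i j.
have mO1 : measurable (Omega : set (H1space R n)) by exact: borel_H1measurable.
have [mc fc _ _ _] := dok; have [mc' fc' _ _ _] := dok'.
pose D : set (H1space R n) := Omega `&` (carrier d `|` carrier d').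
have mD : measurable D by apply: measurableI => //; exact: measurableU.
have HD : (H1 D < +oo)%E.
  apply: (@le_lt_trans _ _ (H1 (carrier d) + H1 (carrier d'))%E); last by rewrite lte_add_pinfty.
  apply: le_trans (outer_measureU2 (H1_outer R n) _ _); apply: le_hausdorff1.
  by move=> x [].
have fi := integrable_density i j dok; have fi' := integrable_density i j dok'.
have : ae_eq H1 D (EFin \o (density d i j : H1space R n -> R)) (EFin \o (density d' i j : H1space R n -> R)).
  apply: integral_ae_eq => //.
  - exact: integrableS fi.
  - by apply: measurable_funTS; apply/measurable_EFinP; exact: measurable_density.
  move=> E ED mE.
  (* A Borel hull of the same finite measure differs from [E] by a null set, so the integrals over
     [E] equal those over a Borel set. *)
  have [B [mB EB HB]] := hausdorff1_borel E.
  have mB1 : measurable (B : set (H1space R n)) by exact: borel_H1measurable.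
  pose A := B `&` Omega.
  have mA : measurable (A : set (borel R n)) by exact: measurableI.
  have mA1 : measurable (A : set (H1space R n)) by exact: borel_H1measurable.
  have EA : E `<=` A by move=> x Ex; split; [exact: EB|have [] := ED x Ex].
  have HE : (H1 E < +oo)%E by apply: le_lt_trans HD; exact: le_hausdorff1.
  have AE0 : H1 (A `\` E) = 0%E.
    apply/eqP; rewrite eq_le measure_ge0 andbT.
    apply: (@le_trans _ _ (H1 (B `\` E))).
      by apply: le_hausdorff1 => x [[Bx _] Ex].
    rewrite measureD//=; last by rewrite HB.
    rewrite (setIidr EB); change ((hausdorff1 B - hausdorff1 E <= 0)%E).
    by rewrite HB subee// ge0_fin_numE// hausdorff1_ge0.
  have AO : A `<=` Omega by move=> x [].
  have := dd' A mA AO; move=> /(congr1 (fun M : 'M[R]_(m, n) => M i j)).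
  rewrite !vmeasure_density /Rintegral.
  rewrite (Rintegral_setD_null mA1 mE EA AE0 fi) (Rintegral_setD_null mA1 mE EA AE0 fi').
  have fE : (\int[H1]_(x in E) (density d i j x)%:E)%E \is a fin_num.
    by apply: integrable_fin_num => //; exact: integrableS fi.
  have fE' : (\int[H1]_(x in E) (density d' i j x)%:E)%E \is a fin_num.
    by apply: integrable_fin_num => //; exact: integrableS fi'.
  by move=> h; rewrite /= -(fineK fE) -(fineK fE') h.
apply: filterS => x /= Dx Ox.
have [cx|cx] := pselect (D x); first by have [] := Dx cx.
have nc : ~ carrier d x by move=> c; apply: cx; split => //; left.
have nc' : ~ carrier d' x by move=> c; apply: cx; split => //; right.
by rewrite !density_out.
Qed.

End Density.

Lemma Rintegral_sum d (T : measurableType d) (R : realType)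
    (mu : {measure set T -> \bar R}) (D : set T) (I : Type) (s : seq I)
    (F : I -> T -> R) : measurable D ->
  (forall i, mu.-integrable D (EFin \o F i)) ->
  mu.-integrable D (EFin \o (fun x => \sum_(i <- s) F i x)) /\
  \int[mu]_(x in D) (\sum_(i <- s) F i x) = \sum_(i <- s) \int[mu]_(x in D) F i x.
Proof.
move=> mD Fi; elim: s => [|i s [IHi IH]].
  rewrite (_ : (fun x => \sum_(i <- [::]) F i x) = cst 0); last first.
    by apply/funext => x; rewrite big_nil.
  split; first exact: integrable0.
  by rewrite big_nil Rintegral_cst// mul0r.
have E : (fun x => \sum_(j <- i :: s) F j x) = (fun x => F i x + \sum_(j <- s) F j x).
  by apply/funext => x; rewrite big_cons.
rewrite E; split.
  have := integrableD mD (Fi i) IHi.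
  by apply: eq_integrable => // x _.
by rewrite big_cons RintegralD// IH.
Qed.

(** * Testing currents with arbitrary smooth functions *)

Section Pairing.
Context {R : realType} {m n : nat}.
Implicit Types (d : current R m n) (phi f g : 'rV[R]_n -> R) (K Omega : set 'rV[R]_n).


Lemma integrable_continuous_density f d Omega i j :
  continuous (f : 'rV[R]_n -> R^o) -> current_regular d ->
  measurable (Omega : set (H1space R n)) -> Omega `<=` Bhalf n ->
  H1.-integrable (Omega : set (H1space R n))
    (EFin \o (fun x : H1space R n => f x * density d i j x)).
Proof.
move=> cf dok mO OB.
have fb : [bounded f x | x in (Omega : set (H1space R n))].
  have cK : compact (f @` closed_eball (0 : 'rV[R]_n) 2^-1 : set R^o).
    apply: continuous_compact; last exact: compact_closed_eball.
    exact: continuous_subspaceT.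
  have [M [Mr MK]] := compact_bounded cK.
  exists M; split => // N MN x Ox; apply: MK MN _ _; exists x => //.
  by have := OB x Ox; rewrite /Bhalf/eball/closed_eball/= => /ltW.
have fm : measurable_fun (Omega : set (H1space R n)) (f : H1space R n -> R).
  by apply: measurable_funTS; exact: continuous_H1measurable.
have di := integrableS measurableT mO (@subsetT _ _) (integrable_density i j dok).
by have := integrableMr mO fm fb di; apply: eq_integrable => // x _.
Qed.

Lemma Bhalf_H1measurable : measurable (Bhalf n : set (H1space R n)).
Proof. exact: eball_H1measurable. Qed.

Lemma pairingD d f g i : current_regular d -> smooth f -> smooth g ->
  pairing d (Bhalf n) (fun x => f x + g x) i =
  pairing d (Bhalf n) f i + pairing d (Bhalf n) g i.
Proof.
move=> dok sf sg; rewrite /pairing -big_split; apply: eq_bigr => j _ /=.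
rewrite partialD => [|x|x]; [|exact: smooth_diff|exact: smooth_diff].
rewrite -RintegralD.
- by apply: eq_Rintegral => x _; rewrite mulrDl.
- exact: Bhalf_H1measurable.
- apply: integrable_continuous_density => //; last exact: Bhalf_H1measurable.
  exact: smooth_partial_continuous.
- apply: integrable_continuous_density => //; last exact: Bhalf_H1measurable.
  exact: smooth_partial_continuous.
Qed.

Lemma eq_Rintegral_density d d' f i j Omega : continuous (f : 'rV[R]_n -> R^o) ->
  current_regular d -> current_regular d' -> measurable (Omega : set (borel R n)) ->
  (forall x, ~ Omega x -> f x = 0) -> eq_vmeasure_on (Omega `&` Bhalf n) (vmeasure_of d) (vmeasure_of d') ->
  \int[H1]_(x in (Bhalf n : set (H1space R n))) (f x * density d i j x) =
  \int[H1]_(x in (Bhalf n : set (H1space R n))) (f x * density d' i j x).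
Proof.
move=> cf dok dok' mO f0 dd'; rewrite /Rintegral; congr fine.
have mB : measurable (Bhalf n : set (borel R n)).
  by apply: sub_sigma_algebra; exact: open_eball.
have mOB : measurable (Omega `&` Bhalf n : set (borel R n)) by exact: measurableI.
have := density_ae dok dok' mOB dd' i j => aedd'.
have mfd d1 : current_regular d1 -> measurable_fun (Bhalf n : set (H1space R n))
    (fun x : H1space R n => (f x * density d1 i j x)%:E).
  move=> d1ok; apply: measurable_funTS; apply/measurable_EFinP.
  by apply: measurable_funM; [exact: continuous_H1measurable|exact: measurable_density].
apply: ae_eq_integral => //; [exact: Bhalf_H1measurable|exact: mfd|exact: mfd|].
apply: filterS aedd' => x /= Ex Bx; congr (_%:E).
have [Ox|Ox] := pselect (Omega x); first by rewrite Ex.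
by rewrite f0// !mul0r.
Qed.

(** Split phi by a cutoff eta that is 1 on the ball of radius r0. The part eta phi is a test
    function, on which both pairings vanish. The part (1 - eta) phi is zero on the ball, and outside
    it the two currents define the same measure. *)
Lemma pairing_eq d d' phi i (r0 : R) : 0 <= r0 < 2^-1 ->
  current_regular d -> current_regular d' ->
  divergence_free (Bhalf n) d -> divergence_free (Bhalf n) d' ->
  eq_vmeasure_on (Bhalf n `\` eball 0 r0) (vmeasure_of d) (vmeasure_of d') ->
  smooth phi -> pairing d (Bhalf n) phi i = pairing d' (Bhalf n) phi i.
Proof.
move=> /andP[r00 r01] dok dok' /divergence_free_pairing df /divergence_free_pairing df' dd' sphi.
pose r1 := (r0 + 2^-1) / 2.
have r0r1 : r0 < r1 by rewrite /r1; lra.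
have r11 : r1 < 2^-1 by rewrite /r1; lra.
have [eta [seta eta1 eta0]] := @smooth_cutoff R n r0 r1 (introT andP (conj r00 r0r1)).
pose f x := eta x * phi x; pose g x := (1 + -1 * eta x) * phi x.
have sf : smooth f by exact: smoothM.
have sg : smooth g.
  apply: smoothM => //; apply: smoothD; first exact: smooth_cst.
  by apply: smoothM => //; exact: smooth_cst.
have phiE : phi = (fun x => f x + g x) by apply/funext => x; rewrite /f /g; ring.
have tf : test_function (Bhalf n) f.
  split => //; exists (closed_eball 0 r1); split; first exact: compact_closed_eball.
    by move=> x; rewrite /closed_eball/Bhalf/eball/= => /le_lt_trans; apply.
  by move=> x /negP; rewrite -ltNge subr0 => /ltW xr; rewrite /f eta0// mul0r.
rewrite phiE !pairingD// df// df'//; congr (_ + _).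
apply: eq_bigr => j _; apply: (eq_Rintegral_density i j (Omega := ~` eball 0 r0)) => //.
- exact: smooth_partial_continuous.
- by apply: measurableC; apply: sub_sigma_algebra; exact: open_eball.
- move=> x /contrapT xr; have -> : partial j g x = partial j (cst 0) x; last by rewrite partial_cst.
  apply: partial_near; have : nbhs x (eball 0 r0).
    by apply: open_nbhs_nbhs; split => //; exact: open_eball.
  apply: filterS => y; rewrite /eball/= subr0 => yr.
  by rewrite /g eta1 ?(ltW yr)// mul1r mulN1r addrN || rewrite /g eta1 ?ltW//; ring.
- by rewrite setIC -setDE.
Qed.

End Pairing.

(** * Approximate tangents: locality, lines, homotheties *)

Section ApproxTangent.
Context {R : realType}.

Lemma at_right0P (A : set R) : 0^'+ A <-> exists2 e : R, 0 < e & forall r, 0 < r < e -> A r.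
Proof.
split=> [|[e e0 eA]].
  rewrite /at_right /within => /nbhs_ballP[e /= e0 eA]; exists e => // r /andP[r0 re].
  by apply: eA => //; rewrite -ball_normE /= sub0r normrN gtr0_norm.
rewrite /at_right /within; apply/nbhs_ballP; exists e => // r.
rewrite -ball_normE /= sub0r normrN => re r0; apply: eA; rewrite r0/=.
by apply: le_lt_trans re; exact: ler_norm.
Qed.

Lemma at_right0_scale (A : set R) (l : R) : 0 < l -> 0^'+ A -> 0^'+ [set r | A (l * r)].
Proof.
move=> l0 /at_right0P[e e0 eA]; apply/at_right0P; exists (e / l); first by rewrite divr_gt0.
move=> r /andP[r0 re] /=; apply: eA; rewrite mulr_gt0//=.
by rewrite mulrC -ltr_pdivlMr.
Qed.

Local Open Scope ereal_scope.

Lemma limf_esup_le (f g : R -> \bar R) (F : set_system R) : Filter F ->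
  (\forall r \near F, f r <= g r) -> limf_esup f F <= limf_esup g F.
Proof.
move=> FF fg; apply: le_ereal_inf_tmp => _ [V FV <-].
apply: (@le_trans _ _ (ereal_sup (f @` (V `&` [set r | f r <= g r])))).
  by apply: ereal_inf_lbound; exists (V `&` [set r | f r <= g r]) => //; exact: filterI.
apply: ge_ereal_sup => _ [r [Vr /= fgr] <-]; apply: le_trans fgr _.
by apply: ereal_sup_ubound; exists r.
Qed.

Lemma limf_esup_cst_le (f : R -> \bar R) (F : set_system R) (c : \bar R) : ProperFilter F ->
  (\forall r \near F, c <= f r) -> c <= limf_esup f F.
Proof.
move=> FF cf; apply: le_ereal_inf_tmp => _ [V FV <-].
have /filter_ex[r [Vr cr]] : F (V `&` (fun r => c <= f r)) by exact: filterI.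
by apply: le_trans cr _; apply: ereal_sup_ubound; exists r.
Qed.

Lemma limf_esup_scale (f : R -> \bar R) (l : R) : (0 < l)%R ->
  limf_esup f 0^'+ <= limf_esup (fun r => f (l * r)%R) 0^'+.
Proof.
move=> l0; apply: le_ereal_inf_tmp => _ [V FV <-].
apply: (@le_trans _ _ (ereal_sup (f @` [set r | V (l^-1 * r)%R]))).
  apply: ereal_inf_lbound; exists [set r | V (l^-1 * r)%R] => //.
  by apply: at_right0_scale => //; rewrite invr_gt0.
apply: ge_ereal_sup => _ [r /= Vr <-]; apply: ereal_sup_ubound.
by exists (l^-1 * r)%R => //; rewrite mulVKf// gt_eqF.
Qed.

Local Close Scope ereal_scope.
Context {n : nat}.
Implicit Types (gamma : set 'rV[R]_n) (x v : 'rV[R]_n).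

Lemma approx_tangent_local gamma gamma' x v (rho : R) : 0 < rho ->
  gamma `&` eball x rho = gamma' `&` eball x rho ->
  approx_tangent gamma x v -> approx_tangent gamma' x v.
Proof.
move=> rho0 gg'.
have E (r : R) : 0 < r < rho -> gamma `&` closed_eball x r = gamma' `&` closed_eball x r.
  move=> /andP[_ rr]; have -> : closed_eball x r = eball x rho `&` closed_eball x r.
    by apply/esym/setIidPr => y; rewrite /closed_eball /eball/= => /le_lt_trans; apply.
  by rewrite !setIA gg'.
have nE : \forall r \near 0^'+, gamma `&` closed_eball x r = gamma' `&` closed_eball x r.
  by apply/at_right0P; exists rho.
move=> [up cone0]; split.
  apply: lt_le_trans up _; apply: limf_esup_le.
  by apply: filterS nE => r ->.
move=> s s01; apply: cvg_trans (cone0 s s01).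
by apply: near_eq_cvg; apply: filterS nE => r ->.
Qed.

Lemma approx_tangent_line (p t : 'rV[R]_n) (s : R) : sphere n t ->
  approx_tangent (range (pline p t)) (pline p t s) t.
Proof.
move=> t1; set x := pline p t s.
have HB (r : R) : 0 < r -> (H1 (range (pline p t) `&` closed_eball x r) = (2 * r)%:E)%E.
  move=> r0; have -> : range (pline p t) `&` closed_eball x r = pline p t @` `[s - r, s + r].
    apply/seteqP; split=> [_ [[u _ <-]]|_ [u /= + <-]].
      rewrite /closed_eball/= enorm_pline// => ur; exists u => //=.
      by rewrite in_itv/= -ler_distl.
    rewrite in_itv/= => ur; split; first by exists u.
    by rewrite /closed_eball/= enorm_pline// ler_distl.
  rewrite H1_pline// lebesgue_measure_itv/= lte_fin ifT; last by lra.
  by rewrite -EFinB; congr (_%:E); lra.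
split.
  apply: (@lt_le_trans _ _ 1%E) => //; apply: limf_esup_cst_le.
  apply/at_right0P; exists 1 => // r /andP[r0 _].
  by rewrite HB// -EFinM mulfV// gt_eqF// mulr_gt0.
move=> c /andP[c0 c1]; apply: (@cvg_trans _ (0%E @[r --> 0^'+])); last exact: cvg_cst.
apply: near_eq_cvg; apply/at_right0P; exists 1 => // r /andP[r0 _].
(* Every point of the line other than the vertex lies in the cone, and the strict inequality
   excludes the vertex, so at most one point remains. *)
suff -> : H1 ((range (pline p t) `&` closed_eball x r) `\` cone x t c) = 0%E by rewrite mul0e.
apply/eqP; rewrite eq_le measure_ge0 andbT -(hausdorff1_set1 x).
apply: le_hausdorff1 => y [[[u _ <-] _] yc] /=.
apply: contrapT => ux; apply: yc; rewrite /cone/=.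
have uE : pline p t u - x = (u - s) *: t.
  by rewrite /x /pline opprD addrACA subrr add0r scalerBl.
rewrite uE dotZl (sphere_dot t1) mulr1 subrr enorm0 mulr_gt0//.
by rewrite -uE enorm_gt0// subr_eq0; apply/eqP.
Qed.

(** Both conditions involve ratios of H^1 to a radius, and a homothety of ratio l multiplies both by
    l while mapping cones to cones with the same axis and opening. *)
Lemma approx_tangent_affine gamma x v (x0 : 'rV[R]_n) (l : R) : 0 < l ->
  approx_tangent gamma x v ->
  approx_tangent (affine x0 l @` gamma) (affine x0 l x) v.
Proof.
move=> l0 [up cone0].
have l1 : l != 0 by rewrite gt_eqF.
have li0 : 0 < l^-1 by rewrite invr_gt0.
have EB (r : R) : (affine x0 l @` gamma) `&` closed_eball (affine x0 l x) r =
    affine x0 l @` (gamma `&` closed_eball x (l^-1 * r)).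
  apply/seteqP; split=> [_ [[y gy <-]]|_ [y [gy yr] <-]]; rewrite /closed_eball/=.
    rewrite affineB enormZ gtr0_norm// => yr; exists y => //; split => //.
    by rewrite /closed_eball/= mulrC ler_pdivlMr// mulrC.
  split; first by exists y.
  rewrite affineB enormZ gtr0_norm//.
  by move: yr; rewrite /closed_eball/= mulrC ler_pdivlMr// mulrC.
have EC (B : set 'rV[R]_n) s : (affine x0 l @` B) `\` cone (affine x0 l x) v s =
    affine x0 l @` (B `\` cone x v s).
  have H y : cone (affine x0 l x) v s (affine x0 l y) <-> cone x v s y.
    rewrite /cone/= affineB dotZl -scalerA -scalerBr !enormZ mulrCA.
    by rewrite ltr_pM2l// normr_gt0.
  apply/seteqP; split=> [_ [[y By <-] yc]|_ [y [By yc] <-]].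
    by exists y => //; split => // /H.
  by split; [exists y|move=> /H].
split.
  apply: lt_le_trans up _; apply: le_trans (limf_esup_scale _ li0) _.
  apply: limf_esup_le; apply/at_right0P; exists 1 => // r /andP[r0 _].
  rewrite EB [X in (_ <= X * _)%E]H1_affine_image// muleAC -EFinM.
  rewrite (_ : l * (2 * r)^-1 = (2 * (l^-1 * r))^-1); last first.
    by rewrite !invfM invrK; ring.
  by rewrite muleC.
move=> s s01.
pose f (r : R) := (H1 ((gamma `&` closed_eball x r) `\` cone x v s) * (r^-1)%:E)%E.
have fc : f @ 0^'+ --> 0%E := cone0 s s01.
have -> : (fun r => H1 ((affine x0 l @` gamma `&` closed_eball (affine x0 l x) r) `\` cone (affine x0 l x) v s) * r^-1%:E)%E
    = (fun r => f (l^-1 * r)).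
  apply/funext => r; rewrite EB EC [X in (X * _ = _)%E]H1_affine_image// muleAC -EFinM /f muleC.
  by congr (_ * _%:E)%E; rewrite invfM invrK.
by move=> A /fc /= Af; exact: (at_right0_scale li0 Af).
Qed.

End ApproxTangent.

(** The line runs through the centre of the ball, so its trace on any concentric ball is a diameter,
    which can be matched with a rescaled competitor. *)
Definition straight_in (R : realType) (m n : nat) (d : current R m n) b t c (rho : R) :=
  forall x, eball c rho x -> (carrier d x <-> range (pline c t) x) /\
    (carrier d x -> mult d x = b /\ tang d x = t).

(** * Polyhedral currents *)

Section Polyhedral.
Context {R : realType} {m n N : nat}.
Variables (b_ : 'I_N -> 'rV[int]_m) (p_ t_ : 'I_N -> 'rV[R]_n) (l_ : 'I_N -> R).
Let gamma_ i := oseg (p_ i) (t_ i) (l_ i).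

(** The segments are open and will be disjoint, so at most one summand is nonzero at each point. The
    omitted endpoints are H^1-null. *)
Definition polyhedral : current R m n := Current (\bigcup_i gamma_ i)
  (fun x => \sum_(i < N) if x \in gamma_ i then b_ i else 0)
  (fun x => \sum_(i < N) if x \in gamma_ i then t_ i else 0).

Hypothesis gammaP : forall i, [/\ sphere n (t_ i), 0 < l_ i & gamma_ i `<=` Bhalf n].
Hypothesis gamma_disj : forall i j, i != j -> gamma_ i `&` gamma_ j = set0.

Let t1 i : sphere n (t_ i). Proof. by case: (gammaP i). Qed.
Let l0 i : 0 < l_ i. Proof. by case: (gammaP i). Qed.
Let gB i : gamma_ i `<=` Bhalf n. Proof. by case: (gammaP i). Qed.

Lemma gamma_uniq i j x : gamma_ i x -> gamma_ j x -> i = j.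
Proof.
move=> gi gj; apply/eqP; apply: contrapT => /negP ij.
by have := gamma_disj ij; rewrite -subset0 => /(_ x); apply.
Qed.

Lemma sum_gamma (V : nmodType) (F : 'I_N -> V) i x : gamma_ i x ->
  \sum_(j < N) (if x \in gamma_ j then F j else 0) = F i.
Proof.
move=> gi; rewrite (bigD1 i)//= mem_set// big1 ?addr0// => j ji.
by rewrite ifF//; apply/negP => /set_mem gj; move: ji; rewrite (gamma_uniq gi gj) eqxx.
Qed.

Lemma sum_gamma0 (V : nmodType) (F : 'I_N -> V) x : ~ (\bigcup_i gamma_ i) x ->
  \sum_(j < N) (if x \in gamma_ j then F j else 0) = 0.
Proof.
move=> gx; rewrite big1// => j _.
by rewrite ifF//; apply/negP => /set_mem gj; apply: gx; exists j.
Qed.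

Lemma polyhedral_mult i x : gamma_ i x -> mult polyhedral x = b_ i.
Proof. exact: sum_gamma. Qed.

Lemma polyhedral_tang i x : gamma_ i x -> tang polyhedral x = t_ i.
Proof. exact: sum_gamma. Qed.

Lemma measurable_gamma i : measurable (gamma_ i : set (H1space R n)).
Proof. exact: measurable_oseg. Qed.

Lemma H1_gamma i : H1 (gamma_ i) = (l_ i)%:E.
Proof. by rewrite H1_oseg// ltW. Qed.

Lemma measurable_polyhedral : measurable (carrier polyhedral : set (H1space R n)).
Proof. by apply: fin_bigcup_measurable => // i _; exact: measurable_gamma. Qed.

Lemma bigcup_gammaE : \bigcup_i gamma_ i = \big[setU/set0]_(i < N) gamma_ i.
Proof.
by rewrite -bigcup_seq; apply: eq_bigcupl; split=> // i _; exact: mem_index_enum.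
Qed.

Lemma trivIset_gamma (D : set 'I_N) : trivIset D gamma_.
Proof. by apply/trivIsetP => i j _ _; exact: gamma_disj. Qed.

Lemma H1_polyhedral_lty : (H1 (carrier polyhedral) < +oo)%E.
Proof.
rewrite /= [X in (_ X < _)%E]bigcup_gammaE; elim/big_ind : _ => [|A B HA HB|i _].
- by rewrite hausdorff10.
- apply: (@le_lt_trans _ _ (hausdorff1 A + hausdorff1 B)%E).
    exact: (outer_measureU2 (H1_outer R n)).
  by rewrite lte_add_pinfty.
- by have := H1_gamma i; rewrite /= => ->; rewrite ltry.
Qed.

Lemma measurable_sum_gamma (F : 'I_N -> R) :
  measurable_fun [set: H1space R n]
    (fun x : H1space R n => \sum_(j < N) (if x \in gamma_ j then F j else 0)).
Proof.
apply: measurable_sum => j.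
have -> : (fun x : H1space R n => if x \in gamma_ j then F j else 0) =
    (fun x => F j * \1_(gamma_ j : set (H1space R n)) x).
  apply/funext => x; rewrite indicE; case: ifPn => _; first by rewrite mulr1.
  by rewrite mulr0.
by apply: measurable_funM => //; exact: measurable_indic (measurable_gamma j).
Qed.

Lemma polyhedral_regular : current_regular polyhedral.
Proof.
have mc := measurable_polyhedral.
split; [by []|exact: H1_polyhedral_lty| | |].
- by move=> x [i _ gx]; rewrite (polyhedral_tang gx).
- move=> j; apply: (eq_measurable_fun
    (fun x : H1space R n => \sum_(k < N) (if x \in gamma_ k then t_ k ord0 j else 0))).
    by move=> x /set_mem[k _ gx]; rewrite (sum_gamma _ gx) (polyhedral_tang gx).
  by apply: measurable_funTS; exact: measurable_sum_gamma.
- move=> i; apply: (@measurable_bounded_integrable _ _ _ H1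
    (fun x : H1space R n => zvec (mult polyhedral x) ord0 i)).
  + exact: mc.
  + exact: H1_polyhedral_lty.
  + apply: (eq_measurable_fun
      (fun x : H1space R n => \sum_(k < N) (if x \in gamma_ k then zvec (b_ k) ord0 i else 0))).
      by move=> x /set_mem[k _ gx]; rewrite (sum_gamma _ gx) (polyhedral_mult gx).
    by apply: measurable_funTS; exact: measurable_sum_gamma.
  + exists (\sum_(k < N) `|zvec (b_ k) ord0 i : R|); split; first exact: num_real.
    move=> M MM x [k _ gx]; change (`|zvec (mult polyhedral x) ord0 i : R| <= M).
    rewrite (polyhedral_mult gx); apply: le_trans (ltW MM).
    by rewrite (bigD1 k)//= lerDl sumr_ge0.
Qed.

Lemma polyhedral_density i j x : density polyhedral i j x =
  \sum_(k < N) (if x \in gamma_ k then tensor (b_ k) (t_ k) i j else 0).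
Proof.
have [[k _ gx]|gx] := pselect ((\bigcup_k gamma_ k) x).
  rewrite (sum_gamma (fun k => tensor (b_ k) (t_ k) i j) gx) density_in; last by exists k.
  by rewrite (polyhedral_mult gx) (polyhedral_tang gx) tensorE.
by rewrite sum_gamma0// density_out.
Qed.

Lemma Rintegral_polyhedral (h : 'rV[R]_n -> R) (g : 'I_N -> 'rV[R]_n -> R) :
  H1.-integrable (carrier polyhedral : set (H1space R n)) (EFin \o (h : H1space R n -> R)) ->
  (forall k x, gamma_ k x -> h x = g k x) ->
  \int[H1]_(x in (carrier polyhedral : set (H1space R n))) h x =
  \sum_(k < N) \int[H1]_(x in (gamma_ k : set (H1space R n))) g k x.
Proof.
move=> hi hg; rewrite /Rintegral.
have gi k : H1.-integrable (gamma_ k : set (H1space R n)) (EFin \o (h : H1space R n -> R)).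
  apply: integrableS hi; [exact: measurable_polyhedral|exact: measurable_gamma|].
  by move=> x gx; exists k.
rewrite [X in integral _ X _]bigcup_gammaE integral_bigsetU_EFin.
- rewrite -sum_fine => [|k _].
    by apply: eq_bigr => k _; congr fine; apply: eq_integral => x /set_mem gx; rewrite (hg k).
  by apply: integrable_fin_num => //; exact: measurable_gamma.
- exact: measurable_gamma.
- exact: index_enum_uniq.
- exact: trivIset_gamma.
- by move: (measurable_int _ hi); rewrite [X in measurable_fun X _]bigcup_gammaE.
Qed.

Lemma carrier_polyhedral_Bhalf : carrier polyhedral `<=` Bhalf n.
Proof. by move=> x [k _ gx]; exact: gB gx. Qed.

(** By [FTC_oseg] each segment contributes the increment of phi between its endpoints, so being
    divergence-free becomes a balance of multiplicities at the vertices. *)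
Lemma polyhedral_pairing phi i : smooth phi -> pairing polyhedral (Bhalf n) phi i =
  \sum_(k < N) zvec (b_ k) ord0 i * (phi (p_ k + l_ k *: t_ k) - phi (p_ k)).
Proof.
move=> sphi; have preg := polyhedral_regular.
have E j : \int[H1]_(x in (Bhalf n : set (H1space R n)))
     (partial j phi x * density polyhedral i j x) =
   \sum_(k < N) \int[H1]_(x in (gamma_ k : set (H1space R n)))
      (zvec (b_ k) ord0 i * (partial j phi x * t_ k ord0 j)).
  rewrite -Rintegral_density setIidl; last exact: carrier_polyhedral_Bhalf.
  apply: (Rintegral_polyhedral (h := fun x => partial j phi x *
    tensor (mult polyhedral x) (tang polyhedral x) i j)
    (g := fun k x => zvec (b_ k) ord0 i * (partial j phi x * t_ k ord0 j))).
    have := integrableS Bhalf_H1measurable measurable_polyhedral carrier_polyhedral_Bhalf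
      (integrable_continuous_density i j (smooth_partial_continuous (j := j) sphi) preg
        Bhalf_H1measurable (@subset_refl _ _)).
    apply: eq_integrable; first exact: measurable_polyhedral.
    by move=> x /set_mem cx /=; rewrite density_in// tensorE.
  by move=> k x gx; rewrite tensorE (polyhedral_mult gx) (polyhedral_tang gx); ring.
rewrite /pairing (eq_bigr _ (fun j _ => E j)) exchange_big/=; apply: eq_bigr => k _.
have gi j : H1.-integrable (gamma_ k : set (H1space R n))
    (EFin \o (fun x : H1space R n => partial j phi x * t_ k ord0 j)).
  apply: (@measurable_bounded_integrable _ _ _ H1
    (fun x : H1space R n => partial j phi x * t_ k ord0 j)).
  - exact: measurable_gamma.
  - by rewrite [X in (X < _)%E]H1_gamma ltry.
  - apply: measurable_funTS; apply: measurable_funM => //.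
    exact/continuous_H1measurable/smooth_partial_continuous.
  - have cK : compact ((fun x => partial j phi x * t_ k ord0 j) @` closed_eball (0 : 'rV[R]_n) 2^-1 : set R^o).
      apply: continuous_compact; last exact: compact_closed_eball.
      apply: continuous_subspaceT; apply: continuous_mul; first exact: smooth_partial_continuous.
      exact: cst_continuous.
    have [M [Mr MK]] := compact_bounded cK.
    exists M; split => // M' MM' x gx; apply: MK MM' _ _; exists x => //.
    by have := gB gx; rewrite /Bhalf/eball/closed_eball/= => /ltW.
rewrite -FTC_oseg//.
have [_ ->] := Rintegral_sum (index_enum _) (measurable_gamma k) gi.
rewrite mulr_sumr; apply: eq_bigr => j _; rewrite RintegralZl//.
exact: measurable_gamma.
Qed.

Lemma polyhedral_vmeasure (A : set 'rV[R]_n) : measurable (A : set (H1space R n)) ->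
  vmeasure_of polyhedral A = poly_vmeasure b_ t_ gamma_ A.
Proof.
move=> mA; apply/matrixP => i j; rewrite vmeasure_density.
rewrite /poly_vmeasure summxE.
have -> : (fun x : H1space R n => density polyhedral i j x) =
  (fun x => \sum_(k < N) tensor (b_ k) (t_ k) i j * \1_(gamma_ k : set (H1space R n)) x).
  apply/funext => x; rewrite polyhedral_density; apply: eq_bigr => k _.
  by rewrite indicE; case: ifPn => _; rewrite ?mulr1 ?mulr0.
have ii k : H1.-integrable (A : set (H1space R n))
    (EFin \o (\1_(gamma_ k : set (H1space R n)) : H1space R n -> R)).
  apply/integrableP; split.
    by apply: measurable_funTS; apply/measurable_EFinP; exact: measurable_indic (measurable_gamma k).
  rewrite (eq_integral (fun x => (\1_(gamma_ k : set (H1space R n)) x : R)%:E)); last first.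
    by move=> x _ /=; rewrite ger0_norm.
  rewrite integral_indic//; last exact: measurable_gamma.
  apply: (@le_lt_trans _ _ (H1 (gamma_ k))); first by apply: le_hausdorff1 => x [].
  by rewrite [X in (X < _)%E]H1_gamma ltry.
have ii' k : H1.-integrable (A : set (H1space R n)) (EFin \o (fun x : H1space R n =>
    tensor (b_ k) (t_ k) i j * \1_(gamma_ k : set (H1space R n)) x)).
  by have := integrableZl mA (tensor (b_ k) (t_ k) i j) (ii k); apply: eq_integrable.
have [_ ->] := Rintegral_sum (index_enum _) mA ii'.
apply: eq_bigr => k _; rewrite RintegralZl// /const_vmeasure !mxE mulrC; congr (_ * _).
rewrite /Rintegral integral_indic//; exact: measurable_gamma.
Qed.

Lemma polyhedral_energy (f : 'rV[int]_m -> 'rV[R]_n -> \bar R) (c : 'I_N -> R) :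
  (forall k, 0 <= c k) -> (forall k, f (b_ k) (t_ k) = (c k)%:E) ->
  energy f polyhedral (Bhalf n) = (\sum_(k < N) (l_ k)%:E * (c k)%:E)%E.
Proof.
move=> c0 fc; rewrite /energy setIidl; last exact: carrier_polyhedral_Bhalf.
pose h (x : H1space R n) := f (mult polyhedral x) (tang polyhedral x).
have hE k x : gamma_ k x -> h x = (c k)%:E.
  by move=> gx; rewrite /h (polyhedral_mult gx) (polyhedral_tang gx).
have mh : measurable_fun (carrier polyhedral : set (H1space R n)) h.
  move=> _ B mB; rewrite (_ : _ `&` _ = \bigcup_(k in [set k | B (c k)%:E]) gamma_ k).
    by apply: fin_bigcup_measurable => // k _; exact: measurable_gamma.
  apply/seteqP; split=> [x [[k _ gx] Bx]|x [k /= Bk gx]].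
    by exists k => //=; rewrite -(hE k x gx).
  by split; [exists k|rewrite /= (hE k x gx)].
transitivity (\int[H1]_(x in (\big[setU/set0]_(k < N) gamma_ k : set (H1space R n))) h x)%E.
  by rewrite -bigcup_gammaE.
rewrite (@ge0_integral_bigsetU _ _ _ H1 _ (gamma_ : 'I_N -> set (H1space R n)) h (index_enum _)).
- apply: eq_bigr => k _; rewrite (eq_integral (cst (c k)%:E)); last first.
    by move=> x /set_mem gx; exact: hE gx.
  by rewrite integral_cst ?[X in (_ * X)%E]H1_gamma 1?muleC//; exact: measurable_gamma.
- exact: measurable_gamma.
- exact: index_enum_uniq.
- exact: trivIset_gamma.
- by rewrite -bigcup_gammaE.
- rewrite -bigcup_gammaE => x [k _ gx].
  by rewrite (hE k x gx) lee_fin.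
Qed.

Definition vertices : set 'rV[R]_n := range p_ `|` range (fun k => p_ k + l_ k *: t_ k).

(** The other closed segments form a compact set that avoids x, so a small ball around x sees only
    the segment of x. *)
Lemma polyhedral_straight_in k x : gamma_ k x -> ~ vertices x ->
  exists rho : R, [/\ 0 < rho, eball x rho `<=` Bhalf n &
    straight_in polyhedral (b_ k) (t_ k) x rho].
Proof.
move=> gx vx; pose U := ~` (\bigcup_(j in [set j | j != k]) (pline (p_ j) (t_ j) @` `[0, l_ j])).
have oU : open U.
  apply: closed_openC; apply: closed_bigcup => [|j _].
    exact: finite_finset.
  apply: compact_closed; first exact: norm_hausdorff.
  apply: continuous_compact; last exact: segment_compact.
  by apply: continuous_subspaceT; exact: pline_continuous.
(* A point of another closed segment is either one of its endpoints, hence a vertex, or an interior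
   point, which disjointness rules out. *)
have Ux : U x.
  move=> [j /= jk [s /= + xs]]; rewrite in_itv/= => /andP[s0 sl].
  have [s00|s00] := eqVneq s 0.
    by apply: vx; left; exists j => //; rewrite -xs /pline s00 scale0r addr0.
  have [sl'|sl'] := eqVneq s (l_ j).
    by apply: vx; right; exists j => //; rewrite -xs /pline sl'.
  apply: (negP jk); apply/eqP; apply: (gamma_uniq (x := x)) => //.
  exists s => //=; rewrite in_itv/=; apply/andP; split; rewrite lt_neqAle.
    by rewrite eq_sym s00.
  by rewrite sl'.
have oB : open (Bhalf n : set 'rV[R]_n) by exact: open_eball.
have [r1 r10 r1U] := open_eballP (openI oU oB) (conj Ux (gB gx)).
have [s /= + xs] := gx; rewrite in_itv/= => /andP[s0 sl].
(* Staying below the distances to both endpoints makes the open segment coincide with its whole line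
   inside the ball. *)
pose rho := Num.min r1 (Num.min s (l_ k - s)).
have rho0 : 0 < rho by rewrite !lt_min r10 s0 subr_gt0.
have rr1 : rho <= r1 by rewrite ge_min lexx.
have rs : rho <= s by rewrite !ge_min lexx orbT.
have rl : rho <= l_ k - s by rewrite !ge_min lexx !orbT.
have rU : eball x rho `<=` U `&` Bhalf n.
  by move=> y yr; apply: r1U; rewrite /eball/=; apply: lt_le_trans rr1.
exists rho; split => //; first by move=> y /rU[].
move=> y yr; have [Uy _] := rU y yr.
have gk j : gamma_ j y -> j = k.
  move=> gy; apply/eqP; apply: contrapT => /negP jk; apply: Uy; exists j => //.
  by have [u /= + <-] := gy; rewrite in_itv/= => /andP[/ltW u0 /ltW ul];
    exists u => //=; rewrite in_itv/= u0.
split; last first.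
  by move=> [j _ gy]; rewrite (polyhedral_mult gy) (polyhedral_tang gy) (gk j gy).
split=> [[j _ gy]|[u _ uy]].
  have := gy; rewrite (gk j gy) => -[u _ <-]; exists (u - s) => //.
  by rewrite /pline -xs -addrA -scalerDl addrCA subrr addr0.
exists k => //; exists (s + u); last by rewrite scalerDl addrA [p_ k + s *: _]xs -uy.
have : `|u - 0| < rho.
  by rewrite -(enorm_pline x (t1 k)) uy /pline scale0r addr0.
rewrite subr0 ltr_norml /= in_itv/= => /andP[u1 u2].
by apply/andP; split; lra.
Qed.

Lemma negligible_vertices : H1.-negligible (vertices : set (H1space R n)).
Proof.
have H1v (F : 'I_N -> 'rV[R]_n) : hausdorff1 (range F) = 0%E.
  apply/eqP; rewrite eq_le hausdorff1_ge0 andbT.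
  rewrite (_ : range F = \big[setU/set0]_(k < N) [set F k]); last first.
    rewrite -bigcup_seq; apply/seteqP; split=> [_ [k _ <-]|x [k _ ->]]; exists k => //=.
    exact: mem_index_enum.
  elim/big_ind : _ => [|A B HA HB|k _].
  - by rewrite hausdorff10.
  - apply: le_trans (outer_measureU2 (H1_outer R n) _ _) _.
    by rewrite -(adde0 0%E); apply: leeD.
  - by rewrite hausdorff1_set1.
have Hv : hausdorff1 vertices = 0%E.
  apply/eqP; rewrite eq_le hausdorff1_ge0 andbT.
  apply: le_trans (outer_measureU2 (H1_outer R n) _ _) _.
  by rewrite -(adde0 0%E); apply: leeD; rewrite [X in (X <= _)%E]H1v.
exists (vertices : set (H1space R n)); split => //.
have [B [mB vB HB]] := hausdorff1_borel vertices.
apply: negligible_H1measurable; exists (B : set (H1space R n)); split => //.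
  exact: borel_H1measurable.
by rewrite -Hv -HB.
Qed.

(** Off the null set of vertices the carrier is locally a line, and approximate tangency is a local
    property. *)
Lemma polyhedral_tangent : {ae H1, forall x : H1space R n,
  carrier polyhedral x -> approx_tangent (carrier polyhedral) x (tang polyhedral x)}.
Proof.
apply: negligibleS negligible_vertices => x /= /not_implyP[[k _ gx] nt].
apply: contrapT => vx; apply: nt.
have [rho [rho0 _ st]] := polyhedral_straight_in gx vx.
rewrite (sum_gamma _ gx); apply: (approx_tangent_local rho0 (gamma := range (pline x (t_ k)))).
  by apply/seteqP; split=> y [cy yr]; split=> //; have [[h1 h2] _] := st y yr; [exact: h2|exact: h1].
by have := approx_tangent_line x 0 (t1 k); rewrite /pline scale0r addr0.
Qed.

Lemma polyhedral_rectifiable : rectifiable1 (carrier polyhedral).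
Proof.
split; [exact: measurable_polyhedral|exact: H1_polyhedral_lty|].
pose f (k : nat) : R -> 'rV[R]_n := if insub k is Some i then pline (p_ i) (t_ i) else cst 0.
exists f; split=> [k|].
  rewrite /f; case: insub => [i|].
    exists (`|t_ i|); split; first exact: num_real.
    move=> M MM /= [x y] _ /=.
    rewrite (_ : _ - _ = (x - y) *: t_ i); last first.
      by rewrite /pline opprD addrACA subrr add0r scalerBl.
    by rewrite normrZ mulrC ler_wpM2r// ltW.
  exists 1; split; first exact: num_real.
  by move=> M MM /= [x y] _ /=; rewrite subrr normr0 mulr_ge0// (le_trans _ (ltW MM)).
rewrite (_ : _ `\` _ = set0) ?measure0// -subset0 => x [[k _ [s _ <-]]] [].
by exists k => //; rewrite /f valK; exists s.
Qed.

Lemma polyhedral_Mdf :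
  (forall phi i, test_function (Bhalf n) phi ->
     \sum_(k < N) zvec (b_ k) ord0 i * (phi (p_ k + l_ k *: t_ k) - phi (p_ k)) = 0 :> R) ->
  Mdf (Bhalf n) polyhedral.
Proof.
move=> H; have [_ _ st mt it] := polyhedral_regular; split => //.
- by split; [exact: polyhedral_rectifiable|exact: carrier_polyhedral_Bhalf].
- by split => //; exact: polyhedral_tangent.
- apply/divergence_free_pairing => phi i tphi.
  by rewrite polyhedral_pairing ?H//; case: tphi.
Qed.

End Polyhedral.

(** * The straight current and the class of competitors *)

Section Straight.
Context {R : realType} {m n : nat}.
Implicit Types (b : 'rV[int]_m) (t : 'rV[R]_n) (d : current R m n).

Definition straight b t : current R m n :=
  polyhedral (fun _ : 'I_1 => b) (fun _ => - (2^-1 *: t)) (fun _ => t) (fun _ => 1).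

Let seg t (_ : 'I_1) := oseg (- (2^-1 *: t)) t 1.

Lemma straightP t : sphere n t ->
  (forall i, [/\ sphere n t, 0 < 1 :> R & seg t i `<=` Bhalf n]) /\
  (forall i j, i != j -> seg t i `&` seg t j = set0).
Proof.
move=> t1; split=> [i|i j]; last by rewrite !ord1 eqxx.
by split => //; rewrite /seg -line_oseg// => x [].
Qed.

Lemma straight_carrier b t : sphere n t -> carrier (straight b t) = line t `&` Bhalf n.
Proof.
move=> t1; rewrite line_oseg//; apply/seteqP; split=> [x [_ _]//|x gx].
by exists ord0.
Qed.

Lemma straight_mult b t x : sphere n t -> carrier (straight b t) x ->
  mult (straight b t) x = b /\ tang (straight b t) x = t.
Proof.
move=> t1 [k _ gx]; have [H1 H2] := straightP t1.
by split; [exact: (polyhedral_mult _ H2 gx)|exact: (polyhedral_tang _ H2 gx)].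
Qed.

Lemma straight_regular b t : sphere n t -> current_regular (straight b t).
Proof. by move=> /straightP[H1 H2]; exact: polyhedral_regular. Qed.

Lemma straight_vmeasure b t A : sphere n t -> measurable (A : set (borel R n)) ->
  vmeasure_of (straight b t) A = const_vmeasure b t (line t `&` Bhalf n) A.
Proof.
move=> t1 mA; have [H1 H2] := straightP t1.
rewrite (polyhedral_vmeasure _ H1 H2); last exact: borel_H1measurable.
by rewrite /poly_vmeasure big_ord1 line_oseg.
Qed.

Lemma straight_pairing b t phi i : sphere n t -> smooth phi ->
  pairing (straight b t) (Bhalf n) phi i =
  zvec b ord0 i * (phi (2^-1 *: t) - phi (- (2^-1 *: t))).
Proof.
move=> t1 sphi; have [H1 H2] := straightP t1.
rewrite (polyhedral_pairing _ H1 H2)// big_ord1 scale1r.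
suff -> : - (2^-1 *: t) + t = 2^-1 *: t by [].
by rewrite -{2}(scale1r t) -scaleNr -scalerDl; congr (_ *: _); lra.
Qed.

Lemma test_function_boundary phi (t : 'rV[R]_n) : test_function (Bhalf n) phi ->
  2^-1 <= enorm t -> phi t = 0.
Proof.
move=> [_ [K [_ KB K0]]] t2; apply: K0 => /KB; rewrite /Bhalf/eball/= subr0.
by rewrite ltNge t2.
Qed.

Lemma enorm_half t : sphere n t -> enorm (2^-1 *: t) = 2^-1.
Proof. by move=> t1; rewrite enormZ t1 mulr1 ger0_norm. Qed.

Lemma straight_Mdf b t : sphere n t -> Mdf (Bhalf n) (straight b t).
Proof.
move=> t1; have [H1 H2] := straightP t1.
apply: polyhedral_Mdf => // phi i tphi; rewrite big_ord1 scale1r.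
rewrite !(test_function_boundary tphi) ?subrr ?mulr0//.
  by rewrite enormN enorm_half.
rewrite (_ : _ + t = 2^-1 *: t) ?enorm_half//.
by rewrite -{2}(scale1r t) -scaleNr -scalerDl; congr (_ *: _); lra.
Qed.

Lemma straight_energy f b t (c : R) : sphere n t -> 0 <= c -> f b t = c%:E ->
  energy f (straight b t) (Bhalf n) = c%:E.
Proof.
move=> t1 c0 fc; have [H1 H2] := straightP t1.
by rewrite (polyhedral_energy H1 H2 (c := fun=> c))// big_ord1 mul1e.
Qed.

(** The competitors of [envelope] in a handier form, justified by [straight_near_boundaryE]: the
    exceptional ball is centred at 0, and the reference measure comes from a current. *)
Definition admissible b t d := Mdf (Bhalf n) d /\
  exists2 r : R, 0 <= r < 2^-1 &
    eq_vmeasure_on (Bhalf n `\` eball 0 r) (vmeasure_of d) (vmeasure_of (straight b t)).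

(** The point of the closed ball farthest from the origin, y + r e with e along y, lies in the open
    ball of radius 1/2. For y = 0 any unit vector e serves, and one exists since n > 0. *)
Lemma closed_eball_Bhalf (y : 'rV[R]_n) r : (0 < n)%N -> 0 < r -> closed_eball y r `<=` Bhalf n ->
  enorm y + r < 2^-1.
Proof.
move=> n0 r0 yB.
have [e e1 ey] : exists2 e : 'rV[R]_n, enorm e = 1 & y = enorm y *: e.
  have [->|y0] := eqVneq y 0.
    by exists (delta_mx ord0 (Ordinal n0)); rewrite ?enorm_delta// enorm0 scale0r.
  have yn : enorm y != 0 by rewrite gt_eqF// enorm_gt0.
  exists ((enorm y)^-1 *: y); last by rewrite scalerA mulfV// scale1r.
  by rewrite enormZ ger0_norm ?invr_ge0 ?enorm_ge0// mulVf.
have : Bhalf n (y + r *: e).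
  by apply: yB; rewrite /closed_eball/= addrC addKr enormZ e1 mulr1 gtr0_norm.
rewrite /Bhalf/eball/= subr0 {1}ey -scalerDl enormZ e1 mulr1 ger0_norm//.
by rewrite addr_ge0 ?enorm_ge0// ltW.
Qed.

Lemma straight_near_boundaryE mu b t : (0 < n)%N -> sphere n t ->
  straight_near_boundary mu b t <-> exists2 r : R, 0 <= r < 2^-1 &
    eq_vmeasure_on (Bhalf n `\` eball 0 r) mu (vmeasure_of (straight b t)).
Proof.
move=> n0 t1; split=> [[y [r [r0 yB E]]]|[r /andP[r0 r1] E]].
  exists (enorm y + r).
    by rewrite addr_ge0 ?enorm_ge0 ?ltW//= closed_eball_Bhalf.
  move=> A mA AB; rewrite straight_vmeasure//; apply: E => // x /AB[Bx xr]; split=> // xy.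
  apply: xr; rewrite /eball/= subr0; have := enormD (x - y) y; rewrite subrK.
  by move: xy; rewrite /eball/=; lra.
exists 0, ((r + 2^-1) / 2); split; first by lra.
  by move=> x; rewrite /closed_eball/Bhalf/eball/=; lra.
move=> A mA AB; rewrite -straight_vmeasure//; apply: E => // x /AB[Bx xr]; split=> // xy.
by apply: xr; move: xy; rewrite /eball/=; lra.
Qed.

Lemma admissible_straight b t : sphere n t -> admissible b t (straight b t).
Proof.
move=> t1; split; first exact: straight_Mdf.
by exists 0; [rewrite lexx/= invr_gt0 ltr0n|move=> A].
Qed.

Lemma admissible_regular b t d : admissible b t d -> current_regular d.
Proof. by case=> /Mdf_regular. Qed.

Lemma admissible_pairing b t d phi i : sphere n t -> admissible b t d -> smooth phi ->
  pairing d (Bhalf n) phi i = pairing (straight b t) (Bhalf n) phi i.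
Proof.
move=> t1 [Md [r r0 E]] sphi.
have [_ _ _ dfd] := Md; have [_ _ _ dfs] := straight_Mdf b t1.
exact: (pairing_eq i r0 (Mdf_regular Md) (straight_regular b t1) dfd dfs E sphi).
Qed.

Lemma envelopeE psi b t : (0 < n)%N -> sphere n t ->
  envelope psi b t = ereal_inf [set energy (fun b' t' => (psi b' t')%:E) d (Bhalf n) |
    d in [set d | admissible b t d]].
Proof.
move=> n0 t1; congr ereal_inf; apply/seteqP; split=> _ [d [Md sd] <-]; exists d => //; split => //.
  by apply/straight_near_boundaryE.
by apply/(straight_near_boundaryE _ b n0 t1).
Qed.

End Straight.

(** * Measurability of the energy density and the lower bound *)

Section CurrentEnergy.
Context {R : realType} {m n : nat}.
Variable psi : 'rV[int]_m -> 'rV[R]_n -> R.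
Hypothesis mpsi : forall b, measurable_fun (sphere n : set (borel R n)) (psi b).
Implicit Types (b : 'rV[int]_m) (t : 'rV[R]_n) (d : current R m n).

Lemma measurable_sphere : measurable (sphere n : set (borel R n)).
Proof.
rewrite -[sphere n]setCK; apply: measurableC; apply: sub_sigma_algebra => /=.
apply: closed_openC; rewrite (_ : sphere n = (fun x => enorm x : R^o) @^-1` [set 1])//.
by apply: closed_comp => [x _|]; [exact: enorm_continuous|exact: closed_eq].
Qed.

(** The multiplicity takes countably many values; on each level set the integrand is the Borel
    function [psi b] composed with the tangent. *)
Lemma measurable_energy d : current_regular d ->
  measurable_fun (carrier d : set (H1space R n))
    (fun x : H1space R n => (psi (mult d x) (tang d x))%:E).
Proof.
move=> [mc _ st mt it]; apply/measurable_EFinP => _ B mB.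
rewrite (_ : _ `&` _ = \bigcup_(b : 'rV[int]_m)
    ((carrier d `&` (tang d : H1space R n -> borel R n) @^-1` (sphere n `&` psi b @^-1` B)) `&`
     \bigcap_(i in [set: 'I_m]) (carrier d `&`
        (fun x : H1space R n => zvec (mult d x) ord0 i : R) @^-1` [set (b ord0 i)%:~R]))).
  apply: countType_bigcup_measurable => b; apply: measurableI.
    apply: measurable_fun_borel => //.
    exact: mpsi measurable_sphere B mB.
  apply: fin_bigcap_measurable => // i _.
  by move: (measurable_int _ (it i)) => /measurable_EFinP mi; apply: mi.
apply/seteqP; split=> [x [cx Bx]|x [b _ [[cx [_ /= Bx]] xb]]].
  exists (mult d x) => //; split; first by split => //; split => //; exact: st.
  by move=> i _; split => //=; rewrite mxE.
split=> //=; suff -> : mult d x = b by [].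
by apply/rowP => i; have [_ /=] := xb i I; rewrite mxE => /intr_inj.
Qed.

Hypothesis psi_ge0 : forall b t, sphere n t -> 0 <= psi b t.

(** A competitor and the straight current pair equally with every coordinate function, so theta_i
    tau_k has integral b_i t_k, while c0 |theta_i tau_k| is at most the energy density. The factor n
    m comes from summing over i and k, using that the |t_k| sum to at least 1. *)
Lemma energy_lower_bound (c0 : R) b t d : 0 < c0 -> sphere n t ->
  (forall b t, sphere n t -> c0 * enorm (zvec b : 'rV[R]_m) <= psi b t) ->
  admissible b t d ->
  ((c0 * enorm (zvec b : 'rV[R]_m))%:E <=
     (n * m)%:R%:E * energy (fun b t => (psi b t)%:E) d (Bhalf n))%E.
Proof.
move=> c00 t1 psib ad; have dreg := admissible_regular ad.
have [mc fc st mt it] := dreg.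
have cB : carrier d `<=` Bhalf n by case: ad => -[[_ ]].
rewrite /energy setIidl//.
set E := (X in (_ <= _ * X)%E).
have E0 : (0 <= E)%E by apply: integral_ge0 => x cx; rewrite lee_fin psi_ge0//; exact: st.
have mE := measurable_energy dreg.
(* the calibration by the coordinate functions *)
have Ecoord i k : ((c0 * `|\int[H1]_(x in (Bhalf n : set (H1space R n))) density d i k x|)%:E <= E)%E.
  have di : H1.-integrable (Bhalf n : set (H1space R n)) (EFin \o (density d i k : H1space R n -> R)).
    exact: (integrableS measurableT Bhalf_H1measurable (@subsetT _ _) (integrable_density i k dreg)).
  rewrite EFinM EFin_normr_Rintegral//; last exact: Bhalf_H1measurable.
  have md : measurable_fun (Bhalf n : set (H1space R n)) (EFin \o (density d i k : H1space R n -> R)).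
    exact: measurable_int di.
  apply: (@le_trans _ _ (c0%:E * \int[H1]_(x in (Bhalf n : set (H1space R n))) `|(density d i k x)%:E|)%E).
    rewrite lee_pmul2l//; exact: (le_abse_integral _ Bhalf_H1measurable md).
  have mnd : measurable_fun (Bhalf n : set (H1space R n)) (fun x : H1space R n => `|(density d i k x)%:E|%E).
    exact: (measurableT_comp (@abse_measurable R setT) md).
  have c00' : (0 <= c0%:E)%E by rewrite lee_fin ltW.
  rewrite -(ge0_integralZl H1 Bhalf_H1measurable mnd (fun x _ => abse_ge0 _) c00').
  rewrite /E [leRHS]integral_mkcond [leLHS]integral_mkcond.
  apply: ge0_le_integral; first exact: measurableT.
  - by move=> x _; rewrite patchE; case: ifPn => _; [rewrite mule_ge0// lee_fin ltW|exact: lexx].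
  - apply/(measurable_restrictT _ Bhalf_H1measurable).
    exact: measurable_funeM.
  - exact/(measurable_restrictT _ mc).
  move=> x _; rewrite !patchE; case: (ifPn (x \in carrier d)) => [/set_mem cx|/negP cx].
    rewrite mem_set; last exact: cB.
    rewrite density_in// /= lee_fin; apply: le_trans (psib _ _ (st _ cx)).
    rewrite ler_wpM2l ?(ltW c00)// normrM.
    apply: le_trans (coord_enorm _ i); rewrite ler_piMr//.
    by rewrite -(st _ cx) coord_enorm.
  rewrite density_out; last by move=> cx'; apply: cx; exact: mem_set.
  by rewrite abse0 mule0; case: ifPn => _; exact: lexx.
(* The gradient of the k-th coordinate function is constant, so only the k-th term of the pairing
   survives. *)
have pE i k : \int[H1]_(x in (Bhalf n : set (H1space R n))) density d i k x = zvec b ord0 i * t ord0 k.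
  have := admissible_pairing i t1 ad (smooth_coord k).
  rewrite straight_pairing//; last exact: smooth_coord.
  rewrite /pairing (bigD1 k)//= big1 ?addr0 => [|j jk].
    have h1 : (delta_mx ord0 k : 'rV[R]_n) ord0 k = 1 by rewrite mxE !eqxx.
    have h2 : (2^-1 *: t) ord0 k - (- (2^-1 *: t)) ord0 k = t ord0 k by rewrite !mxE; lra.
    rewrite partial_coord h1 h2 => <-.
    by apply: eq_Rintegral => x _; rewrite mul1r.
  rewrite partial_coord (@eq_Rintegral _ _ _ H1 _ (cst 0)).
    by rewrite Rintegral_cst ?mul0r//; exact: Bhalf_H1measurable.
  by move=> x _ /=; rewrite mxE (negPf (_ : k != j)) ?andbF ?mul0r// eq_sym.
have [Eoo|Efin] := eqVneq E +oo%E.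
  (* If the factor n m vanishes, its product with infinity is 0. The unit vector t forces m = 0 in
     that case, so the left side is 0 as well. *)
  rewrite Eoo; have [nm0|nm0] := eqVneq (n * m)%:R (0 : R).
    have m0 : m = 0%N.
      move/eqP: nm0; rewrite pnatr_eq0 muln_eq0 => /orP[/eqP n0|/eqP//].
      by move: t1; rewrite /sphere/= /enorm /dot; move: (t); rewrite n0 => ?; rewrite big_ord0 sqrtr0 => /eqP; rewrite eq_sym oner_eq0.
    rewrite nm0 mul0e (_ : enorm _ = 0) ?mulr0//.
    by rewrite /enorm /dot; move: (zvec b : 'rV[R]_m); rewrite m0 => ?; rewrite big_ord0 sqrtr0.
  by rewrite gt0_muley ?leey// lte_fin lt_neqAle eq_sym nm0 ler0n.
have fE : E \is a fin_num by rewrite ge0_fin_numE// ltey.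
rewrite -(fineK fE) -EFinM lee_fin; set e := fine E.
have bk i k : c0 * `|zvec b ord0 i * t ord0 k| <= e :> R.
  by rewrite -lee_fin (fineK fE) -(pE i k).
have bi i : c0 * `|zvec b ord0 i : R| <= n%:R * e.
  have tk : 1 <= \sum_(k < n) `|t ord0 k|.
    by have := enorm_le_sum t; rewrite (t1 : enorm t = 1).
  apply: (@le_trans _ _ (c0 * `|zvec b ord0 i : R| * \sum_(k < n) `|t ord0 k|)).
    by rewrite ler_peMr// mulr_ge0// ltW.
  rewrite mulr_sumr; apply: (@le_trans _ _ (\sum_(k < n) e)).
    by apply: ler_sum => k _; rewrite -mulrA -normrM; exact: bk.
  by rewrite sumr_const card_ord mulr_natl.
apply: (@le_trans _ _ (\sum_(i < m) c0 * `|zvec b ord0 i : R|)).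
  by rewrite -mulr_sumr ler_wpM2l ?(ltW c00)// enorm_le_sum.
rewrite (le_trans (ler_sum _ (fun i _ => bi i)))//.
by rewrite sumr_const card_ord -[leLHS]mulr_natl natrM mulrCA mulrA.
Qed.

End CurrentEnergy.

Lemma integrableU d (T : measurableType d) (R : realType)
    (mu : {measure set T -> \bar R}) (A B : set T) (f : T -> \bar R) :
  measurable A -> measurable B -> [disjoint A & B] ->
  mu.-integrable A f -> mu.-integrable B f -> mu.-integrable (A `|` B) f.
Proof.
move=> mA mB AB /integrableP[mfA fA] /integrableP[mfB fB]; apply/integrableP.
have mf : measurable_fun (A `|` B) f by apply/measurable_funU.
split => //; rewrite ge0_integral_setU//; first by rewrite lte_add_pinfty.
exact: measurableT_comp.
Qed.

(** * Transport of integrals and null sets by a homothety *)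

Section AffineTransport.
Context {R : realType} {n : nat}.
Variables (c : 'rV[R]_n) (l : R).
Hypothesis l0 : 0 < l.
Let T := affine c l.
Let V := affineV c l.

Let l1 : l != 0. Proof. by rewrite gt_eqF. Qed.

Lemma measurable_affineV : measurable_fun [set: H1space R n] (V : H1space R n -> H1space R n).
Proof. by rewrite /V affineVE; apply: measurable_affine; rewrite invr_gt0. Qed.

Lemma measurable_fun_affineV d (U : measurableType d) (A : set (H1space R n))
    (g : H1space R n -> U) : measurable A -> measurable_fun A g ->
  measurable_fun (T @` A : set (H1space R n)) (fun x => g (V x)).
Proof.
move=> mA mg; apply: (measurable_comp mA _ mg).
  by move=> _ [_ [y Ay <-] <-]; rewrite /T /V affineK.
apply: measurable_funTS; exact: measurable_affineV.
Qed.

Lemma integral_affineV (A : set (H1space R n)) (g : 'rV[R]_n -> \bar R) :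
  measurable A -> measurable_fun A g ->
  (\int[H1]_(x in (T @` A : set (H1space R n))) g (V x) = l%:E * \int[H1]_(x in A) g x)%E.
Proof.
move=> mA mg; rewrite (integral_affine (x0 := c) l0 mA (f := fun x => g (V x))).
  by congr (_ * _)%E; apply: eq_integral => x _; rewrite /V affineK.
exact: (measurable_fun_affineV mA mg).
Qed.

Lemma Rintegral_affineV (A : set (H1space R n)) (g : 'rV[R]_n -> R) :
  measurable A -> H1.-integrable A (EFin \o (g : H1space R n -> R)) ->
  \int[H1]_(x in (T @` A : set (H1space R n))) g (V x) = l * \int[H1]_(x in A) g x.
Proof.
move=> mA gi; rewrite /Rintegral.
rewrite (integral_affineV (g := fun x => (g x)%:E) mA (measurable_int _ gi)).
by rewrite fineM//; exact: integrable_fin_num.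
Qed.

Lemma integrable_affineV (A : set (H1space R n)) (g : 'rV[R]_n -> \bar R) :
  measurable A -> H1.-integrable A (g : H1space R n -> \bar R) ->
  H1.-integrable (T @` A : set (H1space R n)) (fun x => g (V x)).
Proof.
move=> mA /integrableP[mg gi]; apply/integrableP; split.
  exact: (measurable_fun_affineV mA mg).
rewrite (integral_affineV (g := fun x => `|g x|%E) mA).
  by rewrite lte_mul_pinfty// ?lee_fin ?ltW.
exact: measurableT_comp.
Qed.

Lemma affine_eball (r : R) : T @` eball 0 r = eball c (l * r).
Proof.
rewrite /T affine_image//; apply/seteqP; split=> x; rewrite /eball/affineV/= subr0;
  by rewrite enormZ gtr0_norm ?invr_gt0// ltr_pdivrMl.
Qed.

Lemma negligible_affine (N : set (H1space R n)) : H1.-negligible N ->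
  H1.-negligible (T @` N : set (H1space R n)).
Proof.
move=> [A [mA HA NA]]; exists (T @` A); split.
- exact: measurable_affine_image.
- by rewrite [LHS]H1_affine_image// HA mule0.
- exact: image_subset.
Qed.

End AffineTransport.

(** * Gluing a rescaled competitor into a ball *)

Section Glue.
Context {R : realType} {m n : nat}.
Variables (d s : current R m n) (c : 'rV[R]_n) (r : R).
Let T := affine c (2 * r).
Let V := affineV c (2 * r).
Let B := eball c r.

(** [T] maps the ball of radius 1/2 onto the ball [B] of radius r, hence the ratio 2r. Multiplicity
    and tangent are carried along unchanged, because a homothety of positive ratio preserves
    directions. *)
Definition glue : current R m n := Current
  ((carrier d `\` B) `|` (T @` carrier s))
  (fun x => if x \in B then mult s (V x) else mult d x)
  (fun x => if x \in B then tang s (V x) else tang d x).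

Hypothesis r0 : 0 < r.
Hypothesis dreg : current_regular d.
Hypothesis sreg : current_regular s.
Hypothesis sB : carrier s `<=` Bhalf n.

Let l0 : 0 < 2 * r. Proof. by rewrite mulr_gt0. Qed.
Let l1 : 2 * r != 0. Proof. by rewrite gt_eqF. Qed.

Let TB : T @` Bhalf n = B.
Proof. by rewrite affine_eball// (_ : 2 * r * 2^-1 = r)//; lra. Qed.

Let TsB : T @` carrier s `<=` B.
Proof. by rewrite -TB; exact: image_subset. Qed.

Let mB : measurable (B : set (H1space R n)).
Proof. exact: eball_H1measurable. Qed.

Let mdB : measurable (carrier d `\` B : set (H1space R n)).
Proof. by apply: measurableD => //; case: dreg. Qed.

Let mTs : measurable (T @` carrier s : set (H1space R n)).
Proof. by apply: measurable_affine_image => //; case: sreg. Qed.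

Let disjB : [disjoint (carrier d `\` B : set (H1space R n)) & T @` carrier s].
Proof. by apply/disj_setPS => x [[_ xB] /TsB]. Qed.

Lemma glue_carrier_in x : B x -> carrier glue x <-> carrier s (V x).
Proof.
move=> Bx; split=> [[[_ /(_ Bx)//]|[y sy <-]]|sx]; first by rewrite /V /T affineK.
by right; exists (V x) => //; rewrite /T /V affineVK.
Qed.

Lemma glue_in x : B x -> mult glue x = mult s (V x) /\ tang glue x = tang s (V x).
Proof. by move=> Bx; rewrite /= mem_set. Qed.

Lemma glue_out x : ~ B x ->
  [/\ carrier glue x <-> carrier d x, mult glue x = mult d x & tang glue x = tang d x].
Proof.
move=> Bx; split; last 2 first.
- by rewrite /= memNset.
- by rewrite /= memNset.
by split=> [[[]//|/TsB//]|dx]; left.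
Qed.

Lemma glue_density i j x :
  density glue i j x = if x \in B then density s i j (V x) else density d i j x.
Proof.
case: ifPn => [/set_mem Bx|/negP nBx].
  have [gm gt] := glue_in Bx.
  have [sx|sx] := pselect (carrier s (V x)).
    rewrite density_in; last exact/glue_carrier_in.
    by rewrite density_in// gm gt.
  by rewrite !density_out// => /glue_carrier_in; auto.
have Bx : ~ B x by move=> Bx; apply: nBx; exact: mem_set.
have [gc gm gt] := glue_out Bx.
have [dx|dx] := pselect (carrier d x).
  by rewrite density_in ?gm ?gt ?density_in//; exact/gc.
by rewrite !density_out// => /gc.
Qed.

Lemma glue_regular : current_regular glue.
Proof.
have [mc fc st mt it] := dreg; have [mc' fc' st' mt' it'] := sreg.
have mglue : measurable (carrier glue : set (H1space R n)) by exact: measurableU.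
split; first exact: mglue.
- apply: (@le_lt_trans _ _ (H1 (carrier d `\` B) + H1 (T @` carrier s))%E).
    exact: (outer_measureU2 (H1_outer R n)).
  rewrite [X in (_ + X)%E]H1_affine_image//; apply: lte_add_pinfty.
    by apply: le_lt_trans fc; apply: le_hausdorff1 => x [].
  by rewrite lte_mul_pinfty// ?lee_fin ?ltW.
- move=> x [[dx Bx]|sx]; first by have [_ _ ->] := glue_out Bx; exact: st.
  have Bx := TsB sx; have [_ ->] := glue_in Bx; apply: st'.
  by apply/(glue_carrier_in Bx); right.
- move=> j; apply/(measurable_funU _ mdB mTs); split.
    apply: (eq_measurable_fun (fun x : H1space R n => tang d x ord0 j)).
      by move=> x /set_mem[_ Bx]; have [_ _ ->] := glue_out Bx.
    by apply: (measurable_funS mc _ (mt j)) => x [].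
  apply: (eq_measurable_fun (fun x : H1space R n => tang s (V x) ord0 j)).
    by move=> x /set_mem/TsB Bx; have [_ ->] := glue_in Bx.
  exact: (measurable_fun_affineV l0 mc' (mt' j)).
- move=> i; apply: (integrableU mdB mTs disjB).
    apply: (eq_integrable mdB (fun x : H1space R n => (zvec (mult d x) ord0 i)%:E)).
      by move=> x /set_mem[_ Bx]; have [_ -> _] := glue_out Bx.
    by apply: (integrableS mc mdB _ (it i)) => x [].
  apply: (eq_integrable mTs (fun x : H1space R n => (zvec (mult s (V x)) ord0 i)%:E)).
    by move=> x /set_mem/TsB Bx; have [-> _] := glue_in Bx.
  have := integrable_affineV c l0 (g := fun x => (zvec (mult s x) ord0 i)%:E) mc' (it' i).
  exact.
Qed.

Lemma glue_rectifiable : rectifiable1 (carrier d) -> rectifiable1 (carrier s) ->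
  rectifiable1 (carrier glue).
Proof.
move=> [_ _ [f [lf Hf]]] [_ _ [g [lg Hg]]].
have [mg fg _ _ _] := glue_regular; split => //.
(* The two countable families of curves are interleaved: even indices for d, odd ones for the
   rescaled s. *)
pose h k : R -> 'rV[R]_n := if odd k then T \o g k./2 else f k./2.
exists h; split=> [k|].
  rewrite /h; case: ifP => _; last exact: lf.
  have [M [Mr gM]] := lg k./2; exists (`|2 * r| * M); split; first by rewrite num_real.
  move=> M' MM' [x y] _ /=.
  rewrite /T affineB normrZ -ler_pdivlMl; last by rewrite normr_gt0.
  have -> : `|2 * r|^-1 * (M' * `|x - y|) = (`|2 * r|^-1 * M') * `|x - y| by rewrite mulrA.
  apply: (gM _ _ (x, y)) => //.
  by rewrite ltr_pdivlMl ?normr_gt0.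
have -> : carrier glue `\` \bigcup_k range (h k) =
  (carrier d `\` B `\` \bigcup_k range (h k)) `|` (T @` carrier s `\` \bigcup_k range (h k)).
  by rewrite setDUl.
apply/eqP; rewrite eq_le measure_ge0 andbT.
apply: le_trans (outer_measureU2 (H1_outer R n) _ _) _.
rewrite -(adde0 0%E); apply: leeD.
  rewrite -Hf; apply: le_hausdorff1 => x [[dx _] hx]; split => // -[k _ [u _ fu]].
  by apply: hx; exists k.*2 => //; rewrite /h odd_double doubleK; exists u.
rewrite -(mule0 (2 * r)%:E) -Hg -[leRHS](H1_affine_image c l0).
apply: le_hausdorff1 => _ [[y sy <-] hy]; exists y => //; split => // -[k _ [u _ gu]].
apply: hy; exists k.*2.+1 => //; rewrite /h /= odd_double/= uphalf_double.
by exists u => //=; rewrite gu.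
Qed.

Variables (b' : 'rV[int]_m) (t' : 'rV[R]_n) (rho : R).
Hypothesis t1' : sphere n t'.
Hypothesis rrho : r < rho.
Hypothesis dstraight : straight_in d b' t' c rho.
Hypothesis rhoB : eball c rho `<=` Bhalf n.

Let Brho x : B x -> eball c rho x.
Proof. by move=> Bx; exact: lt_trans Bx rrho. Qed.

Let BB : B `<=` Bhalf n.
Proof. by move=> x /Brho; exact: rhoB. Qed.

Lemma glue_carrier_Bhalf : carrier d `<=` Bhalf n -> carrier glue `<=` Bhalf n.
Proof. by move=> dB x [[/dB]//|/TsB/BB]. Qed.

(** Inside the open ball the carrier is locally that of the rescaled s, and off the closed ball that
    of d. On the sphere between them d consists of the two end points of a diameter, which are
    negligible. *)
Lemma glue_tangent :
  {ae H1, forall x : H1space R n, carrier d x -> approx_tangent (carrier d) x (tang d x)} ->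
  {ae H1, forall x : H1space R n, carrier s x -> approx_tangent (carrier s) x (tang s x)} ->
  {ae H1, forall x : H1space R n, carrier glue x -> approx_tangent (carrier glue) x (tang glue x)}.
Proof.
move=> dt st.
have set1N (p : 'rV[R]_n) : H1.-negligible ([set p] : set (H1space R n)).
  exists ([set p] : set (H1space R n)); split => //; last exact: hausdorff1_set1.
  apply: closed_H1measurable; apply: compact_closed; first exact: norm_hausdorff.
  exact: compact_set1.
have := negligibleU (negligibleU dt (negligible_affine c l0 st))
  (negligibleU (set1N (pline c t' r)) (set1N (pline c t' (- r)))).
apply: negligibleS => x /not_implyP[gx nt]; apply: contrapT => /not_orP[/not_orP[Nd Ns] Np].
apply: nt; have [Bx|Bx] := pselect (B x).
  have [_ ->] := glue_in Bx.
  have sV : carrier s (V x) by exact/glue_carrier_in.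
  have TV : T (V x) = x by rewrite /T /V affineVK.
  have at_s : approx_tangent (carrier s) (V x) (tang s (V x)).
    by apply: contrapT => nt; apply: Ns; exists (V x) => //; move=> /(_ sV).
  have := approx_tangent_affine c l0 at_s; rewrite -/T TV.
  have [e e0 eB] := open_eballP (@open_eball _ _ c r) Bx.
  apply: (approx_tangent_local e0); apply/seteqP; split=> y [gy ye]; split=> //.
    by right.
  by case: gy => // -[_ /(_ (eB _ ye))].
have [gc _ gt] := glue_out Bx.
have dx : carrier d x by exact/gc.
have at_d : approx_tangent (carrier d) x (tang d x).
  by apply: contrapT => nt; apply: Nd; move=> /(_ dx).
rewrite gt; have xr : r <= enorm (x - c) by rewrite leNgt; exact/negP.
have [xr'|xr'] := eqVneq (enorm (x - c)) r.
  have xrho : eball c rho x by rewrite /eball/= xr'.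
  have [[/(_ dx)[u _ ux] _] _] := dstraight xrho.
  case: Np; have : `|u - 0| = r by rewrite -(enorm_pline c t1') ux /pline scale0r addr0.
  rewrite subr0 => ur; have [u0|u0] := leP 0 u.
    by left; rewrite -ux -ur ger0_norm.
  by right; rewrite -ux -ur ltr0_norm// opprK.
have xr2 : r < enorm (x - c) by rewrite lt_neqAle eq_sym xr'.
have e0 : 0 < enorm (x - c) - r by rewrite subr_gt0.
apply: approx_tangent_local e0 _ at_d.
have eB y : eball x (enorm (x - c) - r) y -> ~ B y.
  rewrite /B /eball/= => yx yc; have := enorm_triangle y x c; rewrite (enormB x y).
  by move: yx yc; lra.
apply/seteqP; split=> y [gy ye]; split=> //; have [h _ _] := glue_out (eB y ye); exact/h.
Qed.

(** Inside [B] the current d is itself a rescaled copy, namely of [straight b' t'], so d and the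
    glued current can be compared after the same change of variables. *)
Let straight_carrierV x : B x -> (carrier d x <-> carrier (straight b' t') (V x)).
Proof.
move=> Bx; have [dl _] := dstraight (Brho Bx).
rewrite straight_carrier//; split=> [/dl[u _ ux]|[[u _ uV] _]].
  split; last first.
    move: Bx; rewrite -TB => -[y By yx]; by rewrite -yx /V /T affineK.
  exists ((2 * r)^-1 * u) => //.
  by rewrite /V /affineV -ux /pline addrC addKr scalerA.
apply/dl; exists (2 * r * u) => //.
by rewrite -[RHS](affineVK c l1 x) -/V -uV /pline /affine scalerA.
Qed.

Let straight_density i j x : B x -> density d i j x = density (straight b' t') i j (V x).
Proof.
move=> Bx; have [_ dm] := dstraight (Brho Bx); have E := straight_carrierV Bx.
have [dx|dx] := pselect (carrier d x).
  have sx := E.1 dx; rewrite !density_in//.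
  by have [-> ->] := dm dx; have [-> ->] := straight_mult t1' sx.
by rewrite !density_out// => /E.
Qed.

(** The factor 2r by which H^1 scales is the one that appears in the gradient of phi composed with
    [T]. *)
Let pairing_affine (s' : current R m n) phi i : current_regular s' -> smooth phi ->
  \sum_(j < n) \int[H1]_(x in (B : set (H1space R n)))
     (partial j phi x * density s' i j (V x)) = pairing s' (Bhalf n) (phi \o T) i.
Proof.
move=> sreg' sphi; apply: eq_bigr => j _.
have cT : continuous (partial j phi \o T : 'rV[R]_n -> R^o).
  exact/smooth_continuous/smooth_affine/smooth_partial.
have gi := integrable_continuous_density i j cT sreg' Bhalf_H1measurable (@subset_refl _ _).
transitivity (\int[H1]_(x in (T @` Bhalf n : set (H1space R n)))
    ((partial j phi \o T) (V x) * density s' i j (V x))).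
  by rewrite TB; apply: eq_Rintegral => x _; rewrite /= /T /V affineVK.
rewrite (Rintegral_affineV c l0 (g := fun y => (partial j phi \o T) y * density s' i j y)
  Bhalf_H1measurable gi).
rewrite -RintegralZl//; last exact: Bhalf_H1measurable.
apply: eq_Rintegral => y _; rewrite partial_affine => [|x]; last exact: smooth_diff.
by rewrite mulrA.
Qed.

(** Outside [B] nothing changes, and inside both currents are rescaled copies with equal pairings.
    The function phi composed with [T] need not vanish near the boundary of the ball of radius 1/2,
    so this equality rests on [admissible_pairing], not on vanishing divergence alone. *)
Lemma glue_pairing phi i : smooth phi ->
  pairing s (Bhalf n) (phi \o T) i = pairing (straight b' t') (Bhalf n) (phi \o T) i ->
  pairing glue (Bhalf n) phi i = pairing d (Bhalf n) phi i.
Proof.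
move=> sphi ss; have greg := glue_regular.
have mBh := @Bhalf_H1measurable R n.
have mBB : measurable (Bhalf n `\` B : set (H1space R n)) by exact: measurableD.
have BE : Bhalf n = (Bhalf n `\` B) `|` B by rewrite setDUK_ || rewrite setUC setDUK.
have split_B (d' : current R m n) j : current_regular d' ->
  \int[H1]_(x in (Bhalf n : set (H1space R n))) (partial j phi x * density d' i j x) =
  \int[H1]_(x in (Bhalf n `\` B : set (H1space R n))) (partial j phi x * density d' i j x) +
  \int[H1]_(x in (B : set (H1space R n))) (partial j phi x * density d' i j x).
  move=> reg'; rewrite {1}BE Rintegral_setU//.
    rewrite -BE; apply: (integrable_continuous_density i j (smooth_partial_continuous sphi) reg' mBh).
    exact: subset_refl.
  by apply/disj_setPS => x [[_ xB] /xB].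
rewrite /pairing (eq_bigr _ (fun j _ => split_B glue j greg)).
rewrite [RHS](eq_bigr _ (fun j _ => split_B d j dreg)) !big_split; congr (_ + _).
  apply: eq_bigr => j _; apply: eq_Rintegral => x /set_mem[_ xB].
  by rewrite glue_density memNset.
transitivity (pairing s (Bhalf n) (phi \o T) i).
  rewrite -(pairing_affine i sreg sphi); apply: eq_bigr => j _; apply: eq_Rintegral => x xB.
  by rewrite glue_density xB.
rewrite ss -(pairing_affine i (straight_regular b' t1') sphi).
by apply: eq_bigr => j _; apply: eq_Rintegral => x /set_mem xB; rewrite straight_density.
Qed.

Lemma glue_vmeasure (A : set 'rV[R]_n) : A `&` B = set0 ->
  vmeasure_of glue A = vmeasure_of d A.
Proof.
move=> AB; apply/matrixP => i j; rewrite !vmeasure_density; apply: eq_Rintegral => x /set_mem Ax.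
rewrite glue_density memNset// => Bx.
by move: AB; rewrite -subset0 => /(_ x); apply.
Qed.

Variable psi : 'rV[int]_m -> 'rV[R]_n -> R.
Hypothesis mpsi : forall b, measurable_fun (sphere n : set (borel R n)) (psi b).
Hypothesis psi_ge0 : forall b t, sphere n t -> 0 <= psi b t.
Local Notation E := (energy (fun b t => (psi b t)%:E)).

(** The diameter of [B], of length 2r, is traded for s scaled by 2r. The balance is written with
    sums only, since energies may be infinite. *)
Lemma glue_energy : carrier d `<=` Bhalf n ->
  (E glue (Bhalf n) + (2 * r * psi b' t')%:E = E d (Bhalf n) + (2 * r)%:E * E s (Bhalf n))%E.
Proof.
move=> dB; have gB := glue_carrier_Bhalf dB; have greg := glue_regular.
have [mc _ dst _ _] := dreg; have [mcs _ sst _ _] := sreg; have [mcg _ gst _ _] := greg.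
rewrite /energy !setIidl//.
have mcB : measurable (carrier d `&` B : set (H1space R n)) by exact: measurableI.
have md := measurable_energy mpsi dreg; have mg := measurable_energy mpsi greg.
have ms := measurable_energy mpsi sreg.
have Eg : (\int[H1]_(x in (carrier glue : set (H1space R n))) (psi (mult glue x) (tang glue x))%:E =
  \int[H1]_(x in (carrier d `\` B : set (H1space R n))) (psi (mult d x) (tang d x))%:E +
  (2 * r)%:E * \int[H1]_(x in (carrier s : set (H1space R n))) (psi (mult s x) (tang s x))%:E)%E.
  rewrite (ge0_integral_setU H1 mdB mTs mg _ disjB); last first.
    by move=> x gx; rewrite lee_fin psi_ge0//; exact: gst.
  congr (_ + _)%E.
    by apply: eq_integral => x /set_mem[_ xB]; have [_ -> ->] := glue_out xB.
  rewrite -(integral_affineV c l0 (g := fun x => (psi (mult s x) (tang s x))%:E) mcs ms).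
  by apply: eq_integral => x /set_mem/TsB xB; have [-> ->] := glue_in xB.
have dE : carrier d = (carrier d `\` B) `|` (carrier d `&` B) by rewrite setUC setUIDK.
have disj : [disjoint (carrier d `\` B : set (H1space R n)) & carrier d `&` B].
  by apply/disj_setPS => x [[_ xB] [_ /xB]].
have Ed : (\int[H1]_(x in (carrier d : set (H1space R n))) (psi (mult d x) (tang d x))%:E =
  \int[H1]_(x in (carrier d `\` B : set (H1space R n))) (psi (mult d x) (tang d x))%:E +
  (2 * r * psi b' t')%:E)%E.
  rewrite {1}dE (ge0_integral_setU H1 mdB mcB _ _ disj); first last.
  - by rewrite -dE => x dx; rewrite lee_fin psi_ge0//; exact: dst.
  - by rewrite -dE.
  congr (_ + _)%E; rewrite (eq_integral (cst (psi b' t')%:E)); last first.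
    move=> x /set_mem[dx Bx]; have [_ dm] := dstraight (Brho Bx).
    by have [-> ->] := dm dx.
  rewrite (integral_cst H1 mcB) (_ : carrier d `&` B = T @` carrier (straight b' t')).
    rewrite [X in (_ * X)%E](H1_affine_image c l0) straight_carrier// line_oseg//.
    by rewrite [X in (_ * (_ * X))%E]H1_oseg// mule1 -EFinM mulrC.
  apply/seteqP; split=> [x [dx Bx]|_ [y sy <-]].
    by exists (V x); [exact/straight_carrierV|rewrite /T /V affineVK].
  have By : B (T y) by rewrite -TB; exists y => //; move: sy; rewrite straight_carrier// => -[].
  by split => //; apply/(straight_carrierV By); rewrite /T /V affineK.
by rewrite Eg Ed addeAC.
Qed.

End Glue.

Lemma admissible_glue (R : realType) (m n : nat) (psi : 'rV[int]_m -> 'rV[R]_n -> R)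
    (b b' : 'rV[int]_m) (t t' c : 'rV[R]_n) (r rho : R) (d s : current R m n) :
  (0 < n)%N ->
  (forall b, measurable_fun (sphere n : set (borel R n)) (psi b)) ->
  (forall b t, sphere n t -> 0 <= psi b t) ->
  sphere n t -> sphere n t' -> 0 < r < rho -> eball c rho `<=` Bhalf n ->
  admissible b t d -> straight_in d b' t' c rho -> admissible b' t' s ->
  exists d' : current R m n, [/\ admissible b t d',
    forall x, ~ eball c r x ->
      [/\ carrier d' x <-> carrier d x, mult d' x = mult d x & tang d' x = tang d x]
    & (energy (fun b t => (psi b t)%:E) d' (Bhalf n) + (2 * r * psi b' t')%:E =
      energy (fun b t => (psi b t)%:E) d (Bhalf n) +
      (2 * r)%:E * energy (fun b t => (psi b t)%:E) s (Bhalf n))%E].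
Proof.
move=> n0 mpsi psi0 t1 t1' /andP[r0 rrho] rhoB ad dst as'.
have dreg := admissible_regular ad; have sreg := admissible_regular as'.
have [[[rd dB] [_ _ td] _ dfd] [q /andP[q0 q1] dq]] := ad.
have [[[rs sB] [_ _ ts] _ dfs] _] := as'.
exists (glue d s c r); split; last 2 first.
- by move=> x; exact: glue_out.
- exact: (glue_energy r0 dreg sreg sB t1' rrho dst rhoB mpsi psi0 dB).
have greg := glue_regular c r0 dreg sreg sB.
have [mg fg gst gmt git] := greg.
split.
  split.
  - by split; [exact: glue_rectifiable|exact: (glue_carrier_Bhalf r0 sB rrho rhoB dB)].
  - split; [exact: gst|exact: gmt|].
    exact: (glue_tangent r0 sB t1' rrho dst td ts).
  - exact: git.
  - apply/divergence_free_pairing => phi i tphi; have [sphi _] := tphi.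
    rewrite (glue_pairing r0 dreg sreg sB t1' rrho dst rhoB sphi).
      exact: (divergence_free_pairing _ _).1.
    by apply: (admissible_pairing i t1' as'); exact: smooth_affine.
have cr : enorm c + r < 2^-1.
  apply: closed_eball_Bhalf => // y yr; apply: rhoB.
  by move: yr; rewrite /closed_eball/eball/= => /le_lt_trans; apply.
(* The new exceptional ball contains both the one of d and the ball in which s was inserted. *)
exists (Num.max q (enorm c + r)).
  by rewrite le_max q0/= gt_max q1.
move=> A mA AB; rewrite glue_vmeasure//.
  apply: dq => // x /AB[Bx xm]; split => // xq; apply: xm.
  by rewrite /eball/= lt_max [X in X || _]xq.
rewrite -subset0 => x [/AB[Bx xm] xr]; apply: xm.
rewrite /eball/= lt_max; apply/orP; right; rewrite subr0.
by have := enormD (x - c) c; rewrite subrK; move: xr; rewrite /eball/=; lra.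
Qed.

(** * Vitali covering of an interval *)

(** The good intervals form a Vitali cover of ]0, l[ minus the finite bad set. Goodness holds for
    all centres near s and all small radii, so rational data suffice and the family is indexed by
    natural numbers. *)
Lemma vitali_intervals (R : realType) (l : R) (good : R -> R -> Prop) (bad : set R) :
  0 < l -> finite_set bad ->
  (forall s, 0 < s < l -> ~ bad s -> exists2 rho0, 0 < rho0 &
     forall s' rho, `|s' - s| < rho0 -> 0 < rho < rho0 -> good s' rho) ->
  forall e, 0 < e -> exists (q_ r_ : nat -> R) (G : seq nat),
    [/\ uniq G,
        forall k, k \in G -> [/\ 0 < r_ k, 0 < q_ k - r_ k, q_ k + r_ k < l & good (q_ k) (r_ k)],
        forall k k', k \in G -> k' \in G -> k != k' -> r_ k + r_ k' <= `|q_ k - q_ k'|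
      & l - e <= \sum_(k <- G) 2 * r_ k].
Proof.
move=> l0 fbad gP e e0.
(* Codes that do not yield a positive radius are sent to centre 0 and radius 1; the set [F] selects
   the usable intervals. *)
pose qr (k : nat) : rat * rat :=
  if @unpickle (rat * rat)%type k is Some x then if 0 < x.2 then x else (0, 1) else (0, 1).
pose q_ k : R := ratr (qr k).1; pose r_ k : R := ratr (qr k).2.
pose B k : set R := ball (q_ k) (r_ k).
have qr0 k : 0 < r_ k.
  by rewrite /r_ /qr ltr0q; case: (unpickle k) => [x|//]; case: ifP.
pose F : set nat := [set k | [/\ 0 < r_ k, 0 < q_ k - r_ k, q_ k + r_ k < l & good (q_ k) (r_ k)]].
pose A : set R := `]0, l[%classic `\` bad.
have cover : vitali_cover A B F.
  split=> [k|x [/= + bx] d d0]; first exact: is_ball_ball.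
  rewrite in_itv/= => xl.
  have [rho0 rho00 H] := gP _ xl bx.
  move: xl => /andP[x0 xl].
  (* A radius between d' and 2 d' and a centre within d' of x give an interval that contains x,
     stays inside ]0, l[ and is small enough for goodness and for the cover. *)
  pose d' := Num.min (Num.min rho0 d) (Num.min x (l - x)) / 4.
  have m0 : 0 < Num.min (Num.min rho0 d) (Num.min x (l - x)) by rewrite !lt_min rho00 d0 x0 subr_gt0.
  have d'0 : 0 < d' by rewrite divr_gt0.
  have [d1 d2 d3 d4] : [/\ 4 * d' <= rho0, 4 * d' <= d, 4 * d' <= x & 4 * d' <= l - x].
    have -> : 4 * d' = Num.min (Num.min rho0 d) (Num.min x (l - x)).
      by rewrite /d' mulrC divfK.
    by split; rewrite !ge_min lexx ?orbT.
  have /rat_in_itvoo[r /itvP rP] : d' < 2 * d' by lra.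
  have /rat_in_itvoo[q /itvP qP] : x - d' < x + d' by lra.
  have rI : ratr r \in `]d', (2 * d')[ by rewrite in_itv/= !rP.
  have qI : ratr q \in `](x - d'), (x + d')[ by rewrite in_itv/= !qP.
  move: rI qI; rewrite !in_itv/= => /andP[ra rb] /andP[qa qb].
  have r0 : 0 < r by rewrite -(ltr0q R); lra.
  exists (pickle (q, r)); rewrite /F /B /= /q_ /r_ /qr pickleK /= r0.
  split.
  - split; [lra|lra|lra|]; apply: H; last by apply/andP; split; lra.
    by rewrite ltr_norml; apply/andP; split; lra.
  - by rewrite /ball/= ltr_norml; apply/andP; split; lra.
  - by rewrite radius_ball_num; lra.
have Al : (lebesgue_measure A < +oo)%E.
  apply: (@le_lt_trans _ _ (lebesgue_measure (`]0, l[%classic : set R))).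
    by apply: (le_outer_measure ((wlength idfun)^*)%mu) => x [].
  by rewrite lebesgue_measure_itv/= lte_fin l0 sube0 ltry.
have [G [GF trG mG]] := vitali_theorem_corollary
  (fun k => eq_ind_r (fun x => 0 < x) (qr0 k) (radius_ball_num (q_ k) (ltW (qr0 k)))) Al cover e0.
pose g : seq nat := finmap.enum_fset G.
exists q_, r_, g; split.
- exact: finmap.fset_uniq.
- by move=> k kG; exact: GF.
- move=> k k' kG k'G kk'; rewrite leNgt; apply/negP => lt.
  have [rk _ _ _] := GF _ kG; have [rk' _ _ _] := GF _ k'G.
  have rr : 0 < r_ k + r_ k' by rewrite addr_gt0.
  have /trivIsetP/(_ k k' kG k'G kk') := trG.
  (* The point that divides the segment between the centres in the ratio of the radii would lie in
     both balls. *)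
  rewrite -subset0 => /(_ ((q_ k * r_ k' + q_ k' * r_ k) / (r_ k + r_ k'))); apply.
  split; apply: subset_closure; rewrite /B/ball/=.
  + rewrite (_ : _ - _ = (q_ k - q_ k') * (r_ k / (r_ k + r_ k'))); last by field; rewrite gt_eqF.
    rewrite normrM [X in _ * X]gtr0_norm ?(divr_gt0 rk rr)// mulrA ltr_pdivrMr// mulrC ltr_pM2l//.
  + rewrite (_ : _ - _ = - (q_ k - q_ k') * (r_ k' / (r_ k + r_ k'))); last by field; rewrite gt_eqF.
    rewrite normrM normrN [X in _ * X]gtr0_norm ?(divr_gt0 rk' rr)// mulrA ltr_pdivrMr// mulrC ltr_pM2l//.
- set S := \big[setU/set0]_(k <- g) closure (B k) in mG.
  have : (lebesgue_measure (`]0%R, l[%classic : set R) <= e%:E + (\sum_(k <- g) 2 * r_ k)%:E)%E.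
    apply: (@le_trans _ _ (lebesgue_measure ((A `\` S) `|` (S `|` bad)))).
      apply: (le_outer_measure ((wlength idfun)^*)%mu) => x xl.
      have [bx|bx] := pselect (bad x); first by right; right.
      by have [Sx|Sx] := pselect (S x); [right; left|left; split].
    apply: le_trans (outer_measureU2 ((wlength idfun)^*)%mu _ _) _.
    apply: leeD; first exact: ltW.
    apply: le_trans (outer_measureU2 ((wlength idfun)^*)%mu _ _) _.
    rewrite [X in (_ + X <= _)%E](_ : _ = 0%E); last first.
      by apply: countable_lebesgue_measure0; exact: finite_set_countable.
    rewrite adde0 -sumEFin /S big_seq [X in (_ <= X)%E]big_seq.
    apply: (big_ind2 (fun X (y : \bar R) => (((wlength idfun)^*)%mu X <= y)%E)).
    + by rewrite outer_measure0.
    + move=> X1 y1 X2 y2 H1 H2; apply: le_trans (outer_measureU2 ((wlength idfun)^*)%mu _ _) _.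
      exact: leeD.
    + move=> k kG; have [rk _ _ _] := GF _ kG.
      rewrite /B closure_ballE.
      rewrite [X in (X <= _)%E](_ : _ = (r_ k *+ 2)%:E); last exact: (lebesgue_measure_closed_ball (q_ k) (ltW rk)).
      by rewrite lee_fin mulr2n mulrDl mul1r.
  by rewrite lebesgue_measure_itv/= lte_fin l0 sube0 -EFinD lee_fin; lra.
Qed.

(** * Item 1: the envelope of polyhedral competitors *)

Section EnvelopePolyhedral.
Context {R : realType} {m n : nat}.
Variable psi : 'rV[int]_m -> 'rV[R]_n -> R.
Hypothesis n0 : (0 < n)%N.
Hypothesis mpsi : forall b, measurable_fun (sphere n : set (borel R n)) (psi b).
Hypothesis psi0 : forall b t, sphere n t -> 0 <= psi b t.

Local Notation E d := (energy (fun b t => (psi b t)%:E) d (Bhalf n)).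

Lemma energy_ge0 b t (d : current R m n) : admissible b t d -> (0 <= E d)%E.
Proof.
move=> /admissible_regular[_ _ st _ _]; apply: integral_ge0 => x [cx _].
by rewrite lee_fin psi0//; exact: st.
Qed.

Lemma envelope_le_energy b t (d : current R m n) : sphere n t -> admissible b t d ->
  (envelope psi b t <= E d)%E.
Proof. by move=> t1 ad; rewrite envelopeE//; apply: ereal_inf_lbound; exists d. Qed.

Lemma envelope_ge0 b t : (0 <= envelope psi b t)%E.
Proof.
apply: le_ereal_inf_tmp => _ [d [Md _] <-].
have [_ _ st _ _] := Mdf_regular Md; apply: integral_ge0 => x [cx _].
by rewrite lee_fin psi0//; exact: st.
Qed.

Lemma envelope_le_psi b t : sphere n t -> (envelope psi b t <= (psi b t)%:E)%E.
Proof.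
move=> t1; apply: le_trans (envelope_le_energy t1 (admissible_straight b t1)) _.
by rewrite (straight_energy t1 (psi0 b t1)).
Qed.

Lemma envelope_fin b t : sphere n t -> envelope psi b t \is a fin_num.
Proof.
by move=> t1; rewrite ge0_fin_numE ?envelope_ge0// (le_lt_trans (envelope_le_psi b t1)) ?ltry.
Qed.

Let v b t := fine (envelope psi b t).

Lemma envelope_fineE b t : sphere n t -> (v b t)%:E = envelope psi b t.
Proof. by move=> t1; rewrite /v fineK// envelope_fin. Qed.

(** Gluing takes place at a radius r strictly below rho. The error e absorbs both the loss from
    shrinking the ball and the deviation of the inserted competitor from optimality. *)
Lemma replace_in_ball b t b' t' c rho (d : current R m n) D e :
  sphere n t -> sphere n t' -> 0 < rho -> eball c rho `<=` Bhalf n ->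
  admissible b t d -> straight_in d b' t' c rho -> E d = D%:E -> 0 < e ->
  exists (d' : current R m n) D', [/\ admissible b t d',
    forall x, ~ eball c rho x ->
      [/\ carrier d' x <-> carrier d x, mult d' x = mult d x & tang d' x = tang d x],
    E d' = D'%:E & D' <= D - 2 * rho * (psi b' t' - v b' t') + e].
Proof.
move=> t1 t1' rho0 cB ad sd ED e0.
have vpsi : v b' t' <= psi b' t' by rewrite -lee_fin envelope_fineE// envelope_le_psi.
set g := psi b' t' - v b' t'; have g0 : 0 <= g by rewrite subr_ge0.
(* Chosen so that [2 * del <= 1] and [4 * rho * g * del <= e]: shrinking the radius by the factor 1
   - del costs at most e/2. *)
pose del := e / (2 * e + 4 * rho * g).
have q0 : 0 < 2 * e + 4 * rho * g by rewrite ltr_wpDr ?mulr_ge0 ?mulr_gt0// ltW.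
have del0 : 0 < del by rewrite divr_gt0.
have del1 : 2 * del <= 1.
  by rewrite /del mulrA ler_pdivrMr// mul1r lerDl !mulr_ge0// ltW.
have delg : 4 * rho * g * del <= e.
  by rewrite /del mulrA ler_pdivrMr// mulrC ler_pM2l// lerDr mulr_ge0// ltW.
pose r := (1 - del) * rho.
have [r0 rrho] : 0 < r /\ r < rho.
  by split; [rewrite mulr_gt0//; lra|rewrite /r gtr_pMl//; lra].
have h0 : 0 < e / (4 * rho) by rewrite divr_gt0// mulr_gt0.
have [_ [s as' <-] Es] : exists2 x, [set E d | d in [set d | admissible b' t' d]] x &
    (x < envelope psi b' t' + (e / (4 * rho))%:E)%E.
  by rewrite envelopeE//; apply: lb_ereal_inf_adherent => //; rewrite -envelopeE// envelope_fin.
have fs : E s \is a fin_num.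
  rewrite ge0_fin_numE ?(energy_ge0 as')//; apply: lt_trans Es _.
  by rewrite -envelope_fineE// -EFinD ltry.
have rr : 0 < r < rho by rewrite r0.
have [d' [ad' out]] := admissible_glue n0 mpsi psi0 t1 t1' rr cB ad sd as'.
move: Es; rewrite ED -envelope_fineE// -(fineK fs) -EFinD -EFinM -EFinD lte_fin => Es Ed.
have fd' : E d' \is a fin_num.
  rewrite ge0_fin_numE ?(energy_ge0 ad')//; apply: (@le_lt_trans _ _ (E d' + (2 * r * psi b' t')%:E)%E).
    by rewrite leeDl// lee_fin mulr_ge0 ?psi0// mulr_ge0// ltW.
  by rewrite Ed ltry.
exists d', (fine (E d')); split=> //.
- move=> x cx; apply: out => cx'; apply: cx; rewrite /eball/=.
  exact: lt_trans cx' rrho.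
- by rewrite fineK.
- move: Ed; rewrite -(fineK fd') -EFinD => -[] /=.
  set X := fine (E d'); set Y := fine (E s) in Es *; rewrite -/(v b' t') in Es => Ed.
  have Yl : 2 * r * Y <= 2 * r * v b' t' + e / 2.
    have : 2 * r * Y <= 2 * r * (v b' t' + e / (4 * rho)).
      by apply: ler_wpM2l; [rewrite mulr_ge0// ltW|exact: ltW].
    rewrite mulrDr => /le_trans; apply; rewrite lerD2l.
    rewrite (_ : e / 2 = 2 * rho * (e / (4 * rho))); last by field; rewrite gt_eqF.
    by apply: ler_wpM2r; [exact: ltW|apply: ler_wpM2l => //; exact: ltW].
  have : X <= D - 2 * r * g + e / 2 by rewrite /g; lra.
  move/le_trans; apply; rewrite (_ : 2 * r * g = 2 * rho * g - 4 * rho * g * del / 2); last first.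
    by rewrite /r; lra.
  lra.
Qed.

(** Each replacement leaves the current unchanged outside its own ball, so it is still straight in
    the remaining disjoint balls, and induction applies. *)
Lemma replace_in_balls (I : eqType) (s : seq I) b t (d : current R m n) D
    (b_ : I -> 'rV[int]_m) (t_ c_ : I -> 'rV[R]_n) (rho_ : I -> R) :
  sphere n t -> uniq s -> admissible b t d -> E d = D%:E ->
  (forall i, i \in s -> [/\ sphere n (t_ i), 0 < rho_ i, eball (c_ i) (rho_ i) `<=` Bhalf n &
     straight_in d (b_ i) (t_ i) (c_ i) (rho_ i)]) ->
  (forall i j, i \in s -> j \in s -> i != j ->
     eball (c_ i) (rho_ i) `&` eball (c_ j) (rho_ j) = set0) ->
  v b t <= D - \sum_(i <- s) 2 * rho_ i * (psi (b_ i) (t_ i) - v (b_ i) (t_ i)).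
Proof.
move=> t1 us ad ED sP dj.
suff H e : 0 < e -> v b t <= D - \sum_(i <- s) (2 * rho_ i * (psi (b_ i) (t_ i) - v (b_ i) (t_ i)) - e).
  apply/ler_addgt0Pr => e e0.
  have s0 : 0 < e / (size s).+1%:R by rewrite divr_gt0// ltr0n.
  apply: le_trans (H _ s0) _; rewrite big_split/= sumrN big_const_seq count_predT iter_addr_0.
  rewrite opprD opprK addrA lerD2l -[_ *+ size s]mulr_natr -mulrA ler_piMr//; first exact: ltW.
  by rewrite mulrC ler_pdivrMr ?ltr0n// mul1r ler_nat.
move=> e0; elim: s d D us ad ED sP dj => [|i s IH] d D us ad ED sP dj.
  by rewrite big_nil subr0 -lee_fin envelope_fineE// -ED envelope_le_energy.
move: us => /= /andP[is_ us].
have [ti1 rho0 cB sd] := sP i (mem_head _ _).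
have [d' [D' [ad' out Ed' DD']]] := replace_in_ball t1 ti1 rho0 cB ad sd ED e0.
rewrite big_cons; apply: le_trans (IH d' D' us ad' Ed' _ _) _; last 1 first.
- by rewrite opprD addrA lerD2r; move: DD'; lra.
- move=> j js; have jis : j \in i :: s by rewrite inE js orbT.
  have [tj1 rhoj cjB sdj] := sP j jis; split=> // x xj.
  have ji : j != i by apply: contraNneq is_ => <-.
  have [-> -> ->] : [/\ carrier d' x <-> carrier d x, mult d' x = mult d x & tang d' x = tang d x].
    apply: out => xi; have : (eball (c_ j) (rho_ j) `&` eball (c_ i) (rho_ i)) x by [].
    by rewrite dj// mem_head.
  exact: sdj.
- by move=> j k js ks; apply: dj; rewrite inE ?js ?ks orbT.
Qed.

Section Polyhedral.
Variables (N : nat) (b_ : 'I_N -> 'rV[int]_m) (p_ t_ : 'I_N -> 'rV[R]_n) (l_ : 'I_N -> R).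
Let gamma_ i := oseg (p_ i) (t_ i) (l_ i).
Hypothesis gammaP : forall i, [/\ sphere n (t_ i), 0 < l_ i & gamma_ i `<=` Bhalf n].
Hypothesis gamma_disj : forall i j, i != j -> gamma_ i `&` gamma_ j = set0.

Local Notation P := (polyhedral b_ p_ t_ l_).

(* straightness is required at the double radius, so that good balls centred on different segments are disjoint *)
Let good k s rho := [/\ 0 < s - 2 * rho, s + 2 * rho < l_ k,
  eball (pline (p_ k) (t_ k) s) (2 * rho) `<=` Bhalf n &
  straight_in P (b_ k) (t_ k) (pline (p_ k) (t_ k) s) (2 * rho)].

Let good_covers k e : 0 < e -> exists q_ r_ (G : seq nat),
  [/\ uniq G,
      forall i, i \in G -> [/\ 0 < r_ i, 0 < q_ i - r_ i, q_ i + r_ i < l_ k & good k (q_ i) (r_ i)],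
      forall i j, i \in G -> j \in G -> i != j -> r_ i + r_ j <= `|q_ i - q_ j|
    & l_ k - e <= \sum_(i <- G) 2 * r_ i].
Proof.
move=> e0; have [tk1 lk0 gB] := gammaP k.
apply: (@vitali_intervals R (l_ k) (good k) [set s | vertices p_ t_ l_ (pline (p_ k) (t_ k) s)]) => //.
  apply: (@finite_preimage _ _ (vertices p_ t_ l_) (pline (p_ k) (t_ k))).
    by move=> x y _ _; exact: (can_inj (plineK _ tk1)).
  by rewrite finite_setU; split; apply: finite_image; exact: finite_finset.
move=> s sl vs.
have gs : gamma_ k (pline (p_ k) (t_ k) s) by exists s.
have [rho [rho0 rB st]] := polyhedral_straight_in b_ gammaP gamma_disj gs vs.
move: sl => /andP[s0 sl].
(* The third leaves room: a ball of radius 2 rho' < 2 r whose centre moved by less than r stays in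
   the ball of radius 3 r <= rho. *)
pose r := Num.min rho (Num.min s (l_ k - s)) / 3.
have r0 : 0 < r by rewrite divr_gt0// !lt_min rho0 s0 subr_gt0.
have [r1 r2 r3] : [/\ 3 * r <= rho, 3 * r <= s & 3 * r <= l_ k - s].
  have -> : 3 * r = Num.min rho (Num.min s (l_ k - s)) by rewrite /r mulrC divfK.
  by split; rewrite !ge_min lexx ?orbT.
exists r => // s' rho' ss' /andP[rho'0 rho'r].
have sub : eball (pline (p_ k) (t_ k) s') (2 * rho') `<=` eball (pline (p_ k) (t_ k) s) rho.
  move=> x; rewrite /eball/= => xs'.
  apply: le_lt_trans (enorm_triangle (pline (p_ k) (t_ k) s') x _) _.
  by rewrite enorm_pline//; lra.
move: (ss'); rewrite ltr_norml => /andP[sa sb].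
split; [lra|lra|exact: subset_trans rB|].
move=> x /sub /st [h1 h2]; split=> //; rewrite h1.
split=> -[u _ <-].
  exists (u + s - s') => //; rewrite /pline -!addrA; congr (_ + _).
  by rewrite -!scalerDl; congr (_ *: _); lra.
exists (u + s' - s) => //; rewrite /pline -!addrA; congr (_ + _).
by rewrite -!scalerDl; congr (_ *: _); lra.
Qed.

(** The energy of the polyhedral current is the sum of l_k psi(b_k, t_k). Replacement in the balls
    lowers psi to the envelope on all but length e' of each segment, and the leftover costs at most
    e' times the gap [g k]. *)
Lemma envelope_polyhedral b t : sphere n t -> admissible b t P ->
  v b t <= \sum_(k < N) l_ k * v (b_ k) (t_ k).
Proof.
move=> t1 aP.
have tk1 k : sphere n (t_ k) by case: (gammaP k).
pose g k := psi (b_ k) (t_ k) - v (b_ k) (t_ k).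
have g0 k : 0 <= g k.
  by rewrite subr_ge0 -lee_fin envelope_fineE// envelope_le_psi.
have EP : E P = (\sum_(k < N) l_ k * psi (b_ k) (t_ k))%:E.
  rewrite (polyhedral_energy gammaP gamma_disj (c := fun k => psi (b_ k) (t_ k)))// => [|k].
    by rewrite -sumEFin.
  exact: psi0.
apply/ler_addgt0Pr => e e0.
(* Normalized so that e' times one plus the sum of all gaps equals e; the extra 1 keeps the
   denominator positive. *)
pose e' := e / (1 + \sum_(k < N) g k).
have s0 : 0 < 1 + \sum_(k < N) g k by rewrite ltr_pwDl// sumr_ge0.
have e'0 : 0 < e' by rewrite divr_gt0.
have ch : forall k, exists x : (nat -> R) * (nat -> R) * seq nat,
  [/\ uniq x.2,
      forall i, i \in x.2 -> [/\ 0 < x.1.2 i, 0 < x.1.1 i - x.1.2 i, x.1.1 i + x.1.2 i < l_ k &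
        good k (x.1.1 i) (x.1.2 i)],
      forall i j, i \in x.2 -> j \in x.2 -> i != j -> x.1.2 i + x.1.2 j <= `|x.1.1 i - x.1.1 j|
    & l_ k - e' <= \sum_(i <- x.2) 2 * x.1.2 i].
  by move=> k; have [q [r [G H]]] := good_covers k e'0; exists (q, r, G).
have [F HF] := choice ch.
pose q k := (F k).1.1; pose r k := (F k).1.2; pose G k := (F k).2.
pose s := [seq (k, i) | k <- enum 'I_N, i <- G k].
have smem (x : 'I_N * nat) : x \in s -> x.2 \in G x.1.
  by case/allpairsPdep => k [i [_ iG ->]].
have us : uniq s.
  apply: allpairs_uniq_dep => [|k _|]; [exact: enum_uniq|by case: (HF k)|].
  by move=> [k i] [k' i'] _ _ /= [-> ->].
pose c (x : 'I_N * nat) := pline (p_ x.1) (t_ x.1) (q x.1 x.2).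
have cG x : x \in s -> [/\ 0 < r x.1 x.2, gamma_ x.1 (c x), eball (c x) (2 * r x.1 x.2) `<=` Bhalf n,
    straight_in P (b_ x.1) (t_ x.1) (c x) (2 * r x.1 x.2) &
    forall u, `|u| < 2 * r x.1 x.2 -> gamma_ x.1 (pline (c x) (t_ x.1) u)].
  move=> /smem xG; have [_ /(_ _ xG)[r0 _ _ [g1 g2 g3 g4]] _ _] := HF x.1.
  rewrite -/(q _ _) -/(r _ _) in r0 g1 g2 g3 g4.
  have gam u : `|u| < 2 * r x.1 x.2 -> gamma_ x.1 (pline (c x) (t_ x.1) u).
    rewrite ltr_norml => /andP[u1 u2]; exists (q x.1 x.2 + u).
      by rewrite /= in_itv/=; apply/andP; split; lra.
    by rewrite /c /pline scalerDl addrA.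
  split=> //; have := gam 0; rewrite {1}/pline scale0r addr0; apply.
  by rewrite normr0; lra.
(* If two balls on different segments were too close, the centre of the smaller one would lie in the
   doubled ball of the larger, where the carrier is a piece of a single segment. *)
have far x y : x \in s -> y \in s -> x.1 != y.1 -> r y.1 y.2 <= r x.1 x.2 ->
    r x.1 x.2 + r y.1 y.2 <= enorm (c x - c y).
  move=> xs ys xy ryx; rewrite leNgt; apply/negP => lt.
  have [rx0 _ _ stx gx] := cG _ xs; have [ry0 gy _ _ _] := cG _ ys.
  have inx : eball (c x) (2 * r x.1 x.2) (c y).
    by rewrite /eball/= -enormN opprB; lra.
  have [[/(_ _)] ] := stx _ inx.
  have cy : carrier P (c y) by exists y.1.
  move=> /(_ cy) [u _ uy] _ _; move: inx; rewrite /eball/= -uy.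
  have -> : pline (c x) (t_ x.1) u - c x = u *: t_ x.1 by rewrite /pline addrAC subrr add0r.
  rewrite enormZ (tk1 x.1) mulr1 => /gx; rewrite uy => gxy.
  by move: xy; rewrite (gamma_uniq gamma_disj gxy gy) eqxx.
have dist x y : x \in s -> y \in s -> x != y -> r x.1 x.2 + r y.1 y.2 <= enorm (c x - c y).
  move=> xs ys xy; have [xy1|xy1] := eqVneq x.1 y.1; last first.
    have [ryx|rxy] := leP (r y.1 y.2) (r x.1 x.2); first exact: far.
    by rewrite -enormN opprB addrC; apply: far => //; [rewrite eq_sym|exact: ltW].
  move: x y xs ys xy xy1 => [k i] [k' j] xs ys xy /= kk'; rewrite -{}kk' in ys xy *.
  rewrite /c enorm_pline//; have [_ _ + _] := HF k; apply; [exact: (smem _ xs)|exact: (smem _ ys)|].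
  by apply: contraNneq xy => ->.
have := @replace_in_balls _ s b t P _ (fun x => b_ x.1) (fun x => t_ x.1) c (fun x => r x.1 x.2)
  t1 us aP EP.
move=> /(_ _ _)/le_trans; apply.
- move=> x xs; have [r0 _ cB st _] := cG x xs; split=> //.
  + by move=> y yx; apply: cB; rewrite /eball/=; apply: lt_trans yx _; lra.
  + by move=> y yx; apply: st; rewrite /eball/=; apply: lt_trans yx _; lra.
- move=> x y xs ys xy; rewrite -subset0 => z [zx zy].
  have := dist x y xs ys xy; rewrite leNgt => /negP; apply.
  apply: le_lt_trans (enorm_triangle z _ _) _; apply: ltrD => //.
  by rewrite -enormN opprB.
- rewrite /s big_allpairs_dep/= big_enum/= -sumrB.
  rewrite [leRHS](_ : _ = \sum_(k < N) l_ k * v (b_ k) (t_ k) + e' * (1 + \sum_(k < N) g k)); last first.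
    by rewrite /e' divfK// gt_eqF.
  rewrite mulrDr mulr1 mulr_sumr addrCA -big_split/= -[leLHS]add0r; apply: lerD; first exact: ltW.
  apply: ler_sum => k _; have [_ _ _] := HF k; rewrite -/(G k) -/(r k) => lk.
  rewrite -mulr_suml -/(g k).
  have : (l_ k - e') * g k <= (\sum_(i <- G k) 2 * r k i) * g k by apply: ler_wpM2r.
  by rewrite /g; lra.
Qed.

End Polyhedral.

End EnvelopePolyhedral.

(** * The detour construction and its triangle inequality *)

Definition normalize (R : realType) n (t : 'rV[R]_n) := (enorm t)^-1 *: t.

Lemma normalizeK (R : realType) n (t : 'rV[R]_n) : t != 0 -> enorm t *: normalize t = t.
Proof. by move=> t0; rewrite scalerA mulfV ?scale1r// gt_eqF// enorm_gt0. Qed.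

Lemma normalize_sphere (R : realType) n (t : 'rV[R]_n) : t != 0 -> sphere n (normalize t).
Proof.
move=> t0; rewrite /sphere/= enormZ ger0_norm ?invr_ge0 ?enorm_ge0//.
by rewrite mulVf// gt_eqF// enorm_gt0.
Qed.

Definition independent2 (R : realType) n (t1 t2 : 'rV[R]_n) :=
  forall x y, x *: t1 + y *: t2 = 0 -> x = 0 /\ y = 0.

Section Triangle.
Context {R : realType} {m n : nat}.
Variables (b b' : 'rV[int]_m) (t1 t2 : 'rV[R]_n).
Hypothesis indep : independent2 t1 t2.

Let t := t1 + t2.
Let u := normalize t.

Let t10 : t1 != 0.
Proof.
apply/negP => /eqP t10; have [] := @indep 1 0; last by move/eqP; rewrite oner_eq0.
by rewrite t10 scaler0 scale0r addr0.
Qed.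

Let t20 : t2 != 0.
Proof.
apply/negP => /eqP t20; have [] := @indep 0 1; last by move=> _ /eqP; rewrite oner_eq0.
by rewrite t20 scaler0 scale0r addr0.
Qed.

Let t0 : t != 0.
Proof.
apply/negP => /eqP t0; have [] := @indep 1 1; last by move/eqP; rewrite oner_eq0.
by rewrite !scale1r.
Qed.

Let n1 : 0 < enorm t1. Proof. by rewrite enorm_gt0. Qed.
Let n2 : 0 < enorm t2. Proof. by rewrite enorm_gt0. Qed.
Let nt : 0 < enorm t. Proof. by rewrite enorm_gt0. Qed.
Let ntle : enorm t <= enorm t1 + enorm t2. Proof. exact: enormD. Qed.

(** With this scale the detour has length 1/8, so the triangle stays well inside the ball of radius
    1/4. *)
Let k : R := (8 * (enorm t1 + enorm t2))^-1.

Let k0 : 0 < k. Proof. by rewrite invr_gt0 mulr_gt0// addr_gt0. Qed.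
Let kE : k * enorm t1 + k * enorm t2 = 8^-1.
Proof.
by rewrite -mulrDr /k invfM -mulrA mulVf ?mulr1// gt_eqF// addr_gt0.
Qed.
Let k1 : 0 < k * enorm t1. Proof. exact: mulr_gt0. Qed.
Let k2 : 0 < k * enorm t2. Proof. exact: mulr_gt0. Qed.
Let kt : 0 < k * enorm t. Proof. exact: mulr_gt0. Qed.
Let kt8 : k * enorm t <= 8^-1. Proof. by rewrite -kE -mulrDr ler_pM2l. Qed.

(** The diameter in direction u is cut at 0 and at k t. Its outer pieces carry b + b' and the middle
    piece b; the last two segments are the detour from 0 through k t1 to k t and carry b'. *)
Let b_ (i : 'I_5) := nth 0 [:: b + b'; b; b + b'; b'; b'] i.
Let p_ (i : 'I_5) := nth 0 [:: - (2^-1 *: u); 0; k *: t; 0; k *: t1] i.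
Let t_ (i : 'I_5) := nth 0 [:: u; u; u; normalize t1; normalize t2] i.
Let l_ (i : 'I_5) :=
  nth 0 [:: 2^-1; k * enorm t; 2^-1 - k * enorm t; k * enorm t1; k * enorm t2] i.
Let gamma_ i := oseg (p_ i) (t_ i) (l_ i).

(* the coordinates along t1, t2 of the points of the i-th segment *)
Let coords (i : 'I_5) x y := nth False
  [:: [/\ x = y, x < 0 & x < k]; [/\ x = y, 0 < x & x < k]; [/\ x = y, 0 < x & k < x];
      [/\ y = 0, 0 < x & x < k]; [/\ x = k, 0 < y & y < k]] i.

Let uE s : s *: u = (s / enorm t) *: t1 + (s / enorm t) *: t2.
Proof. by rewrite /u /normalize scalerA -scalerDr. Qed.

Let gamma_coords i z : gamma_ i z -> exists x y, z = x *: t1 + y *: t2 /\ coords i x y.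
Proof.
case: i => -[|[|[|[|[|//]]]]] lt [s /= + <-]; rewrite in_itv/p_/t_/l_/= => /andP[s0 sl].
- exists ((s - 2^-1) / enorm t), ((s - 2^-1) / enorm t); split.
    by rewrite -uE scalerBl addrC.
  have h : (s - 2^-1) / enorm t < 0 by rewrite pmulr_llt0 ?invr_gt0//; lra.
  by split=> //; exact: lt_trans h k0.
- exists (s / enorm t), (s / enorm t); split; first by rewrite -uE add0r.
  by split=> //; [rewrite divr_gt0|rewrite ltr_pdivrMr].
- exists (k + s / enorm t), (k + s / enorm t); split.
    by rewrite !scalerDl addrACA -uE scalerDr.
  by split=> //; [rewrite addr_gt0// divr_gt0|rewrite ltrDl divr_gt0].
- exists (s / enorm t1), 0; split; first by rewrite /normalize scalerA scale0r addr0 add0r.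
  by split=> //; [rewrite divr_gt0|rewrite ltr_pdivrMr].
- exists k, (s / enorm t2); split; first by rewrite /normalize scalerA.
  by split=> //; [rewrite divr_gt0|rewrite ltr_pdivrMr].
Qed.

Let gamma_disj i j : i != j -> gamma_ i `&` gamma_ j = set0.
Proof.
move=> ij; rewrite -subset0 => z [/gamma_coords[x [y [zE xy]]] /gamma_coords[x' [y' [z'E xy']]]].
have [/eqP xx /eqP yy] : x - x' = 0 /\ y - y' = 0.
  by apply: indep; rewrite !scalerBl addrACA -opprD -zE -z'E subrr.
move: xx yy; rewrite !subr_eq0 => /eqP xx /eqP yy; rewrite -{}xx -{}yy in xy'.
clear zE z'E; move: i j ij xy xy' => -[[|[|[|[|[|//]]]]] i5] -[[|[|[|[|[|//]]]]] j5] //= ij [? ? ?] [? ? ?];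
  try lra; by move: ij; rewrite eqE.
Qed.

Let u1 : sphere n u. Proof. exact: normalize_sphere. Qed.

Let gamma_small (i : 'I_5) z : ~~ ((val i == 0%N) || (val i == 2%N)) -> gamma_ i z -> eball 0 4^-1 z.
Proof.
move=> i02 /gamma_coords[x [y [-> xy]]].
have [x0 xk y0 yk] : [/\ 0 <= x, x <= k, 0 <= y & y <= k].
  by move: i i02 xy => -[[|[|[|[|[|//]]]]] i5] //= _ [? ? ?]; split; lra.
rewrite /eball/= subr0; apply: le_lt_trans (enormD _ _) _; rewrite !enormZ !ger0_norm//.
apply: (@le_lt_trans _ _ 8^-1); last by lra.
by rewrite -kE; apply: lerD; rewrite ler_pM2r.
Qed.

Let gamma_line (i : 'I_5) : (val i == 0%N) || (val i == 2%N) -> gamma_ i `<=` line u `&` Bhalf n.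
Proof.
rewrite line_oseg//; move: i => -[[|[|[|//]]] i5] //= _ _ [s /= + <-];
  rewrite in_itv/p_/t_/l_/= => /andP[s0 sl].
  by exists s => //=; rewrite in_itv/= s0/=; lra.
have kt' := kt; exists (s + k * enorm t + 2^-1); first by rewrite /= in_itv/=; apply/andP; split; lra.
rewrite -{2}(normalizeK t0) -/u (scalerA k) -scaleNr -!scalerDl; congr (_ *: _); ring.
Qed.

Let gammaP i : [/\ sphere n (t_ i), 0 < l_ i & gamma_ i `<=` Bhalf n].
Proof.
split.
- by case: i => -[|[|[|[|[|//]]]]] i5; rewrite /t_/=; do ?exact: normalize_sphere.
- have [h1 h2 h3 h4] := And4 kt8 kt k1 k2; case: i => -[|[|[|[|[|//]]]]] i5; rewrite /l_/=; lra.
- have [i02|i02] := boolP ((val i == 0%N) || (val i == 2%N)).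
    by move=> z /(gamma_line i02)[].
  move=> z /(gamma_small i02); rewrite /Bhalf/eball/= => /lt_trans; apply; lra.
Qed.

Let P := polyhedral b_ p_ t_ l_.

(** The multiplicities balance at the inner vertices 0, k t1 and k t. The two remaining endpoints
    lie on the boundary sphere, where test functions vanish. *)
Let P_Mdf : Mdf (Bhalf n) P.
Proof.
apply: (polyhedral_Mdf gammaP gamma_disj) => phi i tphi.
rewrite !big_ord_recl big_ord0 /b_/p_/t_/l_/=.
have e0 : - (2^-1 *: u) + 2^-1 *: u = 0 by rewrite addNr.
have e1 : 0 + (k * enorm t) *: u = k *: t by rewrite add0r -scalerA normalizeK.
have e2 : k *: t + (2^-1 - k * enorm t) *: u = 2^-1 *: u.
  by rewrite scalerBl -scalerA normalizeK// addrCA subrr addr0.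
have e3 : 0 + (k * enorm t1) *: normalize t1 = k *: t1 by rewrite add0r -scalerA normalizeK.
have e4 : k *: t1 + (k * enorm t2) *: normalize t2 = k *: t.
  by rewrite -scalerA normalizeK// -scalerDr.
rewrite e0 e1 e2 e3 e4.
rewrite (test_function_boundary tphi (t := 2^-1 *: u)) ?enorm_half//.
rewrite (test_function_boundary tphi (t := - (2^-1 *: u))) ?enormN ?enorm_half//.
by rewrite !mxE !rmorphD/=; ring.
Qed.

Let P_admissible : admissible (b + b') u P.
Proof.
split; first exact: P_Mdf.
exists 4^-1; first by apply/andP; split; lra.
move=> A mA AB; rewrite straight_vmeasure//.
have mA' := borel_H1measurable mA.
rewrite (polyhedral_vmeasure _ gammaP gamma_disj)// /poly_vmeasure.
have z (i : 'I_5) (c : 'rV[int]_m) w : ~~ ((val i == 0%N) || (val i == 2%N)) -> const_vmeasure c w (gamma_ i) A = 0.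
  move=> i02; rewrite /const_vmeasure (_ : _ `&` _ = set0) ?measure0 ?scale0r//.
  by rewrite -subset0 => x [/(gamma_small i02) gx /AB[]].
rewrite (_ : \sum_(i < 5) _ = \sum_(i < 5) const_vmeasure (b_ i) (t_ i) (gamma_ i) A)//.
rewrite !big_ord_recl big_ord0 (z (lift ord0 ord0))// (z (lift ord0 (lift ord0 (lift ord0 _))))//.
rewrite (z (lift ord0 (lift ord0 (lift ord0 (lift ord0 _)))))// !add0r addr0.
rewrite /const_vmeasure -scalerDl.
set i0 := ord0; set i2 := lift _ _.
have fin i : H1 (gamma_ i `&` A : set (H1space R n)) \is a fin_num.
  have mg : measurable (gamma_ i : set (H1space R n)) by apply: measurable_oseg; case: (gammaP i).
  rewrite ge0_fin_numE//; apply: (@le_lt_trans _ _ (H1 (gamma_ i : set (H1space R n)))).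
    by apply: le_measure; [rewrite inE; exact: measurableI|rewrite inE|exact: subIsetl].
  have [ti li _] := gammaP i.
  by rewrite [X in (X < _)%E](H1_oseg _ ti (ltW li)) ltry.
rewrite -fineD//; congr (fine _ *: _).
have mgA i : measurable (gamma_ i `&` A : set (H1space R n)).
  by apply: measurableI => //; apply: measurable_oseg; case: (gammaP i).
rewrite -measureU; [|exact: mgA|exact: mgA|by rewrite setIACA gamma_disj// set0I].
congr (hausdorff1 _); rewrite -setIUl; apply/seteqP; split=> x [gx Ax]; split=> //.
  by case: gx; exact: gamma_line.
have [_ xs] := AB _ Ax; have [[s _ sx] _] := gx; move: xs.
rewrite /eball/= subr0 -sx enormZ u1 mulr1 => /negP; rewrite -leNgt => s4.
have := gx; rewrite line_oseg// => -[s' /= + s'x]; rewrite in_itv/= => /andP[s'0 s'1].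
have ss' : s = s' - 2^-1.
  by apply: (can_inj (plineK (0 : 'rV[R]_n) u1)); rewrite /pline !add0r sx -s'x scalerBl addrC.
(* Points of the diameter outside the ball of radius 1/4 lie on an outer piece, on the right because
   k |t| is at most 1/8. *)
have [s0|s0] := ltP s 0; [left|right].
  exists s'; last by rewrite sx -s'x.
  by move: s4; rewrite ltr0_norm// /l_ /= in_itv/= s'0/=; lra.
exists (s - k * enorm t).
  have k8 := kt8; rewrite /l_ /= in_itv/=; move: s4; rewrite ger0_norm// => s4; apply/andP; split; lra.
by rewrite /p_/t_/= scalerBl -scalerA normalizeK// addrC subrK.
Qed.

Variable psi : 'rV[int]_m -> 'rV[R]_n -> R.
Hypothesis n0 : (0 < n)%N.
Hypothesis mpsi : forall b, measurable_fun (sphere n : set (borel R n)) (psi b).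
Hypothesis psi0 : forall b t, sphere n t -> 0 <= psi b t.

(* On an initial piece of the straight line with multiplicity b + b', the part b' takes the detour t1, t2. *)
Lemma envelope_ext_triangle :
  envelope_ext psi (b + b') (t1 + t2) <=
  envelope_ext psi b (t1 + t2) + envelope_ext psi b' t1 + envelope_ext psi b' t2.
Proof.
have := envelope_polyhedral n0 mpsi psi0 gammaP gamma_disj u1 P_admissible.
rewrite !big_ord_recl big_ord0 /b_/p_/t_/l_/=.
rewrite /envelope_ext -/(normalize t1) -/(normalize t2) -/(normalize (t1 + t2)) -/t -/u.
(* The outer pieces, of total length 1 - k |t|, carry the same multiplicity and direction as the
   left side. After cancellation every remaining term has the factor k. *)
move=> H; rewrite -(ler_pM2l k0); lra.
Qed.
End Triangle.

(** * Convexity, subadditivity, bounds and the Lipschitz estimate *)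

Section EnvelopeExt.
Context {R : realType} {m n : nat}.
Variables (psi : 'rV[int]_m -> 'rV[R]_n -> R) (c0 : R).
Hypothesis n1 : (1 < n)%N.
Hypothesis c00 : 0 < c0.
Hypothesis mpsi : forall b, measurable_fun (sphere n : set (borel R n)) (psi b).
Hypothesis psi0 : forall b t, sphere n t -> 0 <= psi b t.
Hypothesis psi_ge : forall b t, sphere n t -> c0 * enorm (zvec b : 'rV[R]_m) <= psi b t.
Hypothesis psi00 : forall t, sphere n t -> psi 0 t = 0.

Let n0 : (0 < n)%N. Proof. exact: ltnW. Qed.

Local Notation f := (envelope_ext psi).

Lemma envelope_ext_ge0 b t : 0 <= f b t.
Proof. by rewrite mulr_ge0 ?enorm_ge0// fine_ge0// envelope_ge0. Qed.

Lemma envelope_ext_sphere b t : sphere n t -> f b t = fine (envelope psi b t).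
Proof. by move=> t1; rewrite /envelope_ext t1 invr1 scale1r mulr1. Qed.

Lemma envelope_ext_at0 b : f b 0 = 0.
Proof. by rewrite /envelope_ext enorm0 mulr0. Qed.

Lemma envelope0 t : sphere n t -> envelope psi 0 t = 0%E.
Proof.
move=> t1; apply/eqP; rewrite eq_le envelope_ge0// andbT.
by have := envelope_le_psi n0 psi0 0 t1; rewrite psi00.
Qed.

Lemma envelope_ext0 t : f 0 t = 0.
Proof.
have [->|t0] := eqVneq t 0; first exact: envelope_ext_at0.
by rewrite /envelope_ext envelope0 ?mul0r//; exact: normalize_sphere.
Qed.

Lemma envelope_extZ b l t : 0 <= l -> f b (l *: t) = l * f b t.
Proof.
move=> l0; have [->|lN0] := eqVneq l 0; first by rewrite scale0r envelope_ext_at0 mul0r.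
rewrite /envelope_ext enormZ ger0_norm// invfM scalerA.
by rewrite [_ / _ * _]mulrAC mulVf// mul1r mulrCA.
Qed.

(** Independent vectors are covered by the detour with zero multiplicity on the straight part. For
    t1 = s t2 the claim follows from homogeneity and nonnegativity: t1 + t2 is a nonnegative
    multiple of t2 if s >= -1 and of t1 otherwise. *)
Lemma envelope_extD b t1 t2 : f b (t1 + t2) <= f b t1 + f b t2.
Proof.
have [ind|] := pselect (independent2 t1 t2).
  by have := envelope_ext_triangle 0 b ind n0 mpsi psi0; rewrite add0r envelope_ext0 add0r.
move=> /existsNP[x /existsNP[y /not_implyP[xy0 xy]]].
wlog x0 : t1 t2 x y xy0 xy / x != 0 => [H|].
  have [x0|] := eqVneq x 0; last exact: H xy0 xy.
  have [y0|y0] := eqVneq y 0; first by exfalso; apply: xy.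
  rewrite addrC [leRHS]addrC; apply: (H t2 t1 y x) => //; first by rewrite addrC.
  by move=> [? ?]; apply: xy.
have -> : t1 = (- (y / x)) *: t2.
  apply: (scalerI x0); rewrite scalerA mulrN mulrCA mulfV// mulr1 scaleNr.
  by apply/eqP; rewrite -addr_eq0 xy0.
move: (- (y / x)) => s; rewrite -{2}(scale1r t2) -scalerDl.
have f0 := envelope_ext_ge0.
have [s0|s0] := leP 0 s; first by rewrite !envelope_extZ ?addr_ge0// mulrDl mul1r.
have [s1|s1] := leP 0 (s + 1).
  rewrite envelope_extZ// mulrDl mul1r; apply: lerD => //.
  by apply: (le_trans _ (f0 _ _)); rewrite nmulr_rle0.
have -> : (s + 1) *: t2 = (1 + s^-1) *: (s *: t2).
  by rewrite scalerA mulrDl mul1r mulVf ?lt_eqF.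
have sV : s^-1 < 0 by rewrite invr_lt0.
have s11 : 0 <= 1 + s^-1.
  rewrite -(mulVf (x := s)) ?lt_eqF// -[X in _ + X]mulr1 -mulrDr nmulr_rge0//; exact: ltW.
rewrite envelope_extZ// mulrDl mul1r; apply: lerD => //.
by apply: (le_trans _ (f0 _ _)); rewrite nmulr_rle0.
Qed.

Lemma convex_envelope_ext b : convex_function [set: 'rV[R]_n] (f b).
Proof.
move=> l x y _ _.
have := envelope_extD b (l%:inum *: (x : 'rV[R]_n)) ((1 - l%:inum) *: (y : 'rV[R]_n)).
by rewrite !envelope_extZ ?subr_ge0 ?ge0 ?le1.
Qed.

(** A linear bound in t obtained from the values at the 2n signed unit vectors, since no growth
    bound on psi from above is available. *)
Let K b := \sum_(i < n) (f b (delta_mx ord0 i) + f b (- delta_mx ord0 i)).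

Lemma envelope_ext_le b t : f b t <= K b * enorm t.
Proof.
have f0 := envelope_ext_ge0.
rewrite [in leLHS](row_sum_coord t) mulr_suml.
apply: (@le_trans _ _ (\sum_(i < n) f b (t ord0 i *: delta_mx ord0 i))).
  apply: (big_ind2 (fun x y => f b x <= y)); [by rewrite envelope_ext_at0| |by []].
  by move=> x1 y1 x2 y2 h1 h2; apply: le_trans (envelope_extD _ _ _) _; exact: lerD.
apply: ler_sum => i _; apply: (@le_trans _ _ ((f b (delta_mx ord0 i) + f b (- delta_mx ord0 i)) * `|t ord0 i|)).
  have [ti|ti] := leP 0 (t ord0 i).
    by rewrite envelope_extZ// ger0_norm// mulrC; apply: ler_wpM2r => //; rewrite lerDl.
  rewrite -[X in f b X]opprK -scaleNr -scalerN envelope_extZ; last by rewrite oppr_ge0 ltW.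
  rewrite ltr0_norm// mulrC; apply: ler_wpM2r; first by rewrite oppr_ge0 ltW.
  by rewrite lerDr.
by rewrite ler_wpM2l ?addr_ge0// coord_enorm.
Qed.

Lemma envelope_ext_lipschitz b t t' : f b t - f b t' <= f b (t - t').
Proof. by rewrite lerBlDr -{1}(subrK t' t) envelope_extD. Qed.

Lemma exists_independent (t : 'rV[R]_n) : t != 0 -> exists e, independent2 t e.
Proof.
move=> t0; have [i ti] : exists i, t ord0 i != 0.
  apply: contrapT => ti; move/negP: t0; apply; apply/eqP/rowP => i; rewrite mxE.
  by apply/eqP/negPn/negP => ti0; apply: ti; exists i.
have [j ij] : exists j : 'I_n, j != i.
  have [i0|i0] := eqVneq (val i) 0%N; [exists (Ordinal n1)|exists (Ordinal n0)]; rewrite -val_eqE/=.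
    by rewrite i0.
  by rewrite eq_sym.
exists (delta_mx ord0 j) => x y /rowP xy.
have x0 : x = 0.
  have := xy i; rewrite !mxE eqxx/= (negbTE _ : (i == j) = false) ?(eq_sym i)// mulr0 addr0.
  by move/eqP; rewrite mulf_eq0 (negbTE ti) orbF => /eqP.
by split=> //; have := xy j; rewrite x0 !mxE !eqxx mul0r add0r mulr1.
Qed.

(** A thin triangle over the straight line: sides t/2 + d e and t/2 - d e are independent for d > 0
    and cost at most f(b', t) + d C. The vector e comes from [exists_independent]. *)
Lemma envelope_ext_subadd b b' t : f (b + b') t <= f b t + f b' t.
Proof.
have [->|t0] := eqVneq t 0; first by rewrite !envelope_ext_at0 addr0.
have [e te] := exists_independent t0.
pose C := f b' e + f b' (- e).
have C0 : 0 <= C by rewrite addr_ge0 ?envelope_ext_ge0.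
apply/ler_addgt0Pr => eps eps0.
have [d d0 h3] : exists2 d : R, 0 < d & d * C <= eps.
  exists (eps / (C + 1)); first by rewrite divr_gt0// ltr_wpDl.
  by rewrite mulrAC ler_pdivrMr ?ltr_wpDl// ler_pM2l// lerDl.
pose t1 := 2^-1 *: t + d *: e; pose t2 := 2^-1 *: t + d *: (- e).
have tE : t = t1 + t2.
  by rewrite addrACA scalerN subrr addr0 -scalerDl -[LHS]scale1r; congr (_ *: _); lra.
have ind : independent2 t1 t2.
  move=> x y xy; have [/eqP h1 /eqP h2] : (x + y) / 2 = 0 /\ (x - y) * d = 0.
    apply: te; rewrite -{}xy /t1 /t2 !scalerDr !scalerN !scalerA addrACA -scalerDl -scalerBl.
    by congr (_ *: _ + _ *: _); ring.
  move: h1 h2; rewrite !mulf_eq0 invr_eq0 pnatr_eq0/= orbF (gt_eqF d0) orbF => /eqP h1 /eqP h2.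
  by split; lra.
have := envelope_ext_triangle b b' ind n0 mpsi psi0; rewrite -tE => /le_trans; apply.
rewrite -!addrA lerD2l.
have h1 : f b' t1 <= 2^-1 * f b' t + d * f b' e.
  by apply: le_trans (envelope_extD _ _ _) _; rewrite !envelope_extZ// ltW.
have h2 : f b' t2 <= 2^-1 * f b' t + d * f b' (- e).
  by apply: le_trans (envelope_extD _ _ _) _; rewrite !envelope_extZ// ltW.
by rewrite /C in h3; lra.
Qed.

Lemma envelope_ext_nat b k t : f (b *+ k) t <= k%:R * f b t.
Proof.
elim: k => [|k IH]; first by rewrite mulr0n mul0r envelope_ext0.
rewrite mulrS -natr1 mulrDl mul1r addrC; apply: le_trans (envelope_ext_subadd _ _ _) _.
exact: lerD.
Qed.

Let C := \sum_(j < m) (K (delta_mx ord0 j) + K (- delta_mx ord0 j)).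

Let K_ge0 b : 0 <= K b.
Proof. by apply: sumr_ge0 => i _; rewrite addr_ge0 ?envelope_ext_ge0. Qed.

Let C_ge0 : 0 <= C.
Proof. by apply: sumr_ge0 => j _; rewrite addr_ge0. Qed.

(** Expand b in the basis of Z^m: subadditivity bounds the value by multiples of those at signed
    basis vectors, to which [envelope_ext_le] applies. *)
Lemma envelope_ext_upper b t : f b t <= C * enorm (zvec b : 'rV[R]_m) * enorm t.
Proof.
have bE : b = \sum_(j < m) b ord0 j *: delta_mx ord0 j.
  by rewrite {1}(matrix_sum_delta b) big_ord1.
rewrite {1}bE; apply: (@le_trans _ _ (\sum_(j < m) f (b ord0 j *: delta_mx ord0 j) t)).
  apply: (big_ind2 (fun x y => f x t <= y)); [by rewrite envelope_ext0| |by []].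
  by move=> x1 y1 x2 y2 h1 h2; apply: le_trans (envelope_ext_subadd _ _ _) _; exact: lerD.
rewrite mulrAC [C * _]mulr_suml mulr_suml; apply: ler_sum => j _.
have bj : `|(b ord0 j)%:~R : R| <= enorm (zvec b : 'rV[R]_m).
  by have := coord_enorm (zvec b : 'rV[R]_m) j; rewrite mxE.
apply: (@le_trans _ _ ((K (delta_mx ord0 j) + K (- delta_mx ord0 j)) * enorm t * `|(b ord0 j)%:~R|)); last first.
  by rewrite ler_wpM2l// mulr_ge0 ?enorm_ge0 ?addr_ge0.
have nn x : 0 <= f x t by exact: envelope_ext_ge0.
case: (b ord0 j) => k.
  rewrite (_ : _ *: _ = delta_mx ord0 j *+ k); last by rewrite -[Posz k]natz scaler_nat.
  apply: le_trans (envelope_ext_nat _ _ _) _; rewrite mulrC ger0_norm ?ler0n//.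
  apply: ler_wpM2r => //; apply: le_trans (envelope_ext_le _ _) _.
  by rewrite ler_wpM2r ?enorm_ge0// lerDl.
rewrite (_ : _ *: _ = (- delta_mx ord0 j) *+ k.+1); last first.
  by rewrite NegzE -natz scaleNr mulNrn scaler_nat.
apply: le_trans (envelope_ext_nat _ _ _) _; rewrite mulrC NegzE rmorphN normrN ger0_norm ?ler0n//.
apply: ler_wpM2r => //; apply: le_trans (envelope_ext_le _ _) _.
by rewrite ler_wpM2r ?enorm_ge0// lerDr.
Qed.

Lemma continuous_envelope b : {within sphere n, continuous (envelope psi b)}.
Proof.
apply: (@subspace_eq_continuous _ _ _ (EFin \o f b)).
  by move=> t /set_mem t1 /=; rewrite envelope_ext_sphere// fineK// envelope_fin.
apply: continuous_subspaceT => t; apply: (@cvg_EFin _ _ (nbhs t) (nbhs_filter t)); first exact: nearW.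
suff : (f b : _ -> R^o) x @[x --> t] --> (f b t : R^o) by [].
apply/(@cvgrPdist_le _ R^o _ (nbhs t) (nbhs_filter t)) => e e0.
set M := C * enorm (zvec b : 'rV[R]_m).
have M0 : 0 <= M by rewrite mulr_ge0// enorm_ge0.
have r0 : 0 < e / (M + 1) by rewrite divr_gt0// ltr_wpDl.
near=> x.
have xt : enorm (x - t) <= e / (M + 1).
  by apply: ltW; near: x; exact: (eball_nbhs t r0).
have Me : M * enorm (x - t) <= e.
  apply: (@le_trans _ _ (M * (e / (M + 1)))); first exact: ler_wpM2l.
  by rewrite mulrA ler_pdivrMr ?ltr_wpDl// mulrC ler_pM2l// lerDl.
rewrite ler_norml; apply/andP; split.
  rewrite lerNl opprB; apply: le_trans (envelope_ext_lipschitz _ _ _) _.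
  exact: le_trans (envelope_ext_upper _ _) Me.
apply: le_trans (envelope_ext_lipschitz _ _ _) _.
by apply: le_trans (envelope_ext_upper _ _) _; rewrite enormB.
Unshelve. all: by end_near.
Qed.

(** [C] serves the upper and Lipschitz bounds, the quotient by c0 serves the lower bound, and 1
    ensures positivity. *)
Let c := C + (n * m)%:R / c0 + 1.

Let nm0 : 0 <= (n * m)%:R / c0. Proof. by rewrite divr_ge0// ltW. Qed.

(** For the Lipschitz estimate first t is changed at fixed b, then b at fixed t'. In each case
    subadditivity bounds the increment by the value at the difference. *)
Lemma envelope_bounds : exists c, 0 < c /\
  [/\ forall b t, sphere n t ->
        ((c^-1 * enorm (zvec b : 'rV[R]_m))%:E <= envelope psi b t)%E /\
        (envelope psi b t <= (c * enorm (zvec b : 'rV[R]_m))%:E)%E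
    & forall b b' t t', sphere n t -> sphere n t' ->
        `|fine (envelope psi b t) - fine (envelope psi b' t')|
          <= c * enorm (zvec (b - b') : 'rV[R]_m)
             + c * enorm (zvec b : 'rV[R]_m) * enorm (t - t')].
Proof.
have c0' : 0 < c by rewrite /c ltr_wpDl// addr_ge0.
have Cc : C <= c by rewrite /c -addrA lerDl addr_ge0.
have up b t : f b t <= c * enorm (zvec b : 'rV[R]_m) * enorm t.
  apply: le_trans (envelope_ext_upper _ _) _; apply: ler_wpM2r; first exact: enorm_ge0.
  by apply: ler_wpM2r => //; exact: enorm_ge0.
exists c; split=> //; split=> [b t t1|b b' t t' t1 t1'].
  split; last first.
    rewrite -envelope_fineE// lee_fin -envelope_ext_sphere//.
    by have := up b t; rewrite t1 mulr1.
  rewrite envelopeE//; apply: le_ereal_inf_tmp => _ [d ad <-].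
  have := energy_lower_bound mpsi psi0 c00 t1 psi_ge ad.
  have := energy_ge0 psi0 ad; case: (energy _ _ _) => [r|_ _|//]; last exact: leey.
  rewrite -EFinM !lee_fin => r0 H.
  rewrite ler_pdivrMl//; apply: (@le_trans _ _ ((n * m)%:R / c0 * r)).
    by rewrite mulrAC ler_pdivlMr// mulrC.
  by apply: ler_wpM2r => //; rewrite /c addrAC lerDr addr_ge0.
rewrite -!envelope_ext_sphere//.
have N (x : 'rV[int]_m) : enorm (zvec (- x) : 'rV[R]_m) = enorm (zvec x : 'rV[R]_m).
  by rewrite -enormN; congr enorm; apply/rowP => i; rewrite !mxE rmorphN opprK.
have h1 := le_trans (envelope_ext_lipschitz b t t') (up b _).
have h2 := le_trans (envelope_ext_lipschitz b t' t) (up b _); rewrite enormB in h2.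
have h3 : f b t' - f b' t' <= c * enorm (zvec (b - b') : 'rV[R]_m).
  rewrite lerBlDr; have := envelope_ext_subadd (b - b') b' t'; rewrite subrK => /le_trans; apply.
  by rewrite lerD2r; have := up (b - b') t'; rewrite t1' mulr1.
have h4 : f b' t' - f b t' <= c * enorm (zvec (b - b') : 'rV[R]_m).
  rewrite lerBlDr; have := envelope_ext_subadd (b' - b) b t'; rewrite subrK => /le_trans; apply.
  by rewrite lerD2r; have := up (b' - b) t'; rewrite t1' mulr1 -N opprB.
by rewrite ler_norml; apply/andP; split; lra.
Qed.
End EnvelopeExt.

(** * Uniqueness of the factors of a rank-one density *)

(** Both the line and the matrix of b and t are unchanged by the simultaneous change of sign, so the
    competitors are the same. *)
Lemma envelopeN (R : realType) (m n : nat) (psi : 'rV[int]_m -> 'rV[R]_n -> R) b t :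
  envelope psi (- b) (- t) = envelope psi b t.
Proof.
suff E : @const_vmeasure R m n (- b) (- t) (line (- t) `&` Bhalf n) =
    const_vmeasure b t (line t `&` Bhalf n) by rewrite /envelope /straight_near_boundary E.
have -> : line (- t) = line t.
  by apply/seteqP; split=> _ [s _ <-]; exists (- s) => //; rewrite scalerN scaleNr ?opprK.
apply/funext => A; congr (_ *: _); rewrite /tensor mulmxN -mulNmx; congr (_ *m _).
by apply/matrixP => i j; rewrite !mxE rmorphN opprK.
Qed.

Lemma zvec_eq0 (R : realType) (m : nat) (b : 'rV[int]_m) : (zvec b : 'rV[R]_m) = 0 -> b = 0.
Proof.
move=> /rowP b0; apply/rowP => i; have := b0 i; rewrite !mxE => /eqP.
by rewrite intr_eq0 => /eqP.
Qed.

(** With s the scalar product of t and t', multiplying by t gives b = s b'. If b' is nonzero then t'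
    = s t as well, and both vectors being of unit length forces s to be 1 or -1. *)
Lemma tensor_eq (R : realType) (m n : nat) (b b' : 'rV[int]_m) (t t' : 'rV[R]_n) :
  sphere n t -> sphere n t' -> tensor b t = tensor b' t' ->
  [\/ b = 0 /\ b' = 0, b = b' /\ t = t' | b = - b' /\ t = - t'].
Proof.
move=> t1 t1' E; have {}E i j : zvec b ord0 i * t ord0 j = zvec b' ord0 i * t' ord0 j.
  by rewrite -!tensorE E.
pose s := dot t t'.
have bs : zvec b = s *: zvec b'.
  apply/rowP => i; rewrite [RHS]mxE -[LHS]mulr1 -(sphere_dot t1) /dot mulr_sumr.
  rewrite /s /dot mulr_suml; apply: eq_bigr => j _.
  by rewrite mulrA E; ring.
have [b'0|b'0] := eqVneq (zvec b' : 'rV[R]_m) 0.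
  by constructor 1; split; apply: (@zvec_eq0 R) => //; rewrite bs b'0 scaler0.
have [i bi] : exists i, zvec b' ord0 i != 0 :> R.
  apply: contrapT => bi; move/negP: b'0; apply; apply/eqP/rowP => i; rewrite [RHS]mxE.
  by apply/eqP/negPn/negP => bi0; apply: bi; exists i.
have t's : t' = s *: t.
  apply/rowP => j; rewrite [RHS]mxE; apply: (mulfI bi).
  by rewrite -E bs [X in X * _]mxE mulrCA mulrA.
have s1 : s ^+ 2 = 1.
  by have := sphere_dot t1'; rewrite {1 2}t's dotZl dotZr sphere_dot// mulr1 expr2.
have zinj x y : zvec x = zvec y :> 'rV[R]_m -> x = y.
  move=> xy; apply/eqP; rewrite -subr_eq0; apply/eqP/(@zvec_eq0 R).
  by move/rowP: xy => xy; apply/rowP => k; have := xy k; rewrite !mxE rmorphB/= => ->; rewrite subrr.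
move/eqP: s1; rewrite sqrf_eq1 => /orP[] /eqP s1.
  by constructor 2; split; [apply: zinj; rewrite bs s1 scale1r|rewrite t's s1 scale1r].
constructor 3; split; last by rewrite t's s1 scaleN1r opprK.
by apply: zinj; rewrite bs s1 scaleN1r; apply/rowP => k; rewrite !mxE rmorphN.
Qed.

(** * The relaxed energy of a polyhedral measure *)

Section EnergyPolyhedral.
Context {R : realType} {m n : nat}.
Variables (psi : 'rV[int]_m -> 'rV[R]_n -> R).
Hypothesis n1 : (1 < n)%N.
Hypothesis mpsi : forall b, measurable_fun (sphere n : set (borel R n)) (psi b).
Hypothesis psi0 : forall b t, sphere n t -> 0 <= psi b t.
Hypothesis psi00 : forall t, sphere n t -> psi 0 t = 0.

Let n0 : (0 < n)%N. Proof. exact: ltnW. Qed.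

(** The envelope density is a function of the matrix alone: the sign ambiguity is harmless by
    [envelopeN], and points with zero multiplicity contribute 0, as do points off the carrier. *)
Lemma envelope_density_eq (d d' : current R m n) x : current_regular d -> current_regular d' ->
  (forall i j, density d i j x = density d' i j x) ->
  ((fun x => envelope psi (mult d x) (tang d x)) \_ (carrier d) : _ -> \bar R) x =
  ((fun x => envelope psi (mult d' x) (tang d' x)) \_ (carrier d') : _ -> \bar R) x.
Proof.
wlog: d d' / carrier d x => [H|cx] rd rd' E.
  have [cx|cx] := pselect (carrier d x); first exact: (H d d' cx rd rd' E).
  have [cx'|cx'] := pselect (carrier d' x).
    by apply/esym/(H d' d cx' rd' rd) => i j; exact/esym/E.
  by rewrite !patchE !memNset.
have [_ _ st _ _] := rd; have [_ _ st' _ _] := rd'.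
have z0 (a : 'rV[int]_m) (t : 'rV[R]_n) : sphere n t -> tensor a t = 0 -> a = 0.
  move=> t1 a0; have E0 : tensor a t = tensor 0 t.
    by rewrite a0 /tensor (_ : zvec 0 = 0) ?trmx0 ?mul0mx//; apply/rowP => i; rewrite !mxE.
  by have [[]|[]|[->]] := tensor_eq t1 t1 E0; rewrite ?oppr0.
have tE i j : tensor (mult d x) (tang d x) i j = density d' i j x.
  by rewrite -E density_in// tensorE.
have [cx'|cx'] := pselect (carrier d' x); rewrite !patchE mem_set//; last first.
  rewrite memNset// (z0 (mult d x) (tang d x) (st _ cx)); last first.
    by apply/matrixP => i j; rewrite tE density_out// mxE.
  exact: (envelope0 n1 psi0 psi00 (st _ cx)).
rewrite mem_set//.
have /tensor_eq : tensor (mult d x) (tang d x) = tensor (mult d' x) (tang d' x).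
  by apply/matrixP => i j; rewrite tE density_in// tensorE.
case/(_ (st _ cx) (st' _ cx')) => -[-> ->]; rewrite ?envelopeN//.
by rewrite !(envelope0 n1 psi0 psi00)//; [exact: st'|exact: st].
Qed.

Variables (N : nat) (b_ : 'I_N -> 'rV[int]_m) (p_ t_ : 'I_N -> 'rV[R]_n) (l_ : 'I_N -> R).
Let gamma_ i := oseg (p_ i) (t_ i) (l_ i).
Hypothesis gammaP : forall i, [/\ sphere n (t_ i), 0 < l_ i & gamma_ i `<=` Bhalf n].
Hypothesis gamma_disj : forall i j, i != j -> gamma_ i `&` gamma_ j = set0.
Variable d : current R m n.
Hypothesis Md : Mdf (Bhalf n) d.
Hypothesis dP : eq_vmeasure_on (Bhalf n) (vmeasure_of d) (poly_vmeasure b_ t_ gamma_).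

Local Notation P := (polyhedral b_ p_ t_ l_).

Let dreg : current_regular d. Proof. exact: Mdf_regular Md. Qed.
Let Preg : current_regular P. Proof. exact: polyhedral_regular. Qed.

Let mB : measurable (Bhalf n : set (borel R n)).
Proof. by apply: sub_sigma_algebra; exact: open_eball. Qed.

Let dP' : eq_vmeasure_on (Bhalf n) (vmeasure_of d) (vmeasure_of P).
Proof.
move=> A mA AB; rewrite (polyhedral_vmeasure _ gammaP gamma_disj); first exact: dP.
exact: borel_H1measurable.
Qed.

(** Divergence-freeness depends only on the measure, so it passes from the given representation [d]
    to the canonical polyhedral current. *)
Lemma polyhedral_Mdf_of_eq : Mdf (Bhalf n) P.
Proof.
apply: (polyhedral_Mdf gammaP gamma_disj) => phi i [sphi [K [cK KB K0]]].
rewrite -(polyhedral_pairing _ gammaP gamma_disj)//.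
have [_ _ _ /divergence_free_pairing dd] := Md.
rewrite -(dd phi i); last by split=> //; exists K.
have dPT : eq_vmeasure_on (setT `&` Bhalf n) (vmeasure_of d) (vmeasure_of P) by rewrite setTI.
apply: eq_bigr => j _; apply/esym.
exact: (eq_Rintegral_density i j (smooth_partial_continuous (j := j) sphi) dreg Preg
  measurableT (fun x xN => False_ind _ (xN I)) dPT).
Qed.

Lemma admissible_polyhedral b t : sphere n t ->
  straight_near_boundary (poly_vmeasure b_ t_ gamma_) b t -> admissible b t P.
Proof.
move=> t1 /(straight_near_boundaryE _ _ n0 t1)[r r0 E]; split; first exact: polyhedral_Mdf_of_eq.
exists r => // A mA AB; rewrite -(E A mA AB) -dP' ?dP// => x /AB[]//.
Qed.

(** The densities of [d] and of the polyhedral current agree almost everywhere, hence so do the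
    envelope integrands, and the polyhedral energy is an explicit sum. *)
Lemma energy_of_eq : Ebar psi d (Bhalf n) = (\sum_(i < N) H1 (gamma_ i) * envelope psi (b_ i) (t_ i))%E.
Proof.
have tk k : sphere n (t_ k) by case: (gammaP k).
pose c k := fine (envelope psi (b_ k) (t_ k)).
have cE k : envelope psi (b_ k) (t_ k) = (c k)%:E by rewrite envelope_fineE.
have c0 k : 0 <= c k by rewrite fine_ge0// envelope_ge0.
rewrite (eq_bigr (fun k => (l_ k)%:E * (c k)%:E)%E); last first.
  by move=> k _; rewrite cE [X in (X * _)%E]H1_gamma.
rewrite -(polyhedral_energy gammaP gamma_disj c0 cE).
have [_ _] : rectifiable1 (carrier d) by case: Md => -[].
have dB : carrier d `<=` Bhalf n by case: Md => -[].
have PB : carrier P `<=` Bhalf n by exact: carrier_polyhedral_Bhalf.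
rewrite /Ebar /energy (setIidl dB) (setIidl PB) => _.
pose g (e : current R m n) : H1space R n -> \bar R :=
  (fun x => envelope psi (mult e x) (tang e x)) \_ (carrier e).
have gE (e : current R m n) :
    (\int[H1]_(x in (carrier e : set (H1space R n))) envelope psi (mult e x) (tang e x) =
    \int[H1]_(x in [set: H1space R n]) g e x)%E.
  by rewrite integral_mkcond.
rewrite (gE d) (gE P).
have mP : measurable_fun [set: H1space R n] (g P).
  have -> : g P = EFin \o (fun x => \sum_(k < N) (if x \in gamma_ k then c k else 0)).
    apply/funext => x; rewrite /g patchE [RHS]/=; case: ifPn => [/set_mem[k _ gx]|/negP gx].
      by rewrite (polyhedral_mult _ gamma_disj gx) (polyhedral_tang _ gamma_disj gx) cE (sum_gamma gamma_disj _ gx).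
    by rewrite sum_gamma0// => gx'; apply: gx; exact: mem_set.
  by apply/measurable_EFinP; exact: measurable_sum_gamma.
have ae : ae_eq H1 [set: H1space R n] (g P) (g d).
  have : {ae H1, forall x : H1space R n, forall ij : 'I_m * 'I_n,
      Bhalf n x -> density d ij.1 ij.2 x = density P ij.1 ij.2 x}.
    apply: filter_forall => ij; exact: density_ae.
  apply: filterS => x H _; have [Bx|Bx] := pselect (Bhalf n x).
    by apply/esym/envelope_density_eq => // i j; exact: (H (i, j)).
  by rewrite /g !patchE !memNset// => [/dB|/PB].
(* Measurability of the integrand of [d] is inherited from the polyhedral one, since H^1 is
   complete. *)
have md := ae_measurable_fun (@measure_is_complete_caratheodory _ _ (H1_outer R n)) ae mP.
have E := ae_eq_integral (g d) (g P) measurableT mP md ae.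
exact: esym E.
Qed.

End EnergyPolyhedral.

(** * Assembly of the five items with a common constant *)

Theorem lemma3p2 (R : realType) (m n : nat) (psi : 'rV[int]_m -> 'rV[R]_n -> R)
    (c0 : R) :
  (1 < n)%N ->
  0 < c0 ->
  (forall b, measurable_fun (sphere n : set (borel R n)) (psi b)) ->
  (forall b t, sphere n t -> 0 <= psi b t) ->
  (forall b t, sphere n t -> c0 * enorm (zvec b : 'rV[R]_m) <= psi b t) ->
  (forall t, sphere n t -> psi 0 t = 0) ->
  exists c : R, 0 < c /\
  [/\ (* 1 *)
      forall (N : nat) (b_ : 'I_N -> 'rV[int]_m) (p_ t_ : 'I_N -> 'rV[R]_n)
             (l_ : 'I_N -> R) (b : 'rV[int]_m) (t : 'rV[R]_n)
             (d : current R m n),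
        let gamma_ i := oseg (p_ i) (t_ i) (l_ i) in
        (forall i, [/\ sphere n (t_ i), 0 < l_ i & gamma_ i `<=` Bhalf n]) ->
        (forall i j, i != j -> gamma_ i `&` gamma_ j = set0) ->
        Mdf (Bhalf n) d ->
        eq_vmeasure_on (Bhalf n) (vmeasure_of d) (poly_vmeasure b_ t_ gamma_) ->
        sphere n t ->
        straight_near_boundary (poly_vmeasure b_ t_ gamma_) b t ->
        (envelope psi b t
           <= \sum_(i < N) H1 (gamma_ i) * envelope psi (b_ i) (t_ i))%E /\
        (\sum_(i < N) H1 (gamma_ i) * envelope psi (b_ i) (t_ i))%E
           = Ebar psi d (Bhalf n),
      (* 2 *)
      (forall b, convex_function [set: 'rV[R]_n] (envelope_ext psi b)) /\
      (forall b, {within sphere n, continuous (envelope psi b)}),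
      (* 3 *)
      forall b b' t, sphere n t ->
        (envelope psi (b + b') t <= envelope psi b t + envelope psi b' t)%E,
      (* 4 *)
      forall b t, sphere n t ->
        ((c^-1 * enorm (zvec b : 'rV[R]_m))%:E <= envelope psi b t)%E /\
        (envelope psi b t <= (c * enorm (zvec b : 'rV[R]_m))%:E)%E
    & (* 5 *)
      forall b b' t t', sphere n t -> sphere n t' ->
        `|fine (envelope psi b t) - fine (envelope psi b' t')|
          <= c * enorm (zvec (b - b') : 'rV[R]_m)
             + c * enorm (zvec b : 'rV[R]_m) * enorm (t - t')].
Proof.
move=> n1 c00 mpsi psi0 psi_ge psi00; have n0 : (0 < n)%N by exact: ltnW.
have [c [cgt0 [bnd lip]]] := envelope_bounds n1 c00 mpsi psi0 psi_ge psi00.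
exists c; split=> //; split=> //.
- move=> N b_ p_ t_ l_ b t d gamma_ gammaP gamma_disj Md dP t1 sb.
  rewrite (energy_of_eq n1 psi0 psi00 gammaP gamma_disj Md dP); split=> //.
  have aP := admissible_polyhedral n1 gammaP gamma_disj Md dP t1 sb.
  rewrite -(envelope_fineE n0 psi0 b t1).
  rewrite (eq_bigr (fun k => (l_ k * fine (envelope psi (b_ k) (t_ k)))%:E)) => [|k _].
    rewrite sumEFin lee_fin.
    exact: (envelope_polyhedral n0 mpsi psi0 gammaP gamma_disj t1 aP).
  have [tk _ _] := gammaP k.
  by rewrite EFinM (envelope_fineE n0 psi0 _ tk) [X in (X * _)%E](H1_gamma gammaP).
- split=> b; first exact: (convex_envelope_ext n1 mpsi psi0 psi00).
  exact: (continuous_envelope n1 mpsi psi0 psi00).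
- move=> b b' t t1.
  have := envelope_ext_subadd n1 mpsi psi0 psi00 b b' t.
  by rewrite !(envelope_ext_sphere psi _ t1) -lee_fin EFinD !(envelope_fineE n0 psi0 _ t1).
Qed.
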